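(* Let $\varphi:\overline{\mathbb{D}}\to\overline{\mathbb{D}}$, $\varphi\in A(\mathbb{D})$, be a symbol which does not have a Denjoy-Wolff point in the open disc $\mathbb{D}$. Let $C_\varphi:A(\mathbb{D})\to A(\mathbb{D})$, $C_\varphi f=f\circ\varphi$. The following are equivalent: (i) $C_\varphi$ is mean ergodic on $A(\mathbb{D})$; (ii) $\varphi$ is an elliptic automorphism, or $\varphi$ has a Denjoy-Wolff point $z_0\in\partial\mathbb{D}$ and for every $z\in\overline{\mathbb{D}}$ and every neighborhood $U$ of $z_0$ the set $\{n\in\mathbb{N}:\varphi^n(z)\in U\}$ has density $1$. In this case, $C_\varphi$ is uniformly mean ergodic on $A(\mathbb{D})$ if and only if $\varphi$ is a periodic elliptic automorphism.
   Context: $\mathbb{D}$ is the open unit disc in $\mathbb{C}$. $A(\mathbb{D})$ is the disc algebra: the Banach space of functions continuous on $\overline{\mathbb{D}}$ and holomorphic on $\mathbb{D}$, with the sup norm. A symbol is a holomorphic map $\varphi$ with $\varphi(\mathbb{D})\subseteq\mathbb{D}$. $\varphi^n=\varphi\circ\cdots\circ\varphi$ ($n$ times). A bounded operator $T$ on a Banach space $X$ is mean ergodic if $T_{[n]}=\frac1n\sum_{m=1}^nT^m$ converges in the strong operator topology to some bounded operator on $X$, and uniformly mean ergodic if it converges in operator norm. A set $J\subseteq\mathbb{N}$ has density $d$ if $\lim_{N\to\infty}\frac{\#(J\cap[0,N])}{N}=d$. An elliptic automorphism is a bijective holomorphic self-map of $\mathbb{D}$ of the form $\phi\circ\varphi_\lambda\circ\phi^{-1}$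 with $\phi$ an automorphism of $\mathbb{D}$ and $\varphi_\lambda(z)=\lambda z$, $|\lambda|=1$ (the identity, $\lambda=1$, is included); it is periodic if $\lambda^k=1$ for some integer $k\ge1$. If a symbol $\varphi$ is not an elliptic automorphism, the Denjoy-Wolff theorem gives a unique point $z_0\in\overline{\mathbb{D}}$, the Denjoy-Wolff point of $\varphi$, such that $\varphi^n\to z_0$ uniformly on compact subsets of $\mathbb{D}$. *)

(* Defs.v *)
From HB Require Import structures.
From mathcomp Require Import all_boot all_order all_algebra.
From mathcomp Require Import all_classical all_reals all_analysis.
From mathcomp Require Import complex.

Set Implicit Arguments.
Unset Strict Implicit.
Unset Printing Implicit Defensive.

Import Order.TTheory GRing.Theory Num.Theory.
Import numFieldNormedType.Exports.

Local Open Scope classical_set_scope.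
Local Open Scope ring_scope.
Local Open Scope complex_scope.

(* [numFieldNormedType] equips abstract number fields with their topology, but
   its instances are not found on the concrete type [R[i]]. *)
Set Warnings "-redundant-canonical-projection".
HB.instance Definition _ (R : rcfType) := GRing.ComAlgebra.copy R[i] R[i]^o.
HB.instance Definition _ (R : rcfType) := Vector.copy R[i] R[i]^o.
HB.instance Definition _ (R : rcfType) := NormedModule.copy R[i] R[i]^o.

Section ErgodicOperators.

Definition cesaro_mean (K : numFieldType) (X : normedModType K)
    (T : X -> X) (n : nat) (x : X) : X :=
  n%:R^-1 *: \sum_(1 <= m < n.+1) iter m T x.

Definition mean_ergodic (K : numFieldType) (X : normedModType K)
    (T : {linear X -> X}) : Prop :=
  continuous T /\
  exists P : {linear X -> X}, continuous P /\
    forall x, cesaro_mean T n x @[n --> \oo] --> P x.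

(* The norm of a normed space over [R[i]] takes its values in [R[i]], whence
   the real part; the norm of an unbounded operator is [+oo]. *)
Definition operator_norm (R : realType) (X Y : normedModType R[i])
    (T : X -> Y) : \bar R :=
  ereal_sup [set (complex.Re `|T x|)%:E | x in [set x : X | `|x| <= 1]].

Definition uniformly_mean_ergodic (R : realType) (X : normedModType R[i])
    (T : {linear X -> X}) : Prop :=
  continuous T /\
  exists P : {linear X -> X}, continuous P /\
    operator_norm (fun x => cesaro_mean T n x - P x) @[n --> \oo] --> 0%:E.

End ErgodicOperators.

Definition has_density (R : realType) (J : set nat) (d : R) : Prop :=
  #|[pred k : 'I_N.+1 | (k : nat) \in J]|%:R / N%:R @[N --> \oo] --> d.

Section Disc.
Variable R : realType.
Local Notation C := R[i].

Definition unit_disc : set C := [set z | `|z| < 1].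
Definition closed_disc : set C := [set z | `|z| <= 1].
Definition unit_circle : set C := [set z | `|z| = 1].

Definition holomorphic_on (U : set C) (f : C -> C) : Prop :=
  forall z, U z -> derivable f z 1.

Lemma unit_disc_closed : unit_disc `<=` closed_disc.
Proof. by move=> z /ltW. Qed.

Lemma closed_disc0 : closed_disc 0.
Proof. by rewrite /closed_disc /= normr0 ler01. Qed.

Lemma nbhs_unit_disc (z : C) : unit_disc z -> nbhs z unit_disc.
Proof.
move=> z1; apply/nbhs_ballP; exists (1 - `|z|) => /=; first by rewrite subr_gt0.
move=> w; rewrite -ball_normE /= /unit_disc /= => zw.
rewrite -[w](subrK z) (le_lt_trans (ler_normD _ _))// -ltrBrDr.
by rewrite distrC.
Qed.

Lemma closed_disc_closed : closed closed_disc.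
Proof.
rewrite -[closed_disc]setCK; apply: open_closedC.
rewrite openE => z /negP; rewrite -real_ltNge ?normr_real ?real1// => z1.
apply/nbhs_ballP; exists (`|z| - 1) => /=; first by rewrite subr_gt0.
move=> w; rewrite -ball_normE /= => zw; apply/negP.
rewrite -real_ltNge ?normr_real ?real1//.
rewrite -(ltrD2l `|z - w|) (@lt_le_trans _ _ `|z|)// -?ltrBrDr//.
by rewrite -{1}[z](subrK w) ler_normD.
Qed.

Lemma closed_disc_compact : compact closed_disc.
Proof.
pose g (p : R * R) : C := p.1 +i* p.2.
have normRe (x : R) : `|x%:C| = `|x|%:C :> C.
  by rewrite normc_def /= expr0n addr0 sqrtr_sqr.
have normg p : `|g p| <= (`|p.1| + `|p.2|)%:C.
  have -> : g p = p.1%:C + 'i * p.2%:C by rewrite [LHS]complexE.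
  rewrite (le_trans (ler_normD _ _))// normrM !normRe normc_def /=.
  by rewrite expr0n expr1n /= add0r sqrtr1 mul1r -rmorphD.
have cg : continuous g.
  move=> p; apply/cvgrPdist_lt => e; rewrite ltcE /= => /andP[/eqP e0 re0].
  have e20 : 0 < complex.Re e / 2 by rewrite divr_gt0.
  apply/(@nbhs_ballP R (R * R)%type); exists (complex.Re e / 2) => //= q [].
  rewrite -!ball_normE /= => h1 h2.
  have -> : g p - g q = g (p.1 - q.1, p.2 - q.2) by [].
  rewrite (le_lt_trans (normg _))//= ltcE /= e0 eqxx /=.
  by rewrite [ltRHS](splitr (complex.Re e)) ltrD.
have cbox : compact (g @` (`[-1, 1]%classic `*` `[-1, 1]%classic)).
  apply: continuous_compact; first exact: continuous_subspaceT.
  by apply: compact_setX; exact: segment_compact.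
apply: (subclosed_compact closed_disc_closed cbox).
case=> a b; rewrite /closed_disc /= normc_def /= lecR => h.
have h2 : a ^+ 2 + b ^+ 2 <= 1.
  rewrite -[leRHS](expr1n _ 2) -[leLHS]sqr_sqrtr ?addr_ge0 ?sqr_ge0//.
  by rewrite ler_sqr ?nnegrE ?sqrtr_ge0 ?ler01.
have key (x y : R) : x ^+ 2 + y ^+ 2 <= 1 -> x \in `[-1, 1].
  move=> xy; rewrite in_itv /= -ler_norml -(@ler_pXn2r _ 2) ?nnegrE//.
  rewrite expr1n real_normK ?num_real// (le_trans _ xy)//.
  by rewrite lerDl sqr_ge0.
exists (a, b) => //; split => /=; first exact: key h2.
by rewrite addrC in h2; exact: key h2.
Qed.

Lemma Re_normK (z : C) : (complex.Re `|z|)%:C = `|z|.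
Proof. by rewrite RRe_real ?normr_real. Qed.

Lemma within_closed_disc_bounded (f : C -> C) :
  {within closed_disc, continuous f} ->
  exists M : R, forall z, closed_disc z -> complex.Re `|f z| <= M.
Proof.
move=> cf.
have cRe : continuous (fun w : C => complex.Re `|w| : R).
  move=> z; apply/(@cvgrPdist_lt R R C _ (@nbhs_filter C z)) => e e0.
  apply/nbhs_ballP; exists e%:C => /=.
    by rewrite ltcR.
  move=> w; rewrite -ball_normE /= => h.
  have : `|(`|z| - `|w|)| < e%:C := le_lt_trans (ler_dist_dist _ _) h.
  rewrite -(Re_normK z) -(Re_normK w) -rmorphB /=.
  by rewrite normc_def /= expr0n addr0 sqrtr_sqr ltcR.
have /compact_bounded : compact ((fun z => complex.Re `|f z|) @` closed_disc).
  apply: continuous_compact closed_disc_compact => z.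
  by apply: (@continuous_comp (subspace closed_disc) C R f); 
    [exact: cf | exact: cRe].
case/pinfty_ex_gt0 => M _ bM; exists M => z Dz.
by rewrite (le_trans (ler_norm _))// bM//; exists z.
Qed.

(* Functions on the closed disc are represented by functions on the whole plane
   that vanish off the closed disc, so that equality in [disc_algebra] is
   equality on the closed disc. *)
Definition disc_algebra_pred : {pred C -> C} :=
  [pred f : C -> C | `[< [/\ {within closed_disc, continuous f},
    holomorphic_on unit_disc f & forall z, ~ closed_disc z -> f z = 0] >]].

Lemma disc_algebra_predP (f : C -> C) :
  reflect [/\ {within closed_disc, continuous f}, holomorphic_on unit_disc f &
           forall z, ~ closed_disc z -> f z = 0] (f \in disc_algebra_pred).
Proof. exact: asboolP. Qed.

Lemma disc_algebra_submod : GRing.submod_closed disc_algebra_pred.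
Proof.
split=> [|a f g /disc_algebra_predP[cf hf f0] /disc_algebra_predP[cg hg g0]];
  apply/disc_algebra_predP; split.
- by move=> z; exact: cst_continuous.
- by move=> z _; exact: derivable_cst.
- by [].
- move=> z; apply: (@cvgD _ _ _ (nbhs (z : subspace closed_disc)) _
    (a *: f) g (a *: f z) (g z)); last exact: cg.
  by apply: cvgZr; exact: cf.
- move=> z Dz; apply: derivableD; last exact: hg.
  by apply: derivableZ; exact: hf.
- move=> z Dz; rewrite -[LHS]/(a * f z + g z) f0// g0// mulr0 addr0//.
Qed.

Record disc_algebra := DiscAlgebra {
  disc_fun :> C -> C ;
  disc_funP : disc_fun \in disc_algebra_pred }.

HB.instance Definition _ := [isSub for disc_fun].
HB.instance Definition _ := [Choice of disc_algebra by <:].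
HB.instance Definition _ := GRing.SubChoice_isSubLmodule.Build
  C (C -> C) disc_algebra_pred disc_algebra disc_algebra_submod.

Lemma disc_fun_continuous (f : disc_algebra) :
  {within closed_disc, continuous f}.
Proof. by case/disc_algebra_predP: (disc_funP f). Qed.

Lemma disc_fun_holomorphic (f : disc_algebra) : holomorphic_on unit_disc f.
Proof. by case/disc_algebra_predP: (disc_funP f). Qed.

Lemma disc_fun_out (f : disc_algebra) z : ~ closed_disc z -> f z = 0.
Proof. by case/disc_algebra_predP: (disc_funP f) => _ _; apply. Qed.

Definition sup_norm (f : disc_algebra) : R :=
  sup [set complex.Re `|f z| | z in closed_disc].

Lemma sup_norm_ub (f : disc_algebra) z :
  closed_disc z -> complex.Re `|f z| <= sup_norm f.
Proof.
move=> Dz; apply: ub_le_sup; last by exists z.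
have [M bM] := within_closed_disc_bounded (@disc_fun_continuous f).
by exists M => _ [w Dw <-]; exact: bM.
Qed.

Lemma sup_norm_le (f : disc_algebra) M :
  (forall z, closed_disc z -> complex.Re `|f z| <= M) -> sup_norm f <= M.
Proof.
move=> fM; apply: ge_sup; last by move=> _ [w Dw <-]; exact: fM.
by exists (complex.Re `|f 0|), 0 => //; exact: closed_disc0.
Qed.

Lemma normc_le_sup_norm (f : disc_algebra) z :
  closed_disc z -> `|f z| <= (sup_norm f)%:C.
Proof. by move=> Dz; rewrite -Re_normK lecR sup_norm_ub. Qed.

Lemma sup_norm_leC (f : disc_algebra) M :
  (forall z, closed_disc z -> `|f z| <= M%:C) -> sup_norm f <= M.
Proof.
by move=> h; apply: sup_norm_le => z Dz; rewrite -lecR Re_normK h.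
Qed.

Let normC (f : disc_algebra) : C := (sup_norm f)%:C.

Let ler_normCD f g : normC (f + g) <= normC f + normC g.
Proof.
rewrite /normC -rmorphD /= lecR; apply: sup_norm_leC => z Dz.
by rewrite (le_trans (ler_normD _ _))// rmorphD lerD// normc_le_sup_norm.
Qed.

Let normCZ (a : C) f : normC (a *: f) = `|a| * normC f.
Proof.
have le b g : normC (b *: g) <= `|b| * normC g.
  rewrite -Re_normK /normC -rmorphM /= lecR; apply: sup_norm_leC => z Dz.
  rewrite rmorphM /= Re_normK normrM ler_wpM2l// normc_le_sup_norm//.
apply/le_anti; rewrite le/=.
have [->|a0] := eqVneq a 0.
  rewrite normr0 mul0r /normC scale0r lecR.
  by rewrite (le_trans _ (sup_norm_ub _ closed_disc0))//= normr0.
rewrite -ler_pdivlMl ?normr_gt0// -normfV.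
by rewrite (le_trans _ (le _ _))// scalerA mulVf// scale1r.
Qed.

Let normC0_eq0 f : normC f = 0 -> f = 0.
Proof.
move=> f0; apply/val_inj/funext => z /=.
have [Dz|Dz] := pselect (closed_disc z); last exact: disc_fun_out.
apply/eqP; rewrite -normr_le0 (le_trans (normc_le_sup_norm f Dz))//.
by rewrite -[leRHS]f0.
Qed.

HB.instance Definition _ :=
  Lmodule_isNormed.Build C disc_algebra ler_normCD normCZ normC0_eq0.

Lemma disc_normE (f : disc_algebra) :
  `|f| = (sup [set complex.Re `|f z| | z in closed_disc])%:C.
Proof. by []. Qed.

Record disc_symbol := DiscSymbol {
  symbol_fun :> disc_algebra ;
  symbol_closed_disc : set_fun closed_disc closed_disc symbol_fun ;
  symbol_unit_disc : set_fun unit_disc unit_disc symbol_fun }.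

Definition composition_fun (phi : disc_symbol) (f : disc_algebra) : C -> C :=
  patch (fun=> 0) closed_disc (f \o phi).

Lemma composition_funE phi f z :
  closed_disc z -> composition_fun phi f z = f (phi z).
Proof. by move=> Dz; rewrite /composition_fun patchE mem_set. Qed.

Lemma composition_funP phi f : composition_fun phi f \in disc_algebra_pred.
Proof.
apply/disc_algebra_predP; split.
- apply: (@subspace_eq_continuous _ _ _ (f \o phi)).
    by move=> z /set_mem Dz; symmetry; exact: composition_funE.
  apply/subspace_continuousP => z Dz.
  have /subspace_continuousP/(_ _ Dz) cphi := @disc_fun_continuous phi.
  have Dphiz : closed_disc (phi z) by exact: symbol_closed_disc.
  have /subspace_continuousP/(_ _ Dphiz) cf := @disc_fun_continuous f.
  apply: (cvg_comp phi f _ cf) => A /cphi hA.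
  have {}hA : nbhs z (fun w : C =>
    closed_disc w -> closed_disc (phi w) -> A (phi w)) by exact: hA.
  rewrite -[_ A]/(nbhs z (fun w => closed_disc w -> A (phi w))).
  apply: filterS hA => w h Dw.
  by apply: (h Dw); exact: symbol_closed_disc.
- move=> z Dz; apply: (@near_eq_derivable _ _ _ (f \o phi)).
    have := nbhs_unit_disc Dz; apply: filterS => w /unit_disc_closed Dw.
    by symmetry; exact: composition_funE.
  apply/derivable1_diffP/differentiable_comp; apply/derivable1_diffP.
    exact: disc_fun_holomorphic.
  exact/disc_fun_holomorphic/symbol_unit_disc.
- by move=> z Dz; rewrite /composition_fun patchE memNset.
Qed.

Definition composition_operator (phi : disc_symbol) (f : disc_algebra) :
  disc_algebra := DiscAlgebra (composition_funP phi f).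

Fact composition_operator_is_linear phi : linear (composition_operator phi).
Proof.
move=> a f g; apply/val_inj/funext => z /=.
rewrite -[RHS]/(a * composition_fun phi f z + composition_fun phi g z).
rewrite /composition_fun !patchE; case: ifP => _ //.
by rewrite mulr0 addr0.
Qed.

HB.instance Definition _ phi := GRing.isLinear.Build C disc_algebra disc_algebra
  _ (composition_operator phi) (composition_operator_is_linear phi).

Lemma composition_operator_contraction phi f :
  `|composition_operator phi f| <= `|f|.
Proof.
rewrite /Num.norm /= lecR; apply: sup_norm_leC => z Dz /=.
by rewrite composition_funE// normc_le_sup_norm//; exact: symbol_closed_disc.
Qed.

Lemma composition_operator_continuous phi :
  continuous (composition_operator phi).
Proof.
move=> f; apply/(@cvgrPdist_lt C disc_algebra _ _ (nbhs_filter f)) => e e0.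
apply/nbhs_ballP; exists e => //= g.
rewrite -ball_normE /= => fg; rewrite -linearB.
exact: le_lt_trans (composition_operator_contraction phi _) fg.
Qed.

Definition disc_automorphism (psi : C -> C) : Prop :=
  holomorphic_on unit_disc psi /\ set_bij unit_disc unit_disc psi.

Definition conjugate_to_rotation (phi : C -> C) (lambda : C) : Prop :=
  disc_automorphism phi /\
  exists psi : C -> C, disc_automorphism psi /\
    forall z, unit_disc z ->
      phi z = psi (lambda * 'pinv_(fun=> 0) unit_disc psi z).

Definition elliptic_automorphism (phi : C -> C) : Prop :=
  exists2 lambda, unit_circle lambda & conjugate_to_rotation phi lambda.

Definition periodic_elliptic_automorphism (phi : C -> C) : Prop :=
  exists2 lambda, unit_circle lambda & conjugate_to_rotation phi lambda /\
    exists2 k : nat, (0 < k)%N & lambda ^+ k = 1.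

Definition denjoy_wolff_point (phi : C -> C) (z0 : C) : Prop :=
  [/\ ~ elliptic_automorphism phi, closed_disc z0 &
      forall K : set C, compact K -> K `<=` unit_disc ->
        {uniform K, (fun n => iter n phi) @ \oo --> (fun=> z0)}].

End Disc.

(* Main.v *)
Require Import Defs.
From HB Require Import structures.
From mathcomp Require Import all_boot all_order all_algebra.
From mathcomp Require Import all_classical all_reals all_analysis.
From mathcomp Require Import complex.
From mathcomp Require Import ring lra.

Set Implicit Arguments.
Unset Strict Implicit.
Unset Printing Implicit Defensive.

Import Order.TTheory GRing.Theory Num.Theory.
Import numFieldNormedType.Exports.

Local Open Scope classical_set_scope.
Local Open Scope ring_scope.
Local Open Scope complex_scope.

(* Cauchy theory is replaced by the following chain. Goursat's bisection gives a
   holomorphic function [f] on the disc a primitive [F], whose difference quotients are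
   twice differentiable in the axis directions; an elementary second-difference test
   yields the maximum principle for them and, in the limit, for [f]. Applying it to
   [prod_p (z - p) f^n] and letting [n] grow, finitely many exceptional points where [f]
   is only continuous are harmless, which is all that the Schwarz lemma, the
   Schwarz-Pick lemma and the strong maximum principle need. These give the
   Denjoy-Wolff theorem: in the half-plane coordinate of Wolff's boundary point a
   recurrent orbit would force the symbol to be a translation.

   If the Denjoy-Wolff point [z0] is on the circle, the Cesaro means of [f] can only
   converge to the constant [f z0]; applied to [f = id], and since [z0] is an extreme
   point of the closed disc, this is the density condition. Conversely the density
   condition bounds an average of [|f - f z0|] along each orbit, and compactness makes
   this uniform. An elliptic automorphism is a rotation in a Moebius coordinate: a
   periodic one has explicit means, and for an irrational one the means become nearly
   constant on circles, hence by the maximum principle close to the value at the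
   fixed point. Uniform ergodicity fails because of peak functions at [z0], respectively
   eigenvalues accumulating at [1]. *)

(** * The modulus of a complex number as a real number *)

Section Modulus.
Variable R : realType.
Local Notation C := R[i].
Implicit Types (x y z w : C).

(** Holomorphy means a complex derivative at each point of the open disc, with no regularity of that
    derivative. Second differences of [f] would require second order information, so the test is run
    on a primitive [F]: where [f] has an affine approximation, [F] has a quadratic one, and the
    quadratic terms of its four axis increments cancel because [1 + 1 + 'i ^+ 2 + 'i ^+ 2 = 0]. Only
    horizontal and vertical increments of [F] occur, so rectangles suffice for Goursat's lemma.

    The dynamics rests on one recurrence argument. A continuous quantity that is monotone under
    [phi] takes equal values at a cluster point of an orbit and at its image, and the equality case
    is rigid: for the pseudo-hyperbolic distance to a fixed point it yields a rotation, for the real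
    part of the half-plane coordinate a translation.

    Uniform ergodicity is refuted through the Cauchy property of the means on the unit ball. A mean
    length is fixed first; then a function of norm at most [1] is chosen that hardly varies along
    that many iterates of one point, while its longer means at this point are far from that
    value. *)

Definition cmod (z : C) : R := Normc.normc z.
Arguments cmod : simpl never.

(** The norm on [C] is a complex number, compared by a partial order. Estimates are moved to the
    real number [cmod z], where the order is total and linear arithmetic applies. *)
Lemma normC_cmod z : `|z| = (cmod z)%:C.
Proof. by rewrite normc_def /cmod; case: z. Qed.

Lemma Re_norm_cmod z : complex.Re `|z| = cmod z.
Proof. by rewrite normC_cmod. Qed.

Lemma cmod_ge0 z : 0 <= cmod z.
Proof. by rewrite -lecR -normC_cmod normr_ge0. Qed.

Lemma cmod_eq0 z : (cmod z == 0) = (z == 0).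
Proof. by rewrite -(normr_eq0 z) normC_cmod eq_complex /= eqxx andbT. Qed.

Lemma cmod0 : cmod 0 = 0.
Proof. by apply/eqP; rewrite cmod_eq0. Qed.

Lemma cmod_gt0 z : (0 < cmod z) = (z != 0).
Proof. by rewrite lt_neqAle cmod_ge0 andbT eq_sym cmod_eq0. Qed.

Lemma cmodD z w : cmod (z + w) <= cmod z + cmod w.
Proof. by rewrite -lecR rmorphD /= -!normC_cmod ler_normD. Qed.

Lemma cmodN z : cmod (- z) = cmod z.
Proof. by apply: (@complexI R); rewrite -!normC_cmod normrN. Qed.

Lemma cmodBC z w : cmod (z - w) = cmod (w - z).
Proof. by rewrite -cmodN opprB. Qed.

Lemma cmodB z w : cmod (z - w) <= cmod z + cmod w.
Proof. by rewrite -[cmod w]cmodN cmodD. Qed.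

Lemma cmod_dist z w : cmod z - cmod w <= cmod (z - w).
Proof. by rewrite lerBlDr (le_trans _ (cmodD _ _))// subrK. Qed.

Lemma cmod_distD y z w : cmod (z - w) <= cmod (z - y) + cmod (y - w).
Proof. by rewrite (le_trans _ (cmodD _ _))// addrA subrK. Qed.

Lemma cmodM z w : cmod (z * w) = cmod z * cmod w.
Proof. exact: Normc.normcM. Qed.

Lemma cmodV z : cmod z^-1 = (cmod z)^-1.
Proof. exact: Normc.normcV. Qed.

Lemma cmod1 : cmod 1 = 1.
Proof. by apply: (@complexI R); rewrite -!normC_cmod normr1. Qed.

Lemma cmodX z n : cmod (z ^+ n) = cmod z ^+ n.
Proof. by elim: n => [|n IH]; rewrite ?expr0 ?cmod1// !exprS cmodM IH. Qed.

Lemma cmod_real (x : R) : cmod x%:C = `|x|.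
Proof. by rewrite /cmod /= expr0n /= addr0 sqrtr_sqr. Qed.

Lemma cmodi (x : R) : cmod (0 +i* x) = `|x|.
Proof. by rewrite /cmod /= expr0n /= add0r sqrtr_sqr. Qed.

Lemma cmod_sqr z : cmod z ^+ 2 = complex.Re z ^+ 2 + complex.Im z ^+ 2.
Proof. by case: z => a b; rewrite /cmod /= sqr_sqrtr// addr_ge0 ?sqr_ge0. Qed.

Lemma cmod_conj z : cmod z^* = cmod z.
Proof. by case: z => a b; rewrite /cmod /= sqrrN. Qed.

Lemma normRe_le z : `|complex.Re z| <= cmod z.
Proof. by rewrite -lecR -normC_cmod normc_ge_Re. Qed.

Lemma Re_le_cmod z : complex.Re z <= cmod z.
Proof. exact: le_trans (ler_norm _) (normRe_le z). Qed.

Lemma normIm_le z : `|complex.Im z| <= cmod z.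
Proof.
rewrite -[leRHS]ger0_norm ?cmod_ge0// -ler_sqr ?nnegrE// !real_normK ?num_real//.
by rewrite cmod_sqr lerDr sqr_ge0.
Qed.

Lemma cmod_le_ReIm z : cmod z <= `|complex.Re z| + `|complex.Im z|.
Proof.
case: z => a b /=.
have -> : a +i* b = a%:C + 0 +i* b by apply/eqP; rewrite eq_complex /= addr0 add0r !eqxx.
by rewrite (le_trans (cmodD _ _))// cmod_real cmodi.
Qed.

Lemma cmod_sum (I : Type) (r : seq I) (P : pred I) (F : I -> C) :
  cmod (\sum_(i <- r | P i) F i) <= \sum_(i <- r | P i) cmod (F i).
Proof.
elim/big_rec2: _ => [|i a b _ h]; first by rewrite cmod0.
by rewrite (le_trans (cmodD _ _))// lerD2l.
Qed.

Lemma unit_discE z : unit_disc z = (cmod z < 1) :> Prop.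
Proof. by rewrite /unit_disc /= normC_cmod ltcR. Qed.

Lemma closed_discE z : closed_disc z = (cmod z <= 1) :> Prop.
Proof. by rewrite /closed_disc /= normC_cmod lecR. Qed.

Lemma unit_circleE z : unit_circle z <-> cmod z = 1.
Proof.
rewrite /unit_circle /= normC_cmod; split => [h|->//].
by apply: (@complexI R); rewrite h.
Qed.

Lemma gt0C (e : C) : 0 < e -> exists2 r : R, 0 < r & e = r%:C.
Proof.
by case: e => a b; rewrite ltcE /= => /andP[/eqP -> a0]; exists a.
Qed.

Lemma nbhs_cmodP z (A : set C) :
  nbhs z A <-> exists2 e : R, 0 < e & forall w, cmod (w - z) < e -> A w.
Proof.
split=> [/nbhs_ballP[e /= /gt0C[r r0 ->] h]|[e e0 h]].
  exists r => // w zw; apply: h; rewrite -ball_normE /= distrC normC_cmod.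
  by rewrite ltcR.
apply/nbhs_ballP; exists e%:C => /=; first by rewrite ltcR.
move=> w; rewrite -ball_normE /= distrC normC_cmod ltcR; exact: h.
Qed.

Lemma continuous_cmodP (f : C -> C) z :
  {for z, continuous f} <->
  forall e : R, 0 < e -> exists2 d : R, 0 < d &
    forall w, cmod (w - z) < d -> cmod (f w - f z) < e.
Proof.
split=> [cf e e0|h].
  have /cf/nbhs_cmodP[d d0 h] : nbhs (f z) [set w | cmod (w - f z) < e].
    by apply/nbhs_cmodP; exists e.
  by exists d.
move=> A /nbhs_cmodP[e e0 hA]; have [d d0 hd] := h e e0.
by apply/nbhs_cmodP; exists d => // w /hd/hA.
Qed.

Lemma within_closed_discP (f : C -> C) :
  {within @closed_disc R, continuous f} <->
  forall z, cmod z <= 1 -> forall e : R, 0 < e -> exists2 d : R, 0 < d &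
    forall w, cmod w <= 1 -> cmod (w - z) < d -> cmod (f w - f z) < e.
Proof.
rewrite subspace_continuousP; split=> [cf z z1 e e0|h z].
  have /cf : @closed_disc R z by rewrite closed_discE.
  have : nbhs (f z) [set w | cmod (w - f z) < e] by apply/nbhs_cmodP; exists e.
  move=> /[swap]/[apply] /nbhs_cmodP[d d0 h]; exists d => // w w1 /h.
  by apply; rewrite closed_discE.
rewrite closed_discE => z1 A /nbhs_cmodP[e e0 hA].
have [d d0 hd] := h z z1 e e0; apply/nbhs_cmodP; exists d => // w zw.
by rewrite closed_discE => /hd/(_ zw)/hA.
Qed.

(** Differentiability as affine approximation: the non-strict bound admits [w = z], so that no point
    has to be excluded. *)
Lemma derivable_cmodP (f : C -> C) z :
  derivable f z 1 <->
  exists l : C, forall e : R, 0 < e -> exists2 d : R, 0 < d &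
    forall w, cmod (w - z) < d -> cmod (f w - f z - l * (w - z)) <= e * cmod (w - z).
Proof.
split=> [df|[l h]].
  exists ('D_1 f z) => e e0.
  have /cvg_ex[l hl] := df.
  have -> : 'D_1 f z = l by exact: cvg_lim hl.
  have : nbhs l [set w | cmod (w - l) < e] by apply/nbhs_cmodP; exists e.
  move/hl => /=; rewrite /nbhs /= => /nbhs_cmodP[d d0 h]; exists d => // w zw.
  have [->|wz] := eqVneq w z; first by rewrite !subrr mulr0 subr0 cmod0 mulr0.
  have wz0 : w - z != 0 by rewrite subr_eq0.
  have /= := h (w - z); rewrite subr0 => /(_ zw wz0).
  have -> : (w - z)%:A = w - z by exact: mulr1.
  rewrite subrK /GRing.scale /= => /ltW.
  rewrite -(ler_pM2r (_ : 0 < cmod (w - z))) ?cmod_gt0// -cmodM.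
  by rewrite mulrBl mulrAC mulVf// mul1r.
apply/cvg_ex; exists l => A /nbhs_cmodP[e e0 hA].
have [d d0 hd] := h (e / 2) ltac:(by rewrite divr_gt0).
apply/nbhs_cmodP; exists d => // t; rewrite subr0 => td t0; apply: hA.
have -> : t%:A = t by exact: mulr1.
have := hd (t + z); rewrite addrK => /(_ td) {}hd.
rewrite -(ltr_pM2r (_ : 0 < cmod t)) ?cmod_gt0// -cmodM mulrBl.
rewrite /GRing.scale /= mulrAC mulVf// mul1r (le_lt_trans hd)//.
by rewrite ltr_pM2r ?cmod_gt0// ltr_pdivrMr// ltr_pMr// ltr1n.
Qed.

Lemma derivable_continuous (f : C -> C) z :
  derivable f z 1 -> {for z, continuous f}.
Proof. by move=> /derivable1_diffP/differentiable_continuous. Qed.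

Lemma compact_cover_cmod (K : set C) (delta : C -> R) : compact K ->
  (forall z, K z -> 0 < delta z) ->
  exists2 s : seq C, {in s, forall z, K z} &
    forall w, K w -> exists2 z, z \in s & cmod (w - z) < delta z.
Proof.
rewrite compact_cover => cK d0.
have opB z : open [set w : C | cmod (w - z) < delta z].
  rewrite openE => w /= zw; apply/nbhs_cmodP.
  exists (delta z - cmod (w - z)); first by rewrite subr_gt0.
  by move=> v; rewrite ltrBrDr /=; apply: le_lt_trans; exact: cmod_distD.
have [] := cK C K (fun z => [set w : C | cmod (w - z) < delta z]).
- by move=> z _; exact: opB.
- by move=> z Kz; exists z => //=; rewrite subrr cmod0 d0.
move=> D' D'K cov; exists (finmap.enum_fset D').
  by move=> z zD; apply/set_mem/D'K.
by move=> w /cov [z /= zD wz]; exists z.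
Qed.

(** Without a cluster point, each [z] of [K] has a ball that the sequence avoids from some rank on;
    a finite subcover gives a rank after which the sequence avoids all of [K]. *)
Lemma compact_cluster_cmod (K : set C) (x_ : nat -> C) : compact K ->
  (forall n, K (x_ n)) ->
  exists2 z, K z & forall e : R, 0 < e -> forall N, exists2 n, (N <= n)%N &
    cmod (x_ n - z) < e.
Proof.
move=> cK Kx; apply: contrapT => /forall2NP H.
have {}H z : exists d : R, K z -> 0 < d /\ exists N, forall n, (N <= n)%N ->
    d <= cmod (x_ n - z).
  have [nKz|] := H z; first by exists 0.
  move=> /existsNP[e /not_implyP[e0 /existsNP[N /forall2NP hN]]].
  exists e => _; split => //; exists N => n Nn.
  by have [//|/negP] := hN n; rewrite -leNgt.
have {H}[delta H] := choice H.
have d0 z : K z -> 0 < delta z by move=> /H[].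
have [s sK cov] := compact_cover_cmod cK d0.
have [M HM] : exists M, forall z, z \in s -> forall n, (M <= n)%N ->
    delta z <= cmod (x_ n - z).
  elim: s sK {cov} => [|a s IH] sK; first by exists 0%N.
  have [|M HM] := IH; first by move=> z zs; apply: sK; rewrite inE zs orbT.
  have [_ [N hN]] := H a (sK a (mem_head _ _)).
  exists (maxn M N) => z; rewrite inE => /orP[/eqP->|zs] n; rewrite geq_max.
    by move=> /andP[_ /hN].
  by move=> /andP[Mn _]; exact: HM.
have [z zs] := cov _ (Kx M).
by rewrite ltNge HM.
Qed.

Lemma seq_max (s : seq C) (u : C -> R) z0 : z0 \in s ->
  exists2 z, z \in s & forall w, w \in s -> u w <= u z.
Proof.
elim: s z0 => // a s IH z0 _.
case: s IH => [|b s] IH.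
  by exists a; rewrite ?mem_head// => w; rewrite inE => /eqP->.
have [z zs hz] := IH b (mem_head _ _).
have [az|za] := leP (u a) (u z).
  by exists z => [|w]; rewrite inE ?zs ?orbT// => /orP[/eqP->//|/hz].
exists a => [|w]; rewrite inE ?eqxx// => /orP[/eqP->//|/hz wz].
exact: le_trans wz (ltW za).
Qed.

(** Upper semicontinuity suffices. Without a maximum, each [z] has a point of [K] whose value beats
    [u] near [z]. The best of these points for a finite subcover lies in one of the neighbourhoods,
    hence is beaten by another one. *)
Lemma compact_max_cmod (K : set C) (u : C -> R) z0 : compact K -> K z0 ->
  (forall z, K z -> forall e, 0 < e -> exists2 d : R, 0 < d &
    forall w, K w -> cmod (w - z) < d -> u w < u z + e) ->
  exists2 z, K z & forall w, K w -> u w <= u z.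
Proof.
move=> cK Kz0 cu; apply: contrapT => /forall2NP H.
have {}H z : exists zd : C * R, K z -> [/\ K zd.1, 0 < zd.2 &
    forall w, K w -> cmod (w - z) < zd.2 -> u w < u zd.1].
  have [nKz|] := H z; first by exists (0, 0).
  have [nKz|Kz] := pselect (~ K z); first by exists (0, 0).
  move=> /existsNP[z' /not_implyP[Kz' /negP]]; rewrite -ltNge => zz'.
  have [|d d0 hd] := cu z (contrapT Kz) (u z' - u z); first by rewrite subr_gt0.
  exists (z', d) => _; split => // w Kw /hd => /(_ Kw).
  by rewrite addrC subrK.
have {H}[f H] := choice H.
have d0 z : K z -> 0 < (f z).2 by move=> /H[].
have [s sK cov] := compact_cover_cmod cK d0.
have [z1 z1s _] := cov _ Kz0.
have [z zs hz] := seq_max (fun z => u (f z).1) z1s.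
have [Kfz _ _] := H z (sK z zs).
have [y ys yz] := cov _ Kfz.
have [_ _ /(_ _ Kfz yz)] := H y (sK y ys).
by rewrite ltNge hz.
Qed.

Definition cball (r : R) : set C := [set z | cmod z <= r].

Lemma cball_compact r : 0 < r -> compact (cball r).
Proof.
move=> r0.
have -> : cball r = (fun z => r%:C * z) @` @closed_disc R.
  apply/seteqP; split => [z zr|_ [z + <-]] /=; last first.
    by rewrite closed_discE /cball /= cmodM cmod_real gtr0_norm// ger_pMr.
  exists (r^-1%:C * z).
    by rewrite closed_discE cmodM cmod_real gtr0_norm ?invr_gt0// ler_pdivrMl// mulr1.
  by rewrite mulrA -rmorphM divff ?gt_eqF// mul1r.
apply: continuous_compact; last exact: closed_disc_compact.
apply: continuous_subspaceT => z; apply: derivable_continuous.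
apply/derivable_cmodP; exists r%:C => e e0; exists 1 => // w _.
by rewrite -!mulrBr subrr mulr0 cmod0 mulr_ge0 ?cmod_ge0// ltW.
Qed.

End Modulus.
Arguments cmod {R} z : simpl never.

(** * Primitives along a real variable *)

Section Primitive.
Variable R : realType.
Local Notation C := R[i].

Lemma heine_cantor_cmod (K : set C) (f : C -> C) : compact K ->
  (forall z, K z -> forall e : R, 0 < e -> exists2 d : R, 0 < d &
    forall w, K w -> cmod (w - z) < d -> cmod (f w - f z) < e) ->
  forall e : R, 0 < e -> exists2 d : R, 0 < d & forall z w, K z -> K w ->
    cmod (w - z) < d -> cmod (f w - f z) < e.
Proof.
move=> cK cf e e0; apply: contrapT => /forall2NP H.
have /choice[z_ Hz] : forall n : nat, exists zs : C * C,
    [/\ K zs.1, K zs.2, cmod (zs.2 - zs.1) < n.+1%:R^-1 &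
     e <= cmod (f zs.2 - f zs.1)].
  move=> n.
  have [[]|] := H (n.+1%:R^-1); first by rewrite invr_gt0 ltr0n.
  move=> /existsNP[z /existsNP[w /not_implyP[Kz /not_implyP[Kw]]]].
  move=> /not_implyP[zw /negP]; rewrite -leNgt => fe.
  by exists (z, w).
have Kz n : K (z_ n).1 by case: (Hz n).
have [z Kzz clz] := compact_cluster_cmod cK Kz.
have [d d0 hd] := cf z Kzz (e / 2) ltac:(by rewrite divr_gt0).
have [N hN] : exists N : nat, forall n, (N <= n)%N -> n.+1%:R^-1 < d / 2.
  have [N _ hN] := near_infty_natSinv_lt (PosNum (divr_gt0 d0 (ltr0Sn R 1))).
  by exists N.
have [n Nn hn] := clz (d / 2) ltac:(by rewrite divr_gt0) N.
have [_ Kw zw] := Hz n; rewrite leNgt => /negP; apply.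
rewrite (le_lt_trans (cmod_distD (f z) _ _))// [e]splitr ltrD//.
  apply: hd => //; rewrite (le_lt_trans (cmod_distD (z_ n).1 _ _))// [d]splitr.
  by rewrite ltrD// (lt_trans zw)// hN.
rewrite cmodBC; apply: hd => //; rewrite (lt_trans hn)// ltr_pdivrMr//.
by rewrite ltr_pMr// ltr1n.
Qed.

(** The window []-2, 2[] contains the real and imaginary parts of all points of the unit disc;
    integrating from [-3] inside [[-3, 3]] makes each of its points interior. *)
Lemma continuous_primitive (g : R -> R) : continuous g ->
  exists P : R -> R, forall x : R, -2 < x < 2 -> is_derive x 1 P (g x).
Proof.
move=> cg; exists (fun x => \int[lebesgue_measure]_(t in `[-3, x]) g t) => x /andP[x2 x3].
have [|||//|d1 d2] := @continuous_FTC1_closed R g (-3) x 3.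
- by lra.
- by apply: continuous_compact_integrable; [exact: segment_compact|exact: continuous_subspaceT].
- by lra.
- exact: cg.
by rewrite derive1E in d2; exact: (DeriveDef d1 d2).
Qed.

Definition btw (a b x : R) := (a <= x <= b) || (b <= x <= a).

Lemma btwC a b x : btw a b x = btw b a x.
Proof. by rewrite /btw orbC. Qed.

(** Mean value theorem for [P] minus a primitive of the affine model: the derivative of the
    difference is the error [g x - al - be * x]. *)
Lemma primitive_increment (g P : R -> R) (a b al be K : R) :
  (forall x : R, -2 < x < 2 -> is_derive x 1 P (g x)) -> -2 < a < 2 -> -2 < b < 2 ->
  (forall x, btw a b x -> `|g x - al - be * x| <= K) ->
  `|P b - P a - al * (b - a) - be / 2 * (b ^+ 2 - a ^+ 2)| <= K * `|b - a|.
Proof.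
move=> dP; wlog ab : a b / a <= b => [H|] a2 b2 hK.
  have [/H|/ltW/H] := leP a b; first exact.
  have hK' x : btw b a x -> `|g x - al - be * x| <= K by rewrite btwC; exact: hK.
  move=> /(_ b2 a2 hK'); rewrite distrC; congr (_ <= _ * _).
    by congr `|_|; ring.
  by rewrite distrC.
pose Q x := P x - al * x - be / 2 * x ^+ 2.
have dQ (x : R) : -2 < x < 2 -> is_derive x 1 Q (g x - al - be * x).
  move=> /dP dPx.
  have h := is_deriveB (is_deriveB dPx (is_deriveZ al (is_derive_id x 1)))
    (is_deriveZ (be / 2) (is_deriveX 2 (is_derive_id x (1 : R)))).
  apply: (is_derive_eq h).
  by rewrite /GRing.scale /= !mulr1 expr1; field.
have ab2 x : x \in `[a, b] -> -2 < x < 2.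
  by rewrite in_itv /= => /andP[? ?]; apply/andP; split; lra.
have dQab z : z \in `[a, b] -> is_derive z 1 Q (g z - al - be * z).
  by move=> /ab2/dQ.
have dQo (z : R) : z \in `]a, b[ -> is_derive z 1 Q (g z - al - be * z).
  by move=> /subset_itv_oo_cc/dQab.
have cQ : {within `[a, b], continuous Q}.
  apply: derivable_within_continuous => z zab; have dz := dQab z zab; exact: ex_derive.
have [c cab e] := @MVT_segment R Q (fun x => g x - al - be * x) a b ab dQo cQ.
have -> : P b - P a - al * (b - a) - be / 2 * (b ^+ 2 - a ^+ 2) = Q b - Q a.
  by rewrite /Q; ring.
rewrite e normrM ler_wpM2r// hK// /btw.
by move: cab; rewrite in_itv /= => ->.
Qed.

(** Real and imaginary parts get separate primitives, each with an error [K * |b - a|], whence the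
    factor [2]. *)
Lemma complex_primitive (g : R -> C) :
  (forall x (e : R), 0 < e -> exists2 d : R, 0 < d &
    forall y, `|y - x| < d -> cmod (g y - g x) < e) ->
  exists P : R -> C, forall a b (al be : C) (K : R), -2 < a < 2 -> -2 < b < 2 ->
    (forall x, btw a b x -> cmod (g x - al - be * x%:C) <= K) ->
    cmod (P b - P a - al * (b - a)%:C - be * ((b ^+ 2 - a ^+ 2) / 2)%:C) <=
      2 * K * `|b - a|.
Proof.
move=> cg.
have cont (h : C -> R) : (forall z w, `|h z - h w| <= cmod (z - w)) ->
    continuous (h \o g).
  move=> hl x; apply/cvgrPdist_lt => e e0; have [d d0 hd] := cg x e e0.
  apply/nbhs_ballP; exists d => // y /=; rewrite /ball_ /= distrC => /hd.
  by rewrite distrC; apply: le_lt_trans.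
have [|P dP] := @continuous_primitive ((@complex.Re R) \o g).
  by apply: cont => z w; rewrite -raddfB; exact: normRe_le.
have [|Q dQ] := @continuous_primitive ((@complex.Im R) \o g).
  by apply: cont => z w; rewrite -raddfB; exact: normIm_le.
exists (fun x => P x +i* Q x) => a b [a1 a2] [b1 b2] K a22 b22 hK.
have hP x : btw a b x -> `|((@complex.Re R) \o g) x - a1 - b1 * x| <= K.
  move=> /hK; apply: le_trans; apply: le_trans (normRe_le _).
  by rewrite /=; case: (g x) => u v /=; rewrite mulr0 subr0.
have hQ x : btw a b x -> `|((@complex.Im R) \o g) x - a2 - b2 * x| <= K.
  move=> /hK; apply: le_trans; apply: le_trans (normIm_le _).
  by rewrite /=; case: (g x) => u v /=; rewrite mulr0 add0r.
have := primitive_increment dP a22 b22 hP.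
have := primitive_increment dQ a22 b22 hQ.
move=> h1 h2; rewrite (le_trans (cmod_le_ReIm _))//.
have -> : 2 * K * `|b - a| = K * `|b - a| + K * `|b - a| by ring.
apply: lerD.
  by apply: le_trans h2; rewrite le_eqVlt; apply/orP; left; apply/eqP; congr `|_| => /=; ring.
by apply: le_trans h1; rewrite le_eqVlt; apply/orP; left; apply/eqP; congr `|_| => /=; ring.
Qed.
End Primitive.

(** * Goursat's lemma *)

Section Goursat.
Variable R : realType.
Local Notation C := R[i].

Definition pt (x y : R) : C := x%:C + 'i * y%:C.

Lemma ptE x y : pt x y = x +i* y.
Proof. by rewrite /pt [RHS]complexE. Qed.

Lemma ReIm_pt (z : C) : z = pt (complex.Re z) (complex.Im z).
Proof. by rewrite ptE; case: z. Qed.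

Lemma ii : 'i * 'i = -1 :> C.
Proof. by rewrite -expr2 sqr_i. Qed.

Lemma cmod_i : cmod ('i : C) = 1.
Proof. by rewrite -[RHS](normr1 R) -cmodi. Qed.

Lemma realcB (x y : R) : (x - y)%:C = x%:C - y%:C :> C.
Proof. exact: rmorphB. Qed.
Lemma realcD (x y : R) : (x + y)%:C = x%:C + y%:C :> C.
Proof. exact: rmorphD. Qed.
Lemma realcM (x y : R) : (x * y)%:C = x%:C * y%:C :> C.
Proof. exact: rmorphM. Qed.
Lemma realcV (x : R) : (x^-1)%:C = x%:C^-1 :> C.
Proof. exact: fmorphV. Qed.
Lemma realcX (x : R) n : (x ^+ n)%:C = x%:C ^+ n :> C.
Proof. exact: rmorphXn. Qed.
Lemma realcN (x : R) : (- x)%:C = - x%:C :> C.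
Proof. exact: rmorphN. Qed.
Lemma realcn n : n%:R%:C = n%:R :> C.
Proof. exact: rmorph_nat. Qed.

(* The primitive of the affine map w |-> A + B (w - z0). *)
Definition quad (A B z0 w : C) : C := A * w + B * (w - z0) ^+ 2 / 2.

Variable f : C -> C.
Hypothesis cf : forall z (e : R), 0 < e -> exists2 d : R, 0 < d &
    forall w, cmod (w - z) < d -> cmod (f w - f z) < e.

(** Line integrals of [f] enter only through this estimate. The free affine model serves two
    purposes: [B = 0] exploits the continuity of [f], and [B] equal to a derivative its
    differentiability. Different heights [y] are unrelated. *)
Definition horizontal_primitive (H : R -> R -> C) :=
  forall y a b A B z0 (K : R), -2 < a < 2 -> -2 < b < 2 ->
    (forall x, btw a b x -> cmod (f (pt x y) - A - B * (pt x y - z0)) <= K) ->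
    cmod (H b y - H a y - (quad A B z0 (pt b y) - quad A B z0 (pt a y))) <=
      2 * K * `|b - a|.

Definition vertical_primitive (V : R -> R -> C) :=
  forall x c d A B z0 (K : R), -2 < c < 2 -> -2 < d < 2 ->
    (forall y, btw c d y -> cmod (f (pt x y) - A - B * (pt x y - z0)) <= K) ->
    cmod (V x d - V x c - (quad A B z0 (pt x d) - quad A B z0 (pt x c))) <=
      2 * K * `|d - c|.

Lemma horizontal_primitive_exists : exists H, horizontal_primitive H.
Proof.
have h y : exists P : R -> C, forall a b A B z0 (K : R), -2 < a < 2 -> -2 < b < 2 ->
    (forall x, btw a b x -> cmod (f (pt x y) - A - B * (pt x y - z0)) <= K) ->
    cmod (P b - P a - (quad A B z0 (pt b y) - quad A B z0 (pt a y))) <=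
      2 * K * `|b - a|.
  have [|P hP] := @complex_primitive R (fun x => f (pt x y)).
    move=> x e e0; have [d d0 hd] := cf (pt x y) e0; exists d => // x' xx'.
    apply: hd; rewrite /pt (_ : _ - _ = (x' - x)%:C) ?cmod_real//.
    by rewrite realcB; ring.
  exists P => a b A B z0 K a2 b2 hK.
  have := hP a b (A + B * ('i * y%:C - z0)) B K a2 b2.
  rewrite /quad /pt !(realcB, realcM, realcV, realcX, realcn).
  set E1 := (X in (_ -> cmod X <= _) -> _); set E2 := (X in _ -> cmod X <= _).
  have -> : E1 = E2 by rewrite /E1 /E2; field.
  apply => x /hK; congr (cmod _ <= _); rewrite /pt; ring.
by have [H hH] := choice h; exists (fun x y => H y x) => y; exact: hH.
Qed.

Lemma vertical_primitive_exists : exists V, vertical_primitive V.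
Proof.
have h x : exists P : R -> C, forall c d A B z0 (K : R), -2 < c < 2 -> -2 < d < 2 ->
    (forall y, btw c d y -> cmod (f (pt x y) - A - B * (pt x y - z0)) <= K) ->
    cmod (P d - P c - (quad A B z0 (pt x d) - quad A B z0 (pt x c))) <=
      2 * K * `|d - c|.
  (* The factor ['i] is the derivative of [y |-> pt x y], so that increments of [V] are integrals of
     [f dz], as those of [H] are. *)
  have [|P hP] := @complex_primitive R (fun y => 'i * f (pt x y)).
    move=> y e e0; have [d d0 hd] := cf (pt x y) e0; exists d => // y' yy'.
    rewrite -mulrBr cmodM cmod_i mul1r.
    apply: hd; rewrite /pt (_ : _ - _ = 'i * (y' - y)%:C).
      by rewrite cmodM cmod_i mul1r cmod_real.
    by rewrite realcB; ring.
  exists P => c d A B z0 K c2 d2 hK.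
  have := hP c d ('i * (A + B * (x%:C - z0))) (- B) K c2 d2.
  rewrite /quad /pt !(realcB, realcM, realcV, realcX, realcn).
  set E1 := (X in (_ -> cmod X <= _) -> _); set E2 := (X in _ -> cmod X <= _).
  have -> : E1 = E2 by rewrite /E1 /E2; field: ii.
  apply => y /hK; rewrite /pt => hy.
  apply: le_trans hy.
  set F1 := f _; rewrite (_ : 'i * F1 - _ - _ =
    'i * (F1 - A - B * (x%:C + 'i * y%:C - z0))).
    by rewrite cmodM cmod_i mul1r.
  by ring: ii.
by have [V hV] := choice h; exists V => x; exact: hV.
Qed.

Variables H V : R -> R -> C.
Hypothesis hH : horizontal_primitive H.
Hypothesis hV : vertical_primitive V.

(** The counterclockwise integral of [f] along the boundary of [[a, b] x [c, d]]: bottom, right,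
    top, left. *)
Definition rect_integral (a b c d : R) : C :=
  (H b c - H a c) + (V b d - V b c) - (H b d - H a d) - (V a d - V a c).

Lemma rect_integral_split a b c d m n : rect_integral a b c d =
  rect_integral a m c n + rect_integral m b c n +
  rect_integral a m n d + rect_integral m b n d.
Proof. by rewrite /rect_integral; ring. Qed.

(** The increments of [quad] cancel around the rectangle; what remains is [2 * K] times the
    perimeter. *)
Lemma rect_integral_le a b c d A B z0 K :
  -2 < a < 2 -> -2 < b < 2 -> -2 < c < 2 -> -2 < d < 2 -> a <= b -> c <= d ->
  (forall x y, a <= x <= b -> c <= y <= d ->
    cmod (f (pt x y) - A - B * (pt x y - z0)) <= K) ->
  cmod (rect_integral a b c d) <= 4 * K * ((b - a) + (d - c)).
Proof.
move=> a2 b2 c2 d2 ab cd hK.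
have hx x : btw a b x -> a <= x <= b.
  by rewrite /btw => /orP[//|/andP[? ?]]; apply/andP; split; lra.
have hy y : btw c d y -> c <= y <= d.
  by rewrite /btw => /orP[//|/andP[? ?]]; apply/andP; split; lra.
have cc : c <= c <= d by rewrite lexx.
have dd : c <= d <= d by rewrite lexx cd.
have aa : a <= a <= b by rewrite lexx.
have bb : a <= b <= b by rewrite lexx ab.
have h1 := hH a2 b2 (fun x hx' => hK x c (hx x hx') cc).
have h2 := hH a2 b2 (fun x hx' => hK x d (hx x hx') dd).
have h3 := hV c2 d2 (fun y hy' => hK a y aa (hy y hy')).
have h4 := hV c2 d2 (fun y hy' => hK b y bb (hy y hy')).
move: h1 h2 h3 h4; rewrite !ger0_norm ?subr_ge0//.
set E1 := (H b c - _ - _); set E2 := (H b d - _ - _).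
set E3 := (V a d - _ - _); set E4 := (V b d - _ - _) => h1 h2 h3 h4.
have -> : rect_integral a b c d = E1 + E4 - E2 - E3.
  by rewrite /rect_integral /E1 /E2 /E3 /E4; ring.
have := cmodB (E1 + E4 - E2) E3; have := cmodB (E1 + E4) E2; have := cmodD E1 E4.
lra.
Qed.


(* If the integral over a rectangle were nonzero, quartering it repeatedly would
   single out a point where [f] is not differentiable. *)
Lemma goursat a b c d : -2 < a < 2 -> -2 < b < 2 -> -2 < c < 2 -> -2 < d < 2 ->
  a <= b -> c <= d ->
  (forall x y, a <= x <= b -> c <= y <= d -> derivable f (pt x y) 1) ->
  rect_integral a b c d = 0.
Proof.
move=> a2 b2 c2 d2 ab cd df.
pose I (q : (R * R) * (R * R)) := rect_integral q.1.1 q.1.2 q.2.1 q.2.2.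
pose half (q q' : (R * R) * (R * R)) :=
  [/\ q.1.1 <= q'.1.1, q'.1.2 <= q.1.2, q'.1.2 - q'.1.1 = (q.1.2 - q.1.1) / 2 &
   [/\ q.2.1 <= q'.2.1, q'.2.2 <= q.2.2 & q'.2.2 - q'.2.1 = (q.2.2 - q.2.1) / 2]].
(* Some quarter carries at least a fourth of the integral: if the first three do not, the triangle
   inequality leaves the last one. On wrongly ordered corners [next] is arbitrary. *)
have /choice[next hnext] : forall q : (R * R) * (R * R), exists q',
    q.1.1 <= q.1.2 -> q.2.1 <= q.2.2 -> half q q' /\ cmod (I q) <= 4 * cmod (I q').
  move=> [[p q] [r s]]; pose m := (p + q) / 2; pose n := (r + s) / 2.
  have [pq|/negP] := boolP ((p <= q) && (r <= s)); last first.
    by move=> h; exists ((p, q), (r, s)) => /= h1 h2; case: h; rewrite h1 h2.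
  move/andP: pq => [pq rs].
  have e : I ((p, q), (r, s)) = I ((p, m), (r, n)) + I ((m, q), (r, n)) +
      I ((p, m), (n, s)) + I ((m, q), (n, s)).
    exact: rect_integral_split.
  have le4 : cmod (I ((p, q), (r, s))) <= cmod (I ((p, m), (r, n))) +
      cmod (I ((m, q), (r, n))) + cmod (I ((p, m), (n, s))) + cmod (I ((m, q), (n, s))).
    by rewrite e (le_trans (cmodD _ _))// lerD2r (le_trans (cmodD _ _))// lerD2r cmodD.
  set X := cmod (I ((p, q), (r, s))) in le4 *.
  have [h1|h1] := leP X (4 * cmod (I ((p, m), (r, n)))).
    by exists ((p, m), (r, n)) => _ _; split => //; rewrite /half /= /m /n; do ![split]; lra.
  have [h2|h2] := leP X (4 * cmod (I ((m, q), (r, n)))).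
    by exists ((m, q), (r, n)) => _ _; split => //; rewrite /half /= /m /n; do ![split]; lra.
  have [h3|h3] := leP X (4 * cmod (I ((p, m), (n, s)))).
    by exists ((p, m), (n, s)) => _ _; split => //; rewrite /half /= /m /n; do ![split]; lra.
  exists ((m, q), (n, s)) => _ _; split; last lra.
  by rewrite /half /= /m /n; do ![split]; lra.
pose q_ k := iter k next ((a, b), (c, d)).
have q_le k : (q_ k).1.1 <= (q_ k).1.2 /\ (q_ k).2.1 <= (q_ k).2.2.
  elim: k => [//|k [h1 h2]]; rewrite /q_ iterS -/(q_ k).
  have [[_ _ e1 [_ _ e2]] _] := hnext _ h1 h2.
  by split; [move: h1 e1|move: h2 e2]; lra.
have q_half k : half (q_ k) (q_ k.+1) by have [h1 h2] := q_le k; have [] := hnext _ h1 h2.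
have q_I k : cmod (I (q_ k)) <= 4 * cmod (I (q_ k.+1)).
  by have [h1 h2] := q_le k; have [] := hnext _ h1 h2.
have q_I0 k : cmod (I (q_ 0%N)) <= 4 ^+ k * cmod (I (q_ k)).
  elim: k => [|k IH]; first by rewrite expr0 mul1r.
  by rewrite (le_trans IH)// exprSr -mulrA ler_wpM2l ?exprn_ge0// q_I.
pose L := (b - a) + (d - c).
have q_L k : ((q_ k).1.2 - (q_ k).1.1) + ((q_ k).2.2 - (q_ k).2.1) = L / 2 ^+ k.
  elim: k => [|k IH]; first by rewrite expr0 divr1.
  have [_ _ e1 [_ _ e2]] := q_half k; rewrite e1 e2 -mulrDl IH exprSr.
  by rewrite invfM mulrA.
have nest (l u : nat -> R) : (forall k, l k <= u k) -> (forall k, l k <= l k.+1) ->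
    (forall k, u k.+1 <= u k) -> exists x, forall k, l k <= x <= u k.
  move=> lu ll uu.
  have hl m k : (m <= k)%N -> l m <= l k.
    by move=> /subnK <-; elim: (k - m)%N => // j IH; rewrite addSn (le_trans IH).
  have hu m k : (m <= k)%N -> u k <= u m.
    by move=> /subnK <-; elim: (k - m)%N => // j IH; rewrite addSn (le_trans _ IH).
  have ub k : ubound (range l) (u k).
    move=> _ [m _ <-]; have [mk|/ltnW km] := leqP m k.
      exact: le_trans (hl _ _ mk) (lu k).
    exact: le_trans (lu m) (hu _ _ km).
  exists (sup (range l)) => k; apply/andP; split.
    by apply: ub_le_sup; [exists (u 0%N); exact: ub|exists k].
  by apply: ge_sup; [exists (l 0%N), 0%N|exact: ub].
have [x hx] : exists x, forall k, (q_ k).1.1 <= x <= (q_ k).1.2.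
  apply: nest => k; first by have [] := q_le k.
    by have [] := q_half k.
  by have [] := q_half k.
have [y hy] : exists y, forall k, (q_ k).2.1 <= y <= (q_ k).2.2.
  apply: nest => k; first by have [] := q_le k.
    by have [_ _ _ []] := q_half k.
  by have [_ _ _ []] := q_half k.
have /derivable_cmodP[l hl] : derivable f (pt x y) 1.
  by apply: df; [exact: (hx 0%N)|exact: (hy 0%N)].
have inside k : [/\ a <= (q_ k).1.1, (q_ k).1.2 <= b, c <= (q_ k).2.1 & (q_ k).2.2 <= d].
  elim: k => [|k [i1 i2 i3 i4]]; first by rewrite /= !lexx.
  have [h1 h2 _ [h3 h4 _]] := q_half k.
  by split; [exact: le_trans i1 h1|exact: le_trans h2 i2|exact: le_trans i3 h3|
    exact: le_trans h4 i4].
have L0 : 0 <= L by rewrite /L; lra.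
(* The factor [4 ^+ k] lost by quartering is exactly compensated: the affine error is [e] times the
   size [L / 2 ^+ k], and integration along the boundary contributes this size once more. *)
have key e : 0 < e -> cmod (I (q_ 0%N)) <= 4 * e * L ^+ 2.
  move=> e0; have [del del0 hdel] := hl e e0.
  have [k hk] : exists k, L / 2 ^+ k < del.
    have : (fun k => L * (2^-1 : R) ^+ k) @ \oo --> L * 0.
      by apply: cvgMr; apply: cvg_expr; rewrite ger0_norm ?invr_ge0// invf_lt1 ?ltr1n.
    rewrite mulr0 => /cvgrPdist_lt/(_ _ del0)[k _ /(_ k (leqnn k))] /=.
    by rewrite sub0r normrN exprVn => /(le_lt_trans (ler_norm _)); exists k.
  rewrite (le_trans (q_I0 k))//.
  have [i1 i2 i3 i4] := inside k; have [w1 w2] := q_le k.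
  have Lk0 : 0 <= L / 2 ^+ k by rewrite divr_ge0 ?exprn_ge0.
  have := @rect_integral_le (q_ k).1.1 (q_ k).1.2 (q_ k).2.1 (q_ k).2.2
    (f (pt x y)) l (pt x y) (e * (L / 2 ^+ k)).
  rewrite q_L => /(_ _ _ _ _ w1 w2) h.
  have -> : 4 * e * L ^+ 2 = 4 ^+ k * (4 * (e * (L / 2 ^+ k)) * (L / 2 ^+ k)).
    have -> : 4 = 2 ^+ 2 :> R by ring.
    rewrite -exprM mulnC exprM; field.
    by rewrite expf_eq0 pnatr_eq0 andbF.
  rewrite ler_wpM2l ?exprn_ge0// h//; try by apply/andP; split; lra.
  move=> x' y' xx' yy'.
  have dist : cmod (pt x' y' - pt x y) <= L / 2 ^+ k.
    rewrite (le_trans (cmod_le_ReIm _))// !ptE /= -q_L.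
    have := hx k; have := hy k; move: xx' yy'.
    by move=> /andP[? ?] /andP[? ?] /andP[? ?] /andP[? ?];
      apply: lerD; rewrite ler_norml; apply/andP; split; lra.
  by rewrite (le_trans (hdel _ (le_lt_trans dist hk)))// ler_wpM2l// ltW.
apply/eqP; rewrite -cmod_eq0 eq_le cmod_ge0 andbT; apply/ler_addgt0Pr => e e0.
(* The [+ 1] covers the rectangle reduced to a point, where [L = 0]. *)
rewrite add0r (le_trans (key (e / (4 * (L ^+ 2 + 1))) _))//.
  by rewrite divr_gt0// mulr_gt0// ltr_wpDl ?sqr_ge0.
have L1 : 0 < L ^+ 2 + 1 by rewrite ltr_wpDl ?sqr_ge0.
have -> : 4 * (e / (4 * (L ^+ 2 + 1))) * L ^+ 2 = e * (L ^+ 2 / (L ^+ 2 + 1)).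
  by field; rewrite gt_eqF.
by rewrite ler_piMr ?ltW// ltr_pdivrMr// mul1r ltrDl.
Qed.

End Goursat.

(** * The maximum modulus principle *)

Section MaximumModulus.
Variable R : realType.
Local Notation C := R[i].

(** The five-point discretisation of [t ^+ 2] times the Laplacian of [u] at [z]. *)
Definition cross_sum (u : C -> C) (z : C) (t : R) : C :=
  u (z + t%:C) + u (z - t%:C) + u (z + 'i * t%:C) + u (z - 'i * t%:C) - 4 * u z.

Lemma cross_sum_sqr (z : C) (t : R) :
  cmod (z + t%:C) ^+ 2 + cmod (z - t%:C) ^+ 2 + cmod (z + 'i * t%:C) ^+ 2 +
    cmod (z - 'i * t%:C) ^+ 2 = 4 * cmod z ^+ 2 + 4 * t ^+ 2.
Proof. by rewrite !cmod_sqr; case: z => x y /=; ring. Qed.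

(* At an interior maximum of [Re (c u) + e |z|^2] the second differences of [u]
   in the four axis directions would have to compensate those of [e |z|^2]. *)
Lemma maximum_principle (u : C -> C) (s M : R) : 0 < s ->
  (forall z, cmod z <= s -> forall e : R, 0 < e -> exists2 d : R, 0 < d &
    forall w, cmod w <= s -> cmod (w - z) < d -> cmod (u w - u z) < e) ->
  (forall z, cmod z < s -> forall e : R, 0 < e -> exists2 d : R, 0 < d &
    forall t, 0 < t < d -> cmod (cross_sum u z t) <= e * t ^+ 2) ->
  (forall z, cmod z = s -> cmod (u z) <= M) ->
  forall z, cmod z <= s -> cmod (u z) <= M.
Proof.
move=> s0 cu du uM z1 z1s; rewrite leNgt; apply/negP => Mu.
have M0 : 0 <= M by apply: le_trans (uM s%:C _); rewrite ?cmod_ge0// cmod_real gtr0_norm.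
(* Rotates [u z1] onto the positive real axis: [complex.Re (c * u)] is at most [cmod u] everywhere,
   with equality at [z1]. *)
pose c := (u z1)^* / (cmod (u z1))%:C.
have u10 : 0 < cmod (u z1) by exact: le_lt_trans Mu.
have c1 : cmod c = 1.
  by rewrite /c cmodM cmodV cmod_conj cmod_real gtr0_norm// divff// gt_eqF.
pose v z := complex.Re (c * u z).
have vu z : v z <= cmod (u z).
  by rewrite /v (le_trans (Re_le_cmod _))// cmodM c1 mul1r.
have v1 : v z1 = cmod (u z1).
  have nz : cmod (u z1) != 0 by rewrite gt_eqF.
  rewrite /v /c mulrAC -realcV; have := cmod_sqr (u z1); move: nz.
  case: (u z1) => a b /=; set m := cmod _ => m0 hm.
  have -> : a * a - - b * b = m ^+ 2 by rewrite hm; ring.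
  by rewrite mulr0 subr0 expr2 mulfK.
(* On the circle the perturbation [e * s ^+ 2] is only half of the excess of [cmod (u z1)] over [M],
   so the perturbed function has its maximum in the open disc. *)
pose e := (cmod (u z1) - M) / (2 * s ^+ 2).
have e0 : 0 < e by rewrite divr_gt0 ?subr_gt0// mulr_gt0// exprn_gt0.
have es : e * s ^+ 2 < cmod (u z1) - M.
  have -> : e * s ^+ 2 = (cmod (u z1) - M) / 2 by rewrite /e; field; rewrite gt_eqF.
  by rewrite ltr_pdivrMr// ltr_pMr ?ltr1n// subr_gt0.
clearbody e.
pose w z := v z + e * cmod z ^+ 2.
have [|z zs zmax] := @compact_max_cmod R (cball s) w z1 (cball_compact s0) z1s.
  move=> z zs g g0; have [d d0 hd] := cu z zs (g / 2) ltac:(by rewrite divr_gt0).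
  exists (Num.min d (g / (4 * e * s))).
    rewrite lt_min d0 /= divr_gt0 ?mulr_gt0//.
  move=> y ys; rewrite lt_min => /andP[/(hd _ ys) h1 h2].
  have h3 : v y - v z < g / 2.
    apply: le_lt_trans h1; rewrite /v -raddfB -mulrBr /=.
    by rewrite (le_trans (Re_le_cmod _))// cmodM c1 mul1r.
  have h4 : e * cmod y ^+ 2 - e * cmod z ^+ 2 <= g / 2.
    have -> : e * cmod y ^+ 2 - e * cmod z ^+ 2 =
       e * ((cmod y - cmod z) * (cmod y + cmod z)) by ring.
    apply: (@le_trans _ _ (e * (cmod (y - z) * (s + s)))).
      apply: ler_wpM2l; first exact: ltW.
      apply: (@le_trans _ _ (cmod (y - z) * (cmod y + cmod z))).
        by rewrite ler_wpM2r ?addr_ge0 ?cmod_ge0// cmod_dist.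
      by rewrite ler_wpM2l ?cmod_ge0// lerD.
    have : cmod (y - z) * (4 * e * s) <= g by rewrite -ler_pdivlMr ?ltW// !mulr_gt0.
    by move=> h; have -> : e * (cmod (y - z) * (s + s)) = cmod (y - z) * (4 * e * s) / 2;
      [field|rewrite ler_pM2r// invr_gt0].
  rewrite /w; lra.
have z_s : cmod z < s.
  rewrite lt_neqAle; move: zs; rewrite /cball /= => ->; rewrite andbT; apply/eqP => zs.
  have := zmax z1 z1s; rewrite /w v1 zs.
  have := vu z; have := uM z zs; have : 0 <= e * cmod z1 ^+ 2.
    by rewrite mulr_ge0 ?sqr_ge0// ltW.
  lra.
have [d d0 hd] := du z z_s e e0.
pose t := Num.min d (s - cmod z) / 2.
have t0 : 0 < t by rewrite divr_gt0// lt_min d0 subr_gt0.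
have td : t < d.
  by rewrite ltr_pdivrMr// gt_min; apply/orP; left; rewrite ltr_pMr// ltr1n.
have ts : cmod z + t <= s.
  rewrite -lerBrDl /t ler_pdivrMr// ge_min; apply/orP; right.
  by rewrite ler_peMr ?ler1n// subr_ge0 ltW.
have near_z h : cmod h = t -> w (z + h) <= w z.
  by move=> ht; apply: zmax; rewrite /cball /= (le_trans (cmodD _ _))// ht.
have ct : cmod (t%:C : C) = t by rewrite cmod_real gtr0_norm.
have it : cmod ('i * t%:C : C) = t by rewrite cmodM cmod_i mul1r ct.
have w1 := near_z _ ct; have := near_z (- t%:C); rewrite cmodN => /(_ ct) w2.
have w3 := near_z _ it; have := near_z (- ('i * t%:C)); rewrite cmodN => /(_ it) w4.
have := hd t; rewrite t0 td => /(_ isT) h.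
(* Adding the four inequalities at the maximum [z] gives [complex.Re (c * cross_sum u z t) + 4 * e *
   t ^+ 2 <= 0], which this bound contradicts. *)
have h2 : `|complex.Re (c * cross_sum u z t)| <= e * t ^+ 2.
  by rewrite (le_trans (normRe_le _))// cmodM c1 mul1r.
have h3 : complex.Re (c * cross_sum u z t) =
    v (z + t%:C) + v (z - t%:C) + v (z + 'i * t%:C) + v (z - 'i * t%:C) - 4 * v z.
  rewrite /cross_sum mulrBr !mulrDr !raddfB !raddfD /= -!/(v _); congr (_ - _).
  rewrite mulrCA /v -(mulr_natl _ 4) -realcn; case: (c * u z) => a b /=.
  by ring.
have := cross_sum_sqr z t; have t20 : 0 < e * t ^+ 2 by rewrite mulr_gt0// exprn_gt0.
move: w1 w2 w3 w4 h2; rewrite h3 /w ler_norml => w1 w2 w3 w4 /andP[h4 _] hs.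
have : e * (4 * cmod z ^+ 2 + 4 * t ^+ 2) =
  e * cmod (z + t%:C) ^+ 2 + e * cmod (z - t%:C) ^+ 2 + e * cmod (z + 'i * t%:C) ^+ 2 +
    e * cmod (z - 'i * t%:C) ^+ 2 by rewrite -hs; ring.
have -> : e * (4 * cmod z ^+ 2 + 4 * t ^+ 2) = 4 * (e * cmod z ^+ 2) + 4 * (e * t ^+ 2) by ring.
move: w1 w2 w3 w4 h4 t20; clear.
lra.
Qed.

End MaximumModulus.

Section MaximumModulusPrinciple.
Variable R : realType.
Local Notation C := R[i].

Lemma cmod_pt_sqr (x y : R) : cmod (pt x y) ^+ 2 = x ^+ 2 + y ^+ 2.
Proof. by rewrite cmod_sqr ptE. Qed.

Lemma cmod_ltP (z : C) (r : R) : 0 < r -> (cmod z < r) = (cmod z ^+ 2 < r ^+ 2).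
Proof. by move=> r0; rewrite ltr_sqr ?nnegrE ?cmod_ge0// ltW. Qed.

Lemma sqr_le_btw (a b x : R) : a <= x <= b -> x ^+ 2 <= Num.max (a ^+ 2) (b ^+ 2).
Proof.
move=> /andP[ax xb]; rewrite le_max; have [x0|x0] := leP 0 x.
  by apply/orP; right; rewrite ler_sqr ?nnegrE// (le_trans x0).
apply/orP; left; rewrite -[leLHS]sqrrN -[leRHS]sqrrN ler_sqr ?nnegrE ?oppr_ge0 ?lerN2//.
  exact: ltW.
exact: le_trans ax (ltW x0).
Qed.

(* [F] is a primitive of [f], seen through its increments along the axes only. *)
Definition axis_primitive (f F : C -> C) (r : R) :=
  (forall a b y A B z0 (K : R), cmod (pt a y) < r -> cmod (pt b y) < r ->
    (forall x, btw a b x -> cmod (f (pt x y) - A - B * (pt x y - z0)) <= K) ->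
    cmod (F (pt b y) - F (pt a y) - (quad A B z0 (pt b y) - quad A B z0 (pt a y))) <=
      2 * K * `|b - a|) /\
  (forall x c d A B z0 (K : R), cmod (pt x c) < r -> cmod (pt x d) < r ->
    (forall y, btw c d y -> cmod (f (pt x y) - A - B * (pt x y - z0)) <= K) ->
    cmod (F (pt x d) - F (pt x c) - (quad A B z0 (pt x d) - quad A B z0 (pt x c))) <=
      2 * K * `|d - c|).

(** [F w] integrates along the real axis to [complex.Re w], then vertically to [w]. Vertical
    increments are immediate; a horizontal one at height [y] comes from Goursat's lemma on the
    rectangle reaching to the real axis, which stays in the disc. *)
Lemma axis_primitive_exists (f : C -> C) (r : R) : 0 < r <= 1 ->
  (forall z (e : R), 0 < e -> exists2 d : R, 0 < d &
    forall w, cmod (w - z) < d -> cmod (f w - f z) < e) ->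
  (forall z, cmod z < r -> derivable f z 1) ->
  exists F, axis_primitive f F r.
Proof.
move=> /andP[r0 r1] cf df.
have [H hH] := horizontal_primitive_exists cf.
have [V hV] := vertical_primitive_exists cf.
have Re2 x y : cmod (pt x y) < r -> -2 < x < 2.
  have := normRe_le (pt x y); rewrite ptE /= => h1 h2.
  by rewrite -ltr_norml (le_lt_trans h1)// (lt_trans h2)// (le_lt_trans r1)// ltr1n.
have Im2 x y : cmod (pt x y) < r -> -2 < y < 2.
  have := normIm_le (pt x y); rewrite ptE /= => h1 h2.
  by rewrite -ltr_norml (le_lt_trans h1)// (lt_trans h2)// (le_lt_trans r1)// ltr1n.
have z2 : -2 < (0 : R) < 2 by rewrite oppr_lt0 ltr0n.
have I0 a b y : a <= b -> cmod (pt a y) < r -> cmod (pt b y) < r ->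
    H b y - H a y = H b 0 - H a 0 + (V b y - V b 0) - (V a y - V a 0).
  move=> ab ar br.
  have a2 := Re2 _ _ ar; have b2 := Re2 _ _ br; have y2 := Im2 _ _ ar.
  have D x t : a <= x <= b -> (0 <= t <= y) || (y <= t <= 0) ->
      derivable f (pt x t) 1.
    move=> xab ty; apply: df; rewrite cmod_ltP// cmod_pt_sqr.
    have t2 : t ^+ 2 <= y ^+ 2.
      have: t ^+ 2 <= Num.max (0 ^+ 2) (y ^+ 2).
        by case/orP: ty => /sqr_le_btw//; rewrite maxC.
      by rewrite expr0n /= (max_idPr (sqr_ge0 y)).
    move: ar br; rewrite !cmod_ltP// !cmod_pt_sqr => ar br.
    have := sqr_le_btw xab; rewrite le_max => /orP[] h; lra.
  have [y0|/ltW y0] := leP 0 y.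
    have := goursat hH hV a2 b2 z2 y2 ab y0.
    move=> /(_ (fun x t xab ty => D x t xab ltac:(by rewrite ty))).
    rewrite /rect_integral => /eqP; rewrite subr_eq add0r subr_eq => /eqP e.
    by apply/esym/eqP; rewrite subr_eq e addrC.
  have := goursat hH hV a2 b2 y2 z2 ab y0.
  move=> /(_ (fun x t xab ty => D x t xab ltac:(by rewrite ty orbT))).
  rewrite /rect_integral => e.
  by apply/eqP; rewrite -subr_eq0 -[X in _ == X]e; apply/eqP; ring.
exists (fun w => H (complex.Re w) 0 + V (complex.Re w) (complex.Im w) - V (complex.Re w) 0).
split=> [a b y A B z0 K ar br hK|x c d A B z0 K cr dr hK].
  have a2 := Re2 _ _ ar; have b2 := Re2 _ _ br.
  apply: le_trans (hH y a b A B z0 K a2 b2 hK).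
  rewrite le_eqVlt; apply/orP; left; apply/eqP; congr (cmod (_ - _)).
  rewrite !ptE /=; have [ab|/ltW ba] := leP a b; first by rewrite I0//; ring.
  by rewrite -[RHS]opprB I0//; ring.
apply: le_trans (hV x c d A B z0 K (Im2 _ _ cr) (Im2 _ _ dr) hK).
rewrite le_eqVlt; apply/orP; left; apply/eqP; congr (cmod (_ - _)).
by rewrite !ptE /=; ring.
Qed.


Section AxisPrimitive.
Variables (f F : C -> C) (r : R).
Hypothesis r01 : 0 < r <= 1.
Hypothesis cf : forall z (e : R), 0 < e -> exists2 d : R, 0 < d &
    forall w, cmod (w - z) < d -> cmod (f w - f z) < e.
Hypothesis df : forall z, cmod z < r -> derivable f z 1.
Hypothesis fF : axis_primitive f F r.

Lemma axis_increment z h (t : R) A B (K : R) :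
  h = t%:C \/ h = 'i * t%:C -> cmod z < r -> cmod (z + h) < r ->
  (forall w, cmod (w - z) <= `|t| -> cmod (f w - A - B * (w - z)) <= K) ->
  cmod (F (z + h) - F z - (A * h + B * h ^+ 2 / 2)) <= 2 * K * `|t|.
Proof.
have bound a b u : btw a b u -> `|u - a| <= `|b - a|.
  case/orP => /andP[h1 h2].
    by rewrite !ger0_norm ?subr_ge0 ?(le_trans h1)// lerB.
  by rewrite distrC [leRHS]distrC !ger0_norm ?subr_ge0 ?(le_trans h1)// lerB.
move=> H zr zhr hK; have [H1 H2] := fF; have ez := ReIm_pt z.
set x := complex.Re z in ez; set y := complex.Im z in ez.
have E : quad A B z (z + h) - quad A B z z = A * h + B * h ^+ 2 / 2.
  by rewrite /quad; field.
rewrite -E; case: H E zhr => -> E zhr.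
  have e2 : z + t%:C = pt (x + t) y by rewrite {1}ez /pt realcD; ring.
  have e3 : `|t| = `|x + t - x| by congr `|_|; ring.
  have := H1 x (x + t) y A B z K; rewrite -ez -e2 -e3; apply => //.
  move=> u /bound; rewrite -e3 => ut; apply: hK; apply: le_trans ut.
  by rewrite ez (_ : _ - _ = (u - x)%:C) ?cmod_real// /pt realcB; ring.
have e2 : z + 'i * t%:C = pt x (y + t) by rewrite {1}ez /pt realcD; ring.
have e3 : `|t| = `|y + t - y| by congr `|_|; ring.
have := H2 x y (y + t) A B z K; rewrite -ez -e2 -e3; apply => //.
move=> u /bound; rewrite -e3 => ut; apply: hK; apply: le_trans ut.
rewrite ez (_ : _ - _ = 'i * (u - y)%:C) ?cmodM ?cmod_i ?mul1r ?cmod_real//.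
by rewrite /pt realcB; ring.
Qed.

Lemma axis_primitive_continuous z : cmod z < r -> forall e : R, 0 < e ->
  exists2 d : R, 0 < d & forall w, cmod (w - z) < d -> cmod (F w - F z) < e.
Proof.
move=> zr e e0; have [d d0 hd] := cf z (@ltr01 R).
have A0 := cmod_ge0 (f z); set A := cmod (f z) in A0.
(* With [f] within [1] of [f z], each of the two legs has an error at most [2 * cmod (w - z)], and
   the main term is [A * cmod (w - z)]; the denominator exceeds the total [A + 4]. *)
exists (Num.min (Num.min (d / 2) (r - cmod z)) (e / (2 * A + 4 + 1))).
  by rewrite !lt_min subr_gt0 zr !divr_gt0//; lra.
move=> w; rewrite !lt_min => /andP[/andP[wd wr]]; rewrite ltr_pdivlMr; last lra.
move=> we; pose a := complex.Re (w - z); pose b := complex.Im (w - z).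
have wz : w - z = a%:C + 'i * b%:C by exact: ReIm_pt.
have aw : `|a| <= cmod (w - z) by exact: normRe_le.
have bw : `|b| <= cmod (w - z) by exact: normIm_le.
have near_z v : cmod (v - z) <= cmod (w - z) -> cmod v < r.
  move=> vz; rewrite -[v](subrK z) (le_lt_trans (cmodD _ _))//.
  by rewrite -ltrBrDr (le_lt_trans vz).
have c1 : cmod (z + a%:C) < r by apply: near_z; rewrite addrC addKr cmod_real.
have c2 : cmod (z + a%:C + 'i * b%:C) < r.
  by apply: near_z; rewrite (_ : _ - z = w - z)// wz; ring.
have ew : w = z + a%:C + 'i * b%:C by rewrite -[LHS](subrK z) wz; ring.
have := axis_increment (or_introl (erefl a%:C)) (A := f z) (B := 0) (K := 1) zr c1.
have := axis_increment (or_intror (erefl ('i * b%:C))) (A := f z) (B := 0) (K := 1) c1 c2.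
rewrite -ew !mul0r !addr0 => h2 h1.
have {}h1 : cmod (F (z + a%:C) - F z - f z * a%:C) <= 2 * 1 * `|a|.
  apply: h1 => v va; rewrite mul0r subr0 ltW// hd//.
  by rewrite (le_lt_trans va)// (le_lt_trans aw)// (lt_trans wd)// ltr_pdivrMr// ltr_pMr ?ltr1n.
have {}h2 : cmod (F w - F (z + a%:C) - f z * ('i * b%:C)) <= 2 * 1 * `|b|.
  apply: h2 => v vb; rewrite mul0r subr0 ltW// hd// (le_lt_trans (cmod_distD (z + a%:C) _ _))//.
  rewrite [d]splitr ltr_leD//; first exact: le_lt_trans vb (le_lt_trans bw wd).
  by rewrite addrC addKr cmod_real (le_trans aw)// ltW.
have -> : F w - F z = (F (z + a%:C) - F z - f z * a%:C) +
    (F w - F (z + a%:C) - f z * ('i * b%:C)) + f z * (w - z) by rewrite wz; ring.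
have := cmodD ((F (z + a%:C) - F z - f z * a%:C) +
    (F w - F (z + a%:C) - f z * ('i * b%:C))) (f z * (w - z)).
have := cmodD (F (z + a%:C) - F z - f z * a%:C)
    (F w - F (z + a%:C) - f z * ('i * b%:C)).
rewrite cmodM -/A; have := cmod_ge0 (w - z); have : 0 <= A * cmod (w - z).
  by rewrite mulr_ge0 ?cmod_ge0.
move: we h1 h2 aw bw; rewrite mulrDr mulrDr; clear.
set X := cmod (w - z) => we h1 h2 aw bw; have := mulrC A X; lra.
Qed.

(** The steps [t], [- t], ['i * t], [- 'i * t] have zero sum and zero sum of squares, so the four
    quadratic approximations of [F] cancel and only their errors remain. *)
Lemma cross_sum_axis_primitive z : cmod z < r -> forall e : R, 0 < e ->
  exists2 d : R, 0 < d & forall t, 0 < t < d -> cmod (cross_sum F z t) <= e * t ^+ 2.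
Proof.
move=> zr e e0; have /derivable_cmodP[l hl] := df zr.
have [d d0 hd] := hl (e / 8) ltac:(by rewrite divr_gt0).
exists (Num.min d (r - cmod z)); first by rewrite lt_min d0 subr_gt0.
move=> t /andP[t0]; rewrite lt_min => /andP[td tr].
have near_z h : cmod h = t -> cmod (z + h) < r.
  by move=> ht; rewrite (le_lt_trans (cmodD _ _))// ht -ltrBrDl.
have ct : cmod (t%:C : C) = t by rewrite cmod_real gtr0_norm.
have it : cmod ('i * t%:C : C) = t by rewrite cmodM cmod_i mul1r ct.
have step h (s : R) : h = s%:C \/ h = 'i * s%:C -> `|s| = t ->
    cmod (F (z + h) - F z - (f z * h + l * h ^+ 2 / 2)) <= e / 4 * t ^+ 2.
  move=> hs st; have ht : cmod h = t.
    by case: hs => ->; rewrite ?cmodM ?cmod_i ?mul1r cmod_real.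
  have -> : e / 4 * t ^+ 2 = 2 * (e / 8 * t) * `|s| by rewrite st; field.
  apply: axis_increment hs zr (near_z _ ht) _ => w; rewrite st => wt.
  rewrite (le_trans (hd _ (le_lt_trans wt td)))// ler_pM2l ?divr_gt0//.
have e4 : - ('i * t%:C) = 'i * (- t)%:C :> C by rewrite realcN mulrN.
have nt : `|- t| = t by rewrite normrN gtr0_norm.
have s1 := step _ t (or_introl erefl) (gtr0_norm t0).
have s2 := step (- t%:C) (- t) (or_introl (esym (realcN _))) nt.
have s3 := step _ t (or_intror erefl) (gtr0_norm t0).
have s4 := step (- ('i * t%:C)) (- t) (or_intror e4) nt.
move: s1 s2 s3 s4; set E1 := F _ - _ - _; set E2 := F _ - _ - _.
set E3 := F _ - _ - _; set E4 := F _ - _ - _ => s1 s2 s3 s4.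
have -> : cross_sum F z t = E1 + E2 + E3 + E4.
  by rewrite /cross_sum /E1 /E2 /E3 /E4; field: (ii R).
have := cmodD (E1 + E2 + E3) E4; have := cmodD (E1 + E2) E3; have := cmodD E1 E2.
move: s1 s2 s3 s4; clear; lra.
Qed.

(** The second-difference test applies to [q w = (F (w + t) - F w) / t], which inherits small cross
    sums from [F]. Uniform continuity puts [q] within [e / 2] of [f], so the bound passes from the
    circle to its interior up to [e]. *)
Lemma maximum_modulus_global s M : 0 < s < r ->
  (forall z, cmod z = s -> cmod (f z) <= M) ->
  forall z, cmod z <= s -> cmod (f z) <= M.
Proof.
move=> /andP[s0 sr] fM z zs; apply/ler_addgt0Pr => e e0.
have [_ r1] := andP r01.
have [|d d0 hd] := @heine_cantor_cmod R (cball 1) f (cball_compact ltr01) _ (e / 4)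
    ltac:(by rewrite divr_gt0).
  by move=> w _ g /(cf w)[d d0 hd]; exists d => // v _; exact: hd.
pose t := Num.min d (r - s) / 2.
have t0 : 0 < t by rewrite divr_gt0// lt_min d0 subr_gt0.
have td : t < d.
  by rewrite ltr_pdivrMr// gt_min; apply/orP; left; rewrite ltr_pMr// ltr1n.
have ts : t < r - s.
  rewrite ltr_pdivrMr// gt_min; apply/orP; right.
  by rewrite ltr_pMr ?ltr1n// subr_gt0.
clearbody t.
have tC : t%:C != 0 :> C by rewrite -cmod_eq0 cmod_real normr_eq0 gt_eqF.
have inr w : cmod w <= s -> cmod (w + t%:C) < r.
  by move=> ws; rewrite (le_lt_trans (cmodD _ _))// cmod_real gtr0_norm//; lra.
pose q w := (F (w + t%:C) - F w) / t%:C.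
have qf w : cmod w <= s -> cmod (q w - f w) <= e / 2.
  move=> ws.
  have -> : q w - f w = (F (w + t%:C) - F w - (f w * t%:C + 0 * t%:C ^+ 2 / 2)) / t%:C.
    by rewrite /q; field.
  rewrite cmodM cmodV cmod_real gtr0_norm// ler_pdivrMr//.
  have -> : e / 2 * t = 2 * (e / 4) * `|t| by rewrite gtr0_norm//; field.
  apply: axis_increment (or_introl erefl) _ (inr _ ws) _; first exact: le_lt_trans sr.
  move=> v; rewrite gtr0_norm// mul0r subr0 => vt; apply/ltW/hd.
  - by rewrite /cball /= (le_trans ws)// (le_trans (ltW sr)).
  - rewrite /cball /= -[v](subrK w) (le_trans (cmodD _ _))//; lra.
  - exact: le_lt_trans vt td.
have qM : forall w, cmod w <= s -> cmod (q w) <= M + e / 2.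
  apply: maximum_principle => //.
  - move=> w ws g g0.
    have [d1 d10 hd1] := axis_primitive_continuous (le_lt_trans ws sr)
      (e := g * t / 2) ltac:(by rewrite divr_gt0// mulr_gt0).
    have [d2 d20 hd2] := axis_primitive_continuous (inr _ ws)
      (e := g * t / 2) ltac:(by rewrite divr_gt0// mulr_gt0).
    exists (Num.min d1 d2) => [|v vs]; first by rewrite lt_min d10.
    rewrite lt_min => /andP[/hd1 h1 v2].
    have {}h2 : cmod (F (v + t%:C) - F (w + t%:C)) < g * t / 2.
      by apply: hd2; rewrite (_ : _ - _ = v - w)//; ring.
    have -> : q v - q w = (F (v + t%:C) - F (w + t%:C) - (F v - F w)) / t%:C.
      by rewrite /q; field.
    rewrite cmodM cmodV cmod_real gtr0_norm// ltr_pdivrMr// (le_lt_trans (cmodB _ _))//.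
    by rewrite [g * t]splitr ltrD.
  - move=> w ws g g0.
    have [d1 d10 hd1] := cross_sum_axis_primitive (lt_trans ws sr)
      (e := g * t / 2) ltac:(by rewrite divr_gt0// mulr_gt0).
    have [d2 d20 hd2] := cross_sum_axis_primitive (inr _ (ltW ws))
      (e := g * t / 2) ltac:(by rewrite divr_gt0// mulr_gt0).
    exists (Num.min d1 d2) => [|v /andP[v0]]; first by rewrite lt_min d10.
    rewrite lt_min => /andP[v1 v2].
    have := hd1 v; rewrite v0 v1 => /(_ isT) h1; have := hd2 v; rewrite v0 v2 => /(_ isT) h2.
    have -> : cross_sum q w v = (cross_sum F (w + t%:C) v - cross_sum F w v) / t%:C.
      have e1 h : w + h + t%:C = w + t%:C + h by ring.
      by rewrite /cross_sum /q !e1; field.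
    rewrite cmodM cmodV cmod_real gtr0_norm// ler_pdivrMr// (le_trans (cmodB _ _))//.
    by rewrite (le_trans (lerD h2 h1))// le_eqVlt; apply/orP; left; apply/eqP; field.
  - move=> w ws; rewrite -[q w](subrK (f w)) (le_trans (cmodD _ _))// addrC.
    by rewrite lerD ?fM// qf// ws.
have := qM z zs; have := qf z zs; rewrite cmodBC => h1 h2.
rewrite -[f z](subrK (q z)) (le_trans (cmodD _ _))// [e]splitr addrC addrA lerD//.
Qed.

End AxisPrimitive.

(** The primitives were built for functions continuous on the whole plane. Composing [f] with the
    radial retraction [ret] onto a disc of radius [r] between [s] and [1] provides such a function,
    equal to [f] on that disc. *)
Lemma maximum_modulus (f : C -> C) (s M : R) : s < 1 ->
  (forall z, unit_disc z -> derivable f z 1) ->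
  (forall z, cmod z = s -> cmod (f z) <= M) ->
  forall z, cmod z <= s -> cmod (f z) <= M.
Proof.
(* For [s <= 0] any point with [cmod z <= s] already lies on the circle. *)
move=> s1 df fM z zs; have [s0|] := ltP 0 s; last first.
  move=> s0; apply: fM; apply/le_anti; rewrite zs /=.
  by rewrite (le_trans s0)// cmod_ge0.
pose r := (1 + s) / 2.
have [r0 r1 sr] : [/\ 0 < r, r < 1 & s < r] by rewrite /r; split; lra.
clearbody r.
pose den (z : C) : R := r / Num.max r (cmod z).
have den1 w : cmod w <= r -> den w = 1.
  by move=> wr; rewrite /den (max_idPl wr) divff// gt_eqF.
have max0 w : 0 < Num.max r (cmod w) by rewrite lt_max r0.
pose ret (z : C) := (den z)%:C * z.
have ret_r w : cmod (ret w) <= r.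
  rewrite cmodM cmod_real /den ger0_norm; last by rewrite divr_ge0// ltW.
  by rewrite -mulrA ler_piMr ?(ltW r0)// ler_pdivrMl// mulr1 le_max lexx orbT.
have ret_id w : cmod w <= r -> ret w = w by move=> /den1 e; rewrite /ret e mul1r.
have maxL w v : Num.max r (cmod w) - Num.max r (cmod v) <= cmod (w - v).
  rewrite lerBlDr ge_max; apply/andP; split.
    by rewrite (le_trans (_ : r <= Num.max r (cmod v)))// ?lerDr ?cmod_ge0// le_max lexx.
  by rewrite -lerBlDl (le_trans _ (_ : cmod v <= _))// ?le_max ?lexx ?orbT// lerBlDr -lerBlDl cmod_dist.
have maxN w v : `|Num.max r (cmod v) - Num.max r (cmod w)| <= cmod (w - v).
  by rewrite ler_norml lerNl opprB maxL cmodBC maxL.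
have retL w v : cmod (ret w - ret v) <= 2 * cmod (w - v).
  have -> : ret w - ret v = (den w)%:C * (w - v) + (den w - den v)%:C * v.
    by rewrite /ret realcB; ring.
  rewrite mulr2n mulrDl mul1r (le_trans (cmodD _ _))// lerD// cmodM cmod_real.
    rewrite ler_piMl ?cmod_ge0// /den ger0_norm; last by rewrite divr_ge0// ltW.
    by rewrite ler_pdivrMr// mul1r le_max lexx.
  have := max0 w; have := max0 v; have := maxN w v.
  have : cmod v <= Num.max r (cmod v) by rewrite le_max lexx orbT.
  have : r <= Num.max r (cmod w) by rewrite le_max lexx.
  rewrite /den; set m := Num.max r (cmod v); set n := Num.max r (cmod w).
  move=> rn vm mn m0 n0.
  have -> : r / n - r / m = (m - n) * (r / n) / m.
    by field; rewrite !gt_eqF.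
  rewrite !normrM [ `|r|]gtr0_norm// !normfV !(gtr0_norm m0) !(gtr0_norm n0).
  have -> : `|m - n| * (r / n) / m * cmod v = `|m - n| * ((r / n) * (cmod v / m)) by ring.
  apply: le_trans mn; rewrite ler_piMr// mulr_ile1 ?divr_ge0 ?cmod_ge0 ?(ltW r0) ?(ltW m0) ?(ltW n0)//.
    by rewrite ler_pdivrMr// mul1r.
  by rewrite ler_pdivrMr// mul1r.
have ret1 w : cmod (ret w) < 1 by exact: le_lt_trans r1.
have cg w (e : R) : 0 < e -> exists2 d : R, 0 < d &
    forall v, cmod (v - w) < d -> cmod ((f \o ret) v - (f \o ret) w) < e.
  move=> e0; have := derivable_continuous (df (ret w) ltac:(by rewrite unit_discE)).
  move/continuous_cmodP => /(_ e e0)[d d0 hd]; exists (d / 2); first by rewrite divr_gt0.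
  move=> v vw; apply: hd; rewrite (le_lt_trans (retL _ _))//.
  by rewrite -ltr_pdivlMl// mulrC.
have dg w : cmod w < r -> derivable (f \o ret) w 1.
  move=> wr; apply: (@near_eq_derivable _ _ _ f).
    apply/nbhs_cmodP; exists (r - cmod w); first by rewrite subr_gt0.
    move=> v vw; rewrite /= ret_id// -[v](subrK w) (le_trans (cmodD _ _))//.
    by rewrite -lerBrDr ltW.
  by apply: df; rewrite unit_discE (lt_trans wr).
have r01 : 0 < r <= 1 by rewrite r0 ltW.
have [F hF] := axis_primitive_exists r01 cg dg.
have ssr : 0 < s < r by rewrite s0.
have := maximum_modulus_global r01 cg dg hF ssr (M := M).
move=> /(_ _ z zs); rewrite /= ret_id; last exact: le_trans zs (ltW sr).
by apply => w ws; rewrite ret_id ?ws ?(ltW sr)//; exact: fM.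
Qed.

End MaximumModulusPrinciple.

(** * The Schwarz lemma *)

Section Schwarz.
Variable R : realType.
Local Notation C := R[i].

Lemma derivable_id_sub (p z : C) : derivable (fun w => w - p) z 1.
Proof. by apply: derivableB; [exact: derivable_id|exact: derivable_cst]. Qed.

Lemma derivable_mul (f g : C -> C) z :
  derivable f z 1 -> derivable g z 1 -> derivable (fun w => f w * g w) z 1.
Proof. exact: derivableM. Qed.

Lemma derivable_inv (f : C -> C) z :
  f z != 0 -> derivable f z 1 -> derivable (fun w => (f w)^-1) z 1.
Proof. exact: derivableV. Qed.

Lemma derivable_add (f g : C -> C) z :
  derivable f z 1 -> derivable g z 1 -> derivable (fun w => f w + g w) z 1.
Proof. exact: derivableD. Qed.

Lemma derivable_pow (f : C -> C) z n :
  derivable f z 1 -> derivable (fun w => f w ^+ n) z 1.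
Proof.
move=> df; elim: n => [|n IH]; first exact: derivable_cst.
by under eq_fun do rewrite exprS; exact: derivable_mul.
Qed.

Lemma derivable_comp (f g : C -> C) z :
  derivable f z 1 -> derivable g (f z) 1 -> derivable (fun w => g (f w)) z 1.
Proof.
move=> /derivable1_diffP df /derivable1_diffP dg.
by apply/derivable1_diffP; exact: (differentiable_comp df dg).
Qed.

Lemma continuous_mul (f g : C -> C) z : {for z, continuous f} ->
  {for z, continuous g} -> {for z, continuous (fun w => f w * g w)}.
Proof. by move=> cf cg; apply: (@continuousM C C f g z cf cg). Qed.

Lemma continuous_pow (f : C -> C) z n :
  {for z, continuous f} -> {for z, continuous (fun w => f w ^+ n)}.
Proof.
move=> cf; elim: n => [|n IH].
  have -> : (fun w => f w ^+ 0) = (fun=> 1) by apply/funext => w; rewrite expr0.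
  exact: cst_continuous.
have -> : (fun w => f w ^+ n.+1) = (fun w => f w * f w ^+ n).
  by apply/funext => w; rewrite exprS.
exact: continuous_mul.
Qed.

(* Holomorphic functions on the disc with finitely many possible exceptions, at
   which they are still continuous: quotients such as [f z / z] arise in this
   form, and no removability theorem is needed to bound them. *)
Definition holomorphic_off (s : seq C) (f : C -> C) :=
  forall z, cmod z < 1 -> {for z, continuous f} /\ (z \notin s -> derivable f z 1).

Lemma derivable_off (f : C -> C) :
  (forall z, cmod z < 1 -> derivable f z 1) -> holomorphic_off [::] f.
Proof. by move=> df z z1; split; [exact/derivable_continuous/df|move=> _; exact: df]. Qed.

(** The difference quotient at [p] is [f] itself, so continuity gives the derivative [f p]. Each
    factor [z - p] thus removes one exceptional point. *)
Lemma derivable_mul_root (f : C -> C) p : {for p, continuous f} ->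
  derivable (fun z => (z - p) * f z) p 1.
Proof.
move=> /continuous_cmodP cf; apply/derivable_cmodP; exists (f p) => e e0.
have [d d0 hd] := cf e e0; exists d => // w wp.
rewrite subrr mul0r subr0 (_ : _ - _ = (f w - f p) * (w - p)); last by ring.
by rewrite cmodM ler_wpM2r ?cmod_ge0// ltW// hd.
Qed.

Lemma holomorphic_off_mul_root p (s : seq C) f : holomorphic_off (p :: s) f ->
  holomorphic_off s (fun z => (z - p) * f z).
Proof.
move=> hf z z1; have [cf df] := hf z z1; split.
  by apply: continuous_mul cf; apply: derivable_continuous; exact: derivable_id_sub.
move=> zs; have [zp|zp] := eqVneq z p; first by rewrite zp in cf *; exact: derivable_mul_root.
apply: derivable_mul; first exact: derivable_id_sub.
by apply: df; rewrite inE negb_or zp.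
Qed.

Lemma derivable_prod_root (s : seq C) f : holomorphic_off s f ->
  forall z, cmod z < 1 -> derivable (fun z => (\prod_(p <- s) (z - p)) * f z) z 1.
Proof.
elim: s f => [|p s IH] f hf z z1.
  by under eq_fun do rewrite big_nil mul1r; have [_] := hf z z1; exact.
under eq_fun do rewrite big_cons (mulrC (_ - p)) -mulrA.
exact: (IH (fun z => (z - p) * f z) (holomorphic_off_mul_root hf) z z1).
Qed.

Lemma holomorphic_off_pow s (f : C -> C) n : holomorphic_off s f ->
  holomorphic_off s (fun z => f z ^+ n).
Proof.
move=> hf z z1; have [cf df] := hf z z1.
split; first exact: continuous_pow.
by move=> zs; apply: derivable_pow; exact: df.
Qed.

(** Constants disappear under large powers. Here [c] and [B] will be a value and a bound of the
    polynomial that kills the exceptional points; [c] is positive only away from them. *)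
Lemma le_of_geometric (a b c B : R) : 0 <= a -> 0 <= b -> 0 < c ->
  (forall n, c * a ^+ n <= B * b ^+ n) -> a <= b.
Proof.
move=> a0 b0 c0 h; rewrite leNgt; apply/negP => ba.
have a1 : 0 < a by exact: le_lt_trans ba.
have : (fun n => B * (b / a) ^+ n) @ \oo --> B * 0.
  apply: cvgMr; apply: cvg_expr; rewrite ger0_norm ?divr_ge0//.
  by rewrite ltr_pdivrMr// mul1r.
rewrite mulr0 => /cvgrPdist_lt/(_ _ c0)[k _ /(_ k (leqnn k))] /=.
rewrite sub0r normrN => /(le_lt_trans (ler_norm _)); rewrite expr_div_n mulrA.
by rewrite ltr_pdivrMr ?exprn_gt0// ltNge h.
Qed.

Lemma maximum_modulus_off (s : seq C) (f : C -> C) (r M : R) : 0 < r < 1 ->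
  holomorphic_off s f -> (forall z, cmod z = r -> cmod (f z) <= M) ->
  forall z, cmod z <= r -> z \notin s -> cmod (f z) <= M.
Proof.
move=> /andP[r0 r1] hf fM z zr zs.
have M0 : 0 <= M.
  by apply: le_trans (fM r%:C _); rewrite ?cmod_ge0// cmod_real gtr0_norm.
pose P (w : C) := \prod_(p <- s) (w - p).
pose B := \prod_(p <- s) (1 + cmod p).
have PB w : cmod w <= 1 -> cmod (P w) <= B.
  move=> w1; rewrite /P /B; elim: s {hf zs P B} => [|p s IH].
    by rewrite !big_nil cmod1.
  rewrite !big_cons cmodM ler_pM ?cmod_ge0// (le_trans (cmodB _ _))//.
  by rewrite lerD2r.
have Pz : 0 < cmod (P z).
  rewrite cmod_gt0 /P; elim: s zs {hf P B PB} => [|p s IH].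
    by rewrite big_nil oner_eq0.
  by rewrite inE negb_or big_cons mulf_eq0 negb_or subr_eq0 => /andP[-> /IH].
apply: (@le_of_geometric _ _ (cmod (P z)) B); rewrite ?cmod_ge0// => n.
have dn w : unit_disc w -> derivable (fun w => P w * f w ^+ n) w 1.
  rewrite unit_discE; apply: derivable_prod_root; exact: holomorphic_off_pow.
rewrite -cmodX -cmodM; apply: (maximum_modulus r1 dn _ zr) => w wr.
rewrite cmodM cmodX ler_pM ?cmod_ge0 ?exprn_ge0 ?cmod_ge0//.
  by rewrite PB// wr ltW.
by rewrite lerXn2r ?nnegrE ?cmod_ge0// fM.
Qed.

(** The disc automorphism sending [a] to [0], with inverse [moebius (- a)]; [cmod (moebius a z)] is
    the pseudo-hyperbolic distance from [a] to [z]. *)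
Definition moebius (a z : C) : C := (z - a) / (1 - a^* * z).

Lemma cmod_sub_moebius (a z : C) : cmod (1 - a^* * z) ^+ 2 - cmod (z - a) ^+ 2 =
  (1 - cmod a ^+ 2) * (1 - cmod z ^+ 2).
Proof. by rewrite !cmod_sqr; case: a => a b; case: z => x y /=; ring. Qed.

Lemma moebius_den_ge (a z : C) : cmod z <= 1 -> 1 - cmod a <= cmod (1 - a^* * z).
Proof.
move=> z1; rewrite (le_trans _ (cmod_dist _ _))// cmod1 lerB// cmodM cmod_conj.
by rewrite ler_piMr ?cmod_ge0.
Qed.

Lemma moebius_den_neq0 (a z : C) : cmod a < 1 -> cmod z <= 1 -> 1 - a^* * z != 0.
Proof.
by move=> a1 /(moebius_den_ge a) h; rewrite -cmod_gt0 (lt_le_trans _ h)// subr_gt0.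
Qed.

Lemma cmod_moebius_sqr (a z : C) : cmod a < 1 -> cmod z <= 1 ->
  cmod (moebius a z) ^+ 2 =
    1 - (1 - cmod a ^+ 2) * (1 - cmod z ^+ 2) / cmod (1 - a^* * z) ^+ 2.
Proof.
move=> a1 z1; have := moebius_den_neq0 a1 z1.
rewrite -cmod_eq0 -cmod_sub_moebius cmodM cmodV => h0.
by field.
Qed.

Lemma cmod_moebius_le1 (a z : C) : cmod a < 1 -> cmod z <= 1 -> cmod (moebius a z) <= 1.
Proof.
move=> a1 z1; rewrite -ler_sqr ?nnegrE ?cmod_ge0// expr1n cmod_moebius_sqr//.
rewrite gerBl divr_ge0 ?sqr_ge0// mulr_ge0// subr_ge0 expr_le1// ?cmod_ge0//.
exact: ltW.
Qed.

Lemma cmod_moebius_lt1 (a z : C) : cmod a < 1 -> cmod z < 1 -> cmod (moebius a z) < 1.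
Proof.
move=> a1 z1; rewrite -ltr_sqr ?nnegrE ?cmod_ge0// expr1n cmod_moebius_sqr ?ltW//.
rewrite ltrBlDr ltrDl divr_gt0 ?exprn_gt0 ?cmod_gt0 ?moebius_den_neq0 ?ltW//.
by rewrite mulr_gt0// subr_gt0 expr_lt1// ?cmod_ge0.
Qed.

Lemma derivable_moebius (a z : C) : cmod a < 1 -> cmod z <= 1 -> derivable (moebius a) z 1.
Proof.
move=> a1 z1; apply: derivable_mul; first exact: derivable_id_sub.
apply: derivable_inv; first exact: moebius_den_neq0.
apply: derivableB; first exact: derivable_cst.
by apply: derivable_mul; [exact: derivable_cst|exact: derivable_id].
Qed.

Lemma moebius_self (a : C) : moebius a a = 0.
Proof. by rewrite /moebius subrr mul0r. Qed.

Lemma moebius_eq0 (a z : C) : cmod a < 1 -> cmod z <= 1 -> (moebius a z == 0) = (z == a).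
Proof.
move=> a1 z1; rewrite /moebius mulf_eq0 invr_eq0 (negbTE (moebius_den_neq0 a1 z1)).
by rewrite orbF subr_eq0.
Qed.

End Schwarz.

(** * The Schwarz-Pick lemma and its equality case *)

Section SchwarzPick.
Variable R : realType.
Local Notation C := R[i].

Lemma derivable_sub_cst (f : C -> C) (c z : C) :
  derivable f z 1 -> derivable (fun w => f w - c) z 1.
Proof. by move=> df; apply: derivableB; [exact: df|exact: derivable_cst]. Qed.

Lemma continuous_sub_cst (f : C -> C) (c z : C) :
  {for z, continuous f} -> {for z, continuous (fun w => f w - c)}.
Proof.
move=> cf; apply: (@continuousB _ _ _ f (fun=> c)); first exact: cf.
exact: cst_continuous.
Qed.

Lemma slope_continuous (f : C -> C) w : f w = 0 -> derivable f w 1 ->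
  exists k : C -> C, {for w, continuous k} /\ forall z, z != w -> k z = f z / (z - w).
Proof.
move=> fw /derivable_cmodP[l hl]; exists (fun z => if z == w then l else f z / (z - w)).
split=> [|z /negbTE ->//]; apply/continuous_cmodP => e e0.
have [d d0 hd] := hl (e / 2) ltac:(by rewrite divr_gt0).
exists d => // z zw; rewrite eqxx; have [_|zw0] := eqVneq z w.
  by rewrite subrr cmod0.
have zw1 : z - w != 0 by rewrite subr_eq0.
have -> : f z / (z - w) - l = (f z - f w - l * (z - w)) / (z - w).
  by rewrite fw; field.
rewrite cmodM cmodV ltr_pdivrMr ?cmod_gt0// (le_lt_trans (hd _ zw))//.
by rewrite ltr_pM2r ?cmod_gt0// ltr_pdivrMr// ltr_pMr// ltr1n.
Qed.

Lemma derivable_slope (f k : C -> C) w z : (forall z, z != w -> k z = f z / (z - w)) ->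
  z != w -> derivable f z 1 -> derivable k z 1.
Proof.
move=> ek zw df; apply: (@near_eq_derivable _ _ _ (fun z => f z / (z - w))).
  apply/nbhs_cmodP; exists (cmod (z - w)); first by rewrite cmod_gt0 subr_eq0.
  move=> v vz; rewrite ek//; apply: contraTneq vz => ->.
  by rewrite -leNgt cmodBC.
apply: derivable_mul; first exact: df.
by apply: derivable_inv; [rewrite subr_eq0|exact: derivable_id_sub].
Qed.

(** The zero at [w] is divided out through the slope function, extended by the derivative. Only
    continuity of the quotient at [w] is established, so [w] joins the exceptional points. *)
Lemma quotient_moebius (s : seq C) (f : C -> C) w : cmod w < 1 -> w \notin s ->
  holomorphic_off s f -> f w = 0 ->
  exists g, holomorphic_off (w :: s) g /\
    forall z, cmod z < 1 -> f z = g z * moebius w z.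
Proof.
move=> w1 ws hf fw; have [cfw dfw] := hf w w1.
have [k [ck ek]] := slope_continuous fw (dfw ws).
have dden z : derivable (fun z => 1 - w^* * z) z 1.
  apply: derivableB; first exact: derivable_cst.
  by apply: derivable_mul; [exact: derivable_cst|exact: derivable_id].
exists (fun z => k z * (1 - w^* * z)); split=> z z1; last first.
  have den0 := moebius_den_neq0 w1 (ltW z1).
  have [->|zw] := eqVneq z w; first by rewrite moebius_self mulr0 fw.
  have zw1 : z - w != 0 by rewrite subr_eq0.
  by rewrite ek// /moebius; field; rewrite den0 zw1.
have [cf df] := hf z z1; split.
  apply: continuous_mul; last exact/derivable_continuous/dden.
  have [->|zw] := eqVneq z w; first exact: ck.
  have zw1 : z - w != 0 by rewrite subr_eq0.
  apply/continuous_cmodP => e e0.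
  have : {for z, continuous (fun z => f z / (z - w))}.
    apply: continuous_mul; first exact: cf.
    by apply: derivable_continuous; apply: derivable_inv; [exact: zw1|exact: derivable_id_sub].
  move/continuous_cmodP => /(_ e e0)[d d0 hd].
  exists (Num.min d (cmod (z - w))); first by rewrite lt_min d0 cmod_gt0.
  move=> v; rewrite lt_min => /andP[vd vz]; rewrite !ek//; first exact: hd.
  by apply: contraTneq vz => ->; rewrite -leNgt cmodBC.
rewrite inE negb_or => /andP[zw zs]; apply: derivable_mul; last exact: dden.
exact: (derivable_slope ek zw (df zs)).
Qed.

(* The maximum modulus principle applied to [f / moebius w], whose modulus is at most
   [1 / |moebius w|] on the circles approaching the unit circle. *)
Lemma schwarz_quotient (s : seq C) (g : C -> C) w : cmod w < 1 ->
  holomorphic_off s g -> (forall z, cmod z < 1 -> cmod (g z * moebius w z) <= 1) ->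
  forall z, cmod z < 1 -> z \notin s -> cmod (g z) <= 1.
Proof.
move=> w1 hg gM z z1 zs; apply/ler_addgt0Pr => e e0.
have w0 := cmod_ge0 w.
(* On the circle of radius [1 - d] the defect [1 - cmod (moebius w v) ^+ 2] is at most [d * kappa]:
   the [2] comes from [1 - cmod v ^+ 2 <= 2 * d], the denominator from [moebius_den_ge]. *)
pose kappa := 2 * (1 - cmod w ^+ 2) / (1 - cmod w) ^+ 2.
have kappa0 : 0 < kappa.
  by rewrite divr_gt0 ?exprn_gt0 ?subr_gt0// mulr_gt0// subr_gt0 expr_lt1.
pose d := Num.min (1 - cmod z) (e / (1 + e) / kappa) / 2.
have e10 : 0 < e / (1 + e) by rewrite divr_gt0// addr_gt0.
have d0 : 0 < d by rewrite divr_gt0// lt_min subr_gt0 z1 divr_gt0.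
have dz : d < 1 - cmod z.
  by rewrite ltr_pdivrMr// gt_min ltr_pMr ?subr_gt0// ltr1n.
have dk : d * kappa <= e / (1 + e).
  rewrite -ler_pdivlMr// /d ler_pdivrMr// ge_min; apply/orP; right.
  by rewrite ler_peMr ?ler1n// ltW// divr_gt0.
have z0 := cmod_ge0 z; clearbody d.
apply: (@maximum_modulus_off _ s g (1 - d)) => //; [|move=> v vr|].
- by apply/andP; split; lra.
- have v1 : cmod v < 1 by lra.
  have mv : 1 / (1 + e) <= cmod (moebius w v).
    apply: (@le_trans _ _ (cmod (moebius w v) ^+ 2)); last first.
      by rewrite expr2 ler_piMr ?cmod_ge0// cmod_moebius_le1// ltW.
    rewrite cmod_moebius_sqr ?(ltW v1)//.
    have -> : 1 / (1 + e) = 1 - e / (1 + e) by field; rewrite gt_eqF// addr_gt0.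
    rewrite lerB// (le_trans _ dk)// /kappa.
    have A0 : 0 < (1 - cmod w) ^+ 2 by rewrite exprn_gt0// subr_gt0.
    have AB : (1 - cmod w) ^+ 2 <= cmod (1 - w^* * v) ^+ 2.
      by rewrite ler_sqr ?nnegrE ?cmod_ge0 ?subr_ge0 ?(ltW w1)// moebius_den_ge// ltW.
    have c0 : 0 <= 1 - cmod w ^+ 2 by rewrite subr_ge0 expr_le1// ltW.
    have v2 : 0 <= 1 - cmod v ^+ 2 by rewrite subr_ge0 expr_le1 ?cmod_ge0// ltW.
    have B0 := lt_le_trans A0 AB.
    set A := (1 - cmod w) ^+ 2 in A0 AB *; set B := cmod (1 - _) ^+ 2 in AB B0 *.
    have v3 : 1 - cmod v ^+ 2 <= 2 * d.
      by rewrite vr; have := sqr_ge0 d; rewrite expr2; lra.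
    set X := 1 - cmod w ^+ 2 in c0 *; set Y := 1 - cmod v ^+ 2 in v2 v3 *.
    rewrite ler_pdivrMr//; apply: (@le_trans _ _ (X * (2 * d))); first exact: ler_wpM2l.
    have -> : d * (2 * X / A) * B = X * (2 * d) * (B / A) by field; rewrite gt_eqF.
    rewrite ler_peMr//; first by rewrite !mulr_ge0// ltW.
    by rewrite ler_pdivlMr// mul1r.
  have mv0 : 0 < cmod (moebius w v) by apply: lt_le_trans mv; rewrite divr_gt0// addr_gt0.
  have := gM v v1; rewrite cmodM -ler_pdivlMr// => /le_trans; apply.
  by rewrite mul1r invf_ple ?posrE ?addr_gt0// -div1r.
- by lra.
Qed.

Lemma schwarz_at (s : seq C) (f : C -> C) w : cmod w < 1 -> w \notin s ->
  holomorphic_off s f -> (forall z, cmod z < 1 -> cmod (f z) <= 1) -> f w = 0 ->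
  forall z, cmod z < 1 -> z \notin s -> cmod (f z) <= cmod (moebius w z).
Proof.
move=> w1 ws hf fM fw z z1 zs; have [g [hg fg]] := quotient_moebius w1 ws hf fw.
have [->|zw] := eqVneq z w; first by rewrite fw moebius_self.
rewrite fg// cmodM ler_piMl ?cmod_ge0//.
apply: (@schwarz_quotient (w :: s) g w) => //; last by rewrite inE negb_or zw.
by move=> v v1; rewrite -fg// fM.
Qed.

Lemma schwarz_pick (phi : C -> C) :
  (forall z, cmod z < 1 -> derivable phi z 1) ->
  (forall z, cmod z < 1 -> cmod (phi z) < 1) ->
  forall w z, cmod w < 1 -> cmod z < 1 ->
    cmod (moebius (phi w) (phi z)) <= cmod (moebius w z).
Proof.
move=> dphi phi1 w z w1 z1.
apply: (@schwarz_at [::] (fun z => moebius (phi w) (phi z))) => //.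
- apply: derivable_off => v v1; apply: derivable_comp; first exact: dphi.
  by apply: derivable_moebius; [exact: phi1|exact/ltW/phi1].
- by move=> v v1; rewrite ltW// cmod_moebius_lt1 ?phi1.
- exact: moebius_self.
Qed.

(** For every [e > 0] the function [h / (h - 2 * e)] maps into the closed disc and vanishes at [w].
    Schwarz's lemma gives [cmod (h z) <= rho * (cmod (h z) + 2 * e)] with [rho < 1], and [e] tends
    to [0]. *)
Lemma strong_maximum (s : seq C) (h : C -> C) w : cmod w < 1 -> w \notin s ->
  holomorphic_off s h -> (forall z, cmod z < 1 -> complex.Re (h z) <= 0) -> h w = 0 ->
  forall z, cmod z < 1 -> z \notin s -> h z = 0.
Proof.
move=> w1 ws hh hRe hw z z1 zs.
have den e v : 0 < e -> cmod v < 1 -> h v - (2 * e)%:C != 0 /\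
    cmod (h v) <= cmod (h v - (2 * e)%:C).
  move=> e0 /hRe; case: (h v) => a b /= a0; split.
    by apply/eqP => /(congr1 (@complex.Re R)) /=; lra.
  rewrite -ler_sqr ?nnegrE ?cmod_ge0// !cmod_sqr /= subr0 lerD2r.
  have : 0 <= e * - a by rewrite mulr_ge0 ?oppr_ge0// ltW.
  have := sqr_ge0 e; nra.
have rho1 := cmod_moebius_lt1 w1 z1; set rho := cmod (moebius w z) in rho1.
have rho0 : 0 <= rho := cmod_ge0 _.
have key e : 0 < e -> cmod (h z) * (1 - rho) <= 2 * e.
  move=> e0; have : cmod (h z / (h z - (2 * e)%:C)) <= rho.
    apply: (schwarz_at (f := fun z => h z / (h z - (2 * e)%:C)) w1 ws _ _ _ z1 zs).
    - move=> v v1; have [dv _] := den e v e0 v1; have [ch dh] := hh v v1; split.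
        apply: continuous_mul; first exact: ch.
        apply: (@continuousV _ _ (fun v => h v - (2 * e)%:C)); first exact: dv.
        exact: continuous_sub_cst.
      move=> vs; apply: derivable_mul; first exact: dh.
      apply: derivable_inv; first exact: dv.
      by apply: derivable_sub_cst; exact: dh.
    - move=> v v1; have [dv le] := den e v e0 v1.
      by rewrite cmodM cmodV ler_pdivrMr ?cmod_gt0// mul1r.
    - by rewrite hw mul0r.
  have [dz _] := den e z e0 z1.
  rewrite cmodM cmodV ler_pdivrMr ?cmod_gt0// => h1.
  have := cmodB (h z) (2 * e)%:C; rewrite cmod_real gtr0_norm ?mulr_gt0// => h2.
  have : rho * cmod (h z - (2 * e)%:C) <= rho * (cmod (h z) + 2 * e) by rewrite ler_wpM2l.
  have : rho * (2 * e) <= 2 * e by rewrite ler_piMl ?ltW// mulr_gt0.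
  have -> : cmod (h z) * (1 - rho) = cmod (h z) - rho * cmod (h z) by ring.
  rewrite mulrDr; lra.
apply/eqP; rewrite -cmod_eq0 eq_le cmod_ge0 andbT -(pmulr_lle0 _ (_ : 0 < 1 - rho)) ?subr_gt0//.
apply/ler_addgt0Pr => e e0; rewrite add0r (le_trans (key (e / 2) _))//.
  by rewrite divr_gt0.
by rewrite mulrC divfK.
Qed.

(** The quotient [g] of [moebius a (phi z)] by [moebius a z] is bounded by [1] and has modulus [1]
    at [w]; the strong maximum principle for [(g w)^* * g - 1] makes it constant. *)
Lemma schwarz_rigidity (phi : C -> C) a w :
  (forall z, cmod z < 1 -> derivable phi z 1) ->
  (forall z, cmod z < 1 -> cmod (phi z) < 1) ->
  cmod a < 1 -> phi a = a -> cmod w < 1 -> w != a ->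
  cmod (moebius a (phi w)) = cmod (moebius a w) ->
  exists2 al, cmod al = 1 & forall z, cmod z < 1 -> moebius a (phi z) = al * moebius a z.
Proof.
move=> dphi phi1 a1 pa w1 wa e.
pose f z := moebius a (phi z).
have df z : cmod z < 1 -> derivable f z 1.
  move=> z1; apply: derivable_comp; first exact: dphi.
  by apply: derivable_moebius; [exact: a1|exact/ltW/phi1].
have fa : f a = 0 by rewrite /f pa moebius_self.
have ane : a \notin ([::] : seq C) by [].
have [g [hg fg]] := quotient_moebius a1 ane (derivable_off df) fa.
have gM z : cmod z < 1 -> z != a -> cmod (g z) <= 1.
  move=> z1 za; have m0 : 0 < cmod (moebius a z) by rewrite cmod_gt0 moebius_eq0// ltW.
  rewrite -(ler_pM2r m0) mul1r -cmodM -fg// /f -{1}pa.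
  exact: schwarz_pick.
(* At [a] the quotient formula says nothing about [g]; the bound comes by continuity from the points
   [a + t]. *)
have ga : cmod (g a) <= 1.
  have [/continuous_cmodP cg _] := hg a a1.
  apply/ler_addgt0Pr => u u0; have [d d0 hd] := cg u u0.
  pose t := Num.min d (1 - cmod a) / 2.
  have t0 : 0 < t by rewrite divr_gt0// lt_min d0 subr_gt0.
  have td : t < d by rewrite ltr_pdivrMr// gt_min ltr_pMr// ltr1n.
  have t1 : t < 1 - cmod a.
    by rewrite ltr_pdivrMr// gt_min; apply/orP; right; rewrite ltr_pMr ?ltr1n// subr_gt0.
  have ct : cmod (t%:C : C) = t by rewrite cmod_real gtr0_norm.
  have h1 : cmod (g (a + t%:C)) <= 1.
    apply: gM; first by rewrite (le_lt_trans (cmodD _ _))// ct -ltrBrDl.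
    by rewrite addrC -subr_eq0 addrK -cmod_gt0 ct.
  have h2 : cmod (g (a + t%:C) - g a) < u by apply: hd; rewrite addrC addKr ct.
  have := cmod_dist (g a) (g (a + t%:C)); rewrite cmodBC; lra.
have m0 : moebius a w != 0 by rewrite moebius_eq0// ltW.
have gw : cmod (g w) = 1.
  apply: (mulIf (_ : cmod (moebius a w) != 0)); first by rewrite cmod_eq0.
  by rewrite -cmodM -fg// mul1r.
exists (g w); first exact: gw.
have gg : (g w)^* * g w = 1.
  have := cmod_sqr (g w); rewrite gw expr1n; case: (g w) => x y /= h.
  by apply/eqP; rewrite eq_complex /=; apply/andP; split; apply/eqP; [rewrite h; ring|ring].
have h0 z : cmod z < 1 -> z \notin [:: a] -> (g w)^* * g z - 1 = 0.
  have wa' : w \notin [:: a] by rewrite inE.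
  apply: (strong_maximum (h := fun z => (g w)^* * g z - 1) w1 wa').
  - move=> v v1; have [cg dg] := hg v v1; split.
      apply: continuous_sub_cst.
      by apply: continuous_mul; [exact: cst_continuous|exact: cg].
    move=> va; apply: derivable_sub_cst.
    by apply: derivable_mul; [exact: derivable_cst|exact: dg].
  - move=> v v1; rewrite raddfB /= subr_le0 (le_trans (Re_le_cmod _))//.
    rewrite cmodM cmod_conj gw mul1r.
    by have [->//|va] := eqVneq v a; exact: gM.
  - by rewrite gg subrr.
move=> z z1; have [->|za] := eqVneq z a; first by rewrite pa moebius_self mulr0.
have := h0 z z1; rewrite inE => /(_ za)/eqP; rewrite subr_eq0 => /eqP gz.
rewrite -/(f z) fg//; congr (_ * _).
by rewrite -[LHS]mul1r -gg mulrAC mulrC gz mulr1.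
Qed.

End SchwarzPick.

(** * Elliptic automorphisms *)

Section Automorphisms.
Variable R : realType.
Local Notation C := R[i].

Lemma moebiusK (a z : C) : cmod a < 1 -> cmod z <= 1 -> moebius (- a) (moebius a z) = z.
Proof.
move=> a1 z1; have d0 := moebius_den_neq0 a1 z1.
have aa : 1 - a * a^* != 0.
  have -> : 1 - a * a^* = (1 - cmod a ^+ 2)%:C.
    rewrite cmod_sqr; case: a {a1 d0} => x y; apply/eqP; rewrite eq_complex /=.
    by apply/andP; split; apply/eqP; ring.
  by rewrite -cmod_eq0 cmod_real normr_eq0 gt_eqF// subr_gt0 expr_lt1// cmod_ge0.
have e : 1 - a^* * z + a^* * (z - a) = 1 - a * a^* by ring.
rewrite /moebius rmorphN /= mulNr !opprK.
have -> : (z - a) / (1 - a^* * z) + a = ((z - a) + a * (1 - a^* * z)) / (1 - a^* * z).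
  by field.
have -> : 1 + a^* * ((z - a) / (1 - a^* * z)) =
    ((1 - a^* * z) + a^* * (z - a)) / (1 - a^* * z) by field.
rewrite invf_div mulrA divfK// e.
by apply: (mulIf aa); rewrite divfK//; ring.
Qed.

Lemma moebiusKN (a z : C) : cmod a < 1 -> cmod z <= 1 -> moebius a (moebius (- a) z) = z.
Proof. by move=> a1 z1; rewrite -{1}[a]opprK moebiusK// cmodN. Qed.

Lemma moebius_inj (a z w : C) : cmod a < 1 -> cmod z <= 1 -> cmod w <= 1 ->
  moebius a z = moebius a w -> z = w.
Proof. by move=> a1 z1 w1 e; rewrite -(moebiusK a1 z1) e moebiusK. Qed.

Lemma moebius0 (a : C) : moebius a 0 = - a.
Proof. by rewrite /moebius mulr0 subr0 divr1 sub0r. Qed.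

Lemma moebius_automorphism (a : C) : cmod a < 1 -> disc_automorphism (moebius a).
Proof.
move=> a1; split; first by move=> z; rewrite unit_discE => /ltW; exact: derivable_moebius.
split.
- by move=> z /=; rewrite !unit_discE => z1; exact: cmod_moebius_lt1.
- by move=> z w /set_mem; rewrite unit_discE => /ltW z1 /set_mem; rewrite unit_discE => /ltW w1; exact: moebius_inj.
- move=> z /=; rewrite unit_discE => z1; exists (moebius (- a) z).
    by rewrite unit_discE cmod_moebius_lt1// cmodN.
  by rewrite moebiusKN// ltW.
Qed.

Lemma pinv_moebius (a z : C) : cmod a < 1 -> cmod z < 1 ->
  'pinv_(fun=> 0) (@unit_disc R) (moebius a) z = moebius (- a) z.
Proof.
move=> a1 z1; have [_ [_ inj _]] := moebius_automorphism a1.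
rewrite -{1}(moebiusKN a1 (ltW z1)) pinvKV//.
by apply/mem_set; rewrite unit_discE cmod_moebius_lt1 ?cmodN.
Qed.

(* The conjugating map is the inverse of the Moebius map sending the fixed point to [0]. *)
Lemma conjugate_to_rotation_moebius (phi : C -> C) (a al : C) :
  (forall z, cmod z < 1 -> derivable phi z 1) ->
  (forall z, cmod z < 1 -> cmod (phi z) < 1) ->
  cmod a < 1 -> cmod al = 1 ->
  (forall z, cmod z < 1 -> moebius a (phi z) = al * moebius a z) ->
  conjugate_to_rotation phi al.
Proof.
move=> dphi phi1 a1 al1 e; have a1' : cmod (- a) < 1 by rewrite cmodN.
have al0 : al != 0 by rewrite -cmod_eq0 al1 oner_eq0.
have phiE z : cmod z < 1 -> phi z = moebius (- a) (al * moebius a z).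
  by move=> z1; rewrite -e// moebiusK// ltW// phi1.
split; last first.
  exists (moebius (- a)); split; first exact: moebius_automorphism.
  by move=> z; rewrite unit_discE => z1; rewrite pinv_moebius// opprK phiE.
split; first by move=> z; rewrite unit_discE; exact: dphi.
split.
- by move=> z /=; rewrite !unit_discE; exact: phi1.
- move=> z w /set_mem; rewrite unit_discE => z1 /set_mem; rewrite unit_discE => w1 zw.
  apply: (moebius_inj a1 (ltW z1) (ltW w1)); apply: (mulfI al0).
  by rewrite -!e// zw.
- move=> z /=; rewrite unit_discE => z1.
  have m1 : cmod (al^-1 * moebius a z) < 1.
    by rewrite cmodM cmodV al1 invr1 mul1r cmod_moebius_lt1.
  have m2 : cmod (moebius (- a) (al^-1 * moebius a z)) < 1 by exact: cmod_moebius_lt1.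
  exists (moebius (- a) (al^-1 * moebius a z)); first by rewrite unit_discE.
  by rewrite phiE// moebiusKN// ?ltW// mulrA divff// mul1r moebiusK// ltW.
Qed.

(** Two powers close to a common cluster point are close to each other, and dividing by the smaller
    one keeps the distance. *)
Lemma unit_power_recurrent (la : C) : cmod la = 1 -> forall e : R, 0 < e ->
  exists2 n, (0 < n)%N & cmod (la ^+ n - 1) < e.
Proof.
move=> la1 e e0; have cl n : cball 1 (la ^+ n) by rewrite /cball /= cmodX la1 expr1n.
have [z _ hz] := compact_cluster_cmod (@cball_compact R 1 ltr01) cl.
have [n _ hn] := hz (e / 2) ltac:(by rewrite divr_gt0) 0%N.
have [m nm hm] := hz (e / 2) ltac:(by rewrite divr_gt0) n.+1.
exists (m - n)%N; first by rewrite subn_gt0.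
rewrite -[cmod _]mul1r -(expr1n _ n) -la1 -cmodX -cmodM mulrBr mulr1 -exprD.
rewrite subnKC 1?ltnW// (le_lt_trans (cmod_distD z _ _))// [e]splitr ltrD//.
by rewrite cmodBC.
Qed.

(** The conjugacy [psi] comes without differentiability of its inverse. Recurrence of the rotation
    takes its place: the distance to the fixed point [psi 0] cannot decrease, so the equality case
    of Schwarz-Pick applies and produces [al]. *)
Lemma elliptic_moebius (phi : C -> C) : elliptic_automorphism phi ->
  exists a al, [/\ cmod a < 1, cmod al = 1, phi a = a &
    forall z, cmod z < 1 -> moebius a (phi z) = al * moebius a z].
Proof.
move=> [la /unit_circleE la1 [[hphi [sphi _ _]] [psi [[hpsi [spsi ipsi ssi]] e]]]].
have dphi z : cmod z < 1 -> derivable phi z 1 by rewrite -unit_discE; exact: hphi.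
have phi1 z : cmod z < 1 -> cmod (phi z) < 1 by rewrite -!unit_discE; exact: sphi.
have psiKV u : cmod u < 1 -> 'pinv_(fun=> 0) (@unit_disc R) psi (psi u) = u.
  by move=> u1; apply: pinvKV => //; apply/mem_set; rewrite unit_discE.
have psi1 u : cmod u < 1 -> cmod (psi u) < 1 by rewrite -!unit_discE; exact: spsi.
have phipsi u : cmod u < 1 -> phi (psi u) = psi (la * u).
  by move=> u1; rewrite e ?unit_discE ?psi1// psiKV.
have iterpsi u n : cmod u < 1 -> iter n phi (psi u) = psi (la ^+ n * u).
  move=> u1; elim: n => [|n IH]; first by rewrite mul1r.
  by rewrite iterS IH phipsi ?exprS ?mulrA// cmodM cmodX la1 expr1n mul1r.
pose a := psi 0; have z1 : cmod (0 : C) < 1 by rewrite cmod0.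
have a1 : cmod a < 1 := psi1 _ z1.
have pa : phi a = a by rewrite phipsi// mulr0.
have [w w1 wa] : exists2 w : C, cmod w < 1 & w != a.
  have [a0|a0] := eqVneq a 0; last by exists 0; rewrite // eq_sym.
  exists (2^-1)%:C; first by rewrite cmod_real gtr0_norm ?invr_gt0// invf_lt1// ltr1n.
  by rewrite a0 -cmod_eq0 cmod_real gtr0_norm ?invr_gt0// invr_eq0 pnatr_eq0.
have [u /= u1 wu] : exists2 u, cmod u < 1 & psi u = w.
  have [|u] := ssi w; first by rewrite unit_discE.
  by rewrite unit_discE; exists u.
have decr v : cmod v < 1 -> cmod (moebius a (phi v)) <= cmod (moebius a v).
  by move=> v1; rewrite -{1}pa; exact: schwarz_pick.
have iter1 n v : cmod v < 1 -> cmod (iter n phi v) < 1.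
  by move=> v1; elim: n => // n IH; rewrite iterS phi1.
have decrn n : cmod (moebius a (iter n.+1 phi w)) <= cmod (moebius a (phi w)).
  elim: n => // n IH; rewrite iterS (le_trans (decr _ _))//; exact: iter1.
(* When [la ^+ n] is close to [1], the [n]-th iterate brings [w] back near itself; as distances to
   [a] never increase, nothing can be lost at the first step. *)
have eqw : cmod (moebius a (phi w)) = cmod (moebius a w).
  apply/le_anti; rewrite decr//=; apply/ler_addgt0Pr => r r0.
  have /derivable_continuous/continuous_cmodP/(_ r r0)[d d0 hd] :
    derivable (moebius a) w 1 by exact: derivable_moebius (ltW w1).
  have /derivable_continuous/continuous_cmodP/(_ d d0)[d' d'0 hd'] :
    derivable psi u 1 by apply: hpsi; rewrite unit_discE.
  have [n n0 hn] := unit_power_recurrent la1 d'0.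
  have : cmod (psi (la ^+ n * u) - psi u) < d.
    apply: hd'; rewrite -{2}[u]mul1r -mulrBl cmodM (le_lt_trans _ hn)//.
    by rewrite ler_piMr ?cmod_ge0// ltW.
  rewrite wu -iterpsi// wu => /hd hm.
  have := cmod_dist (moebius a w) (moebius a (iter n phi w)); rewrite cmodBC.
  by case: n n0 hn hm => // n _ _ hm; have := decrn n; lra.
have [al al1 hal] := schwarz_rigidity dphi phi1 a1 pa w1 wa eqw.
by exists a, al.
Qed.

End Automorphisms.

(** * The Denjoy-Wolff theorem *)

Section Iteration.
Variable R : realType.
Local Notation C := R[i].

Lemma uniform_cvg_cmodP (K : set C) (F : nat -> C -> C) (z0 : C) :
  {uniform K, F @ \oo --> (fun=> z0)} <->
  forall e : R, 0 < e -> exists N, forall n, (N <= n)%N -> forall w, K w ->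
    cmod (F n w - z0) < e.
Proof.
split=> [cF e e0|h].
  have : nbhs ((fun=> z0) : {uniform` K -> C})
      [set g | forall w, K w -> cmod (g w - z0) < e].
    apply/uniform_nbhs; exists [set p : C * C | ball p.1 e%:C p.2]; split.
      by apply: entourage_ball (PosNum _); rewrite ltcR.
    move=> g hg w /hg; rewrite -ball_normE /= distrC normC_cmod ltcR.
    exact.
  by move=> /cF[N _ hN]; exists N => n Nn; exact: hN.
move=> P /uniform_nbhs[E []]; rewrite -entourage_ballE => -[e /= /gt0C[r r0 ->] hE] hP.
have [N hN] := h r r0; exists N => // n Nn; apply: hP => w Kw; apply: hE => /=.
by rewrite -ball_normE /= distrC normC_cmod ltcR; exact: hN.
Qed.

Variable phi : C -> C.
Hypothesis dphi : forall z, cmod z < 1 -> derivable phi z 1.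
Hypothesis phi1 : forall z, cmod z < 1 -> cmod (phi z) < 1.

Lemma iter_unit_disc n z : cmod z < 1 -> cmod (iter n phi z) < 1.
Proof. by move=> z1; elim: n => // n IH; rewrite iterS phi1. Qed.

Lemma schwarz_pick_iter n w z : cmod w < 1 -> cmod z < 1 ->
  cmod (moebius (iter n phi w) (iter n phi z)) <= cmod (moebius w z).
Proof.
move=> w1 z1; elim: n => // n IH; rewrite !iterS (le_trans _ IH)//.
by apply: schwarz_pick => //; exact: iter_unit_disc.
Qed.

Lemma cmod_sub_le_moebius (a z : C) : cmod a < 1 -> cmod z < 1 ->
  cmod (z - a) <= 2 * cmod (moebius a z).
Proof.
move=> a1 z1; have d0 := moebius_den_neq0 a1 (ltW z1).
have -> : z - a = (1 - a^* * z) * moebius a z by rewrite /moebius mulrC divfK.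
rewrite cmodM ler_wpM2r ?cmod_ge0// (le_trans (cmodB _ _))// cmod1 lerD2l.
by rewrite cmodM cmod_conj mulr_ile1 ?cmod_ge0// ltW.
Qed.

Lemma moebius_le_cmod_sub (a z : C) : cmod a < 1 -> cmod z < 1 ->
  cmod (moebius a z) <= cmod (z - a) / (1 - cmod a).
Proof.
move=> a1 z1; rewrite /moebius cmodM cmodV ler_wpM2l ?cmod_ge0// lef_pV2 ?posrE.
- by rewrite moebius_den_ge// ltW.
- by rewrite cmod_gt0 moebius_den_neq0// ltW.
- by rewrite subr_gt0.
Qed.

(* The iterates are equicontinuous by the Schwarz-Pick lemma. *)
Lemma iter_cvg_uniform z0 :
  (forall z, cmod z < 1 -> forall e : R, 0 < e -> exists N, forall n, (N <= n)%N ->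
    cmod (iter n phi z - z0) < e) ->
  forall K : set C, compact K -> K `<=` @unit_disc R ->
    {uniform K, (fun n => iter n phi) @ \oo --> (fun=> z0)}.
Proof.
move=> h K cK Kd; apply/uniform_cvg_cmodP => e e0.
have e4 : 0 < e / 4 by rewrite divr_gt0.
(* Within this radius the pseudo-hyperbolic distance is at most [e / 4]; iteration does not increase
   it, and passing back to the Euclidean distance doubles it. *)
pose delta (z : C) : R := e / 4 * (1 - cmod z).
have [|s sK cov] := @compact_cover_cmod _ K delta cK.
  by move=> z /Kd; rewrite unit_discE => z1; rewrite mulr_gt0// subr_gt0.
have [N hN] : exists N, forall z, z \in s -> forall n, (N <= n)%N ->
    cmod (iter n phi z - z0) < e / 2.
  elim: s sK {cov} => [|a s IH] sK; first by exists 0%N.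
  have [|N hN] := IH; first by move=> z zs; apply: sK; rewrite inE zs orbT.
  have /Kd := sK a (mem_head _ _); rewrite unit_discE => a1.
  have [M hM] := h a a1 (e / 2) ltac:(by rewrite divr_gt0).
  exists (maxn N M) => z; rewrite inE => zs n; rewrite geq_max => /andP[Nn Mn].
  by case/orP: zs => [/eqP->|zs]; [exact: hM|exact: hN].
exists N => n Nn w Kw; have [z zs wz] := cov w Kw.
have /Kd := sK z zs; rewrite unit_discE => z1.
have := Kd w Kw; rewrite unit_discE => w1.
rewrite (le_lt_trans (cmod_distD (iter n phi z) _ _))// [e]splitr ler_ltD ?hN//.
rewrite (le_trans (cmod_sub_le_moebius _ _)) ?iter_unit_disc//.
rewrite -ler_pdivlMl// (le_trans (schwarz_pick_iter _ _ _))//.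
rewrite (le_trans (moebius_le_cmod_sub _ _))// ler_pdivrMr ?subr_gt0//.
by rewrite (le_trans (ltW wz))// /delta le_eqVlt; apply/orP; left; apply/eqP; field.
Qed.

Definition cluster_orbit (z w : C) := forall e : R, 0 < e -> forall N,
  exists2 n, (N <= n)%N & cmod (iter n phi z - w) < e.

(** If the orbit is near [w] at time [n], it is near [phi w] at time [n.+1] and near [w] again
    later; since [u] decreases along it, [u w] is at most [u (phi w)] in the limit. *)
Lemma cluster_orbit_le (z w : C) (u : C -> R) : cmod z < 1 -> cmod w < 1 ->
  cluster_orbit z w ->
  (forall x, cmod x < 1 -> u (phi x) <= u x) ->
  (forall x, cmod x < 1 -> forall e : R, 0 < e -> exists2 d : R, 0 < d &
    forall y, cmod (y - x) < d -> `|u y - u x| < e) ->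
  u w <= u (phi w).
Proof.
move=> z1 w1 cl mono cu.
have decr m n : (m <= n)%N -> u (iter n phi z) <= u (iter m phi z).
  move=> /subnK <-; elim: (n - m)%N => // k IH; rewrite addSn iterS.
  by rewrite (le_trans (mono _ _))//; exact: iter_unit_disc.
apply/ler_addgt0Pr => e e0.
have [d d0 hd] := cu _ (phi1 w1) (e / 2) ltac:(by rewrite divr_gt0).
have [d2 d20 hd2] := cu _ w1 (e / 2) ltac:(by rewrite divr_gt0).
have /derivable_continuous/continuous_cmodP/(_ d d0)[d1 d10 hd1] := dphi w1.
have [n _ hn] := cl d1 d10 0%N; have [m nm hm] := cl d2 d20 n.+1.
have := hd _ (hd1 _ hn); have := hd2 _ hm; have := decr _ _ nm.
rewrite iterS !ltr_norml => h1 /andP[h2 _] /andP[_ h3]; lra.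
Qed.

(** The distance to [a] decreases along the orbit, which keeps a cluster point off the circle. There
    the distance is preserved, so rigidity leaves only [a], and monotonicity turns clustering into
    convergence. *)
Lemma interior_fixed_point_cvg (a : C) : cmod a < 1 -> phi a = a ->
  ~ elliptic_automorphism phi ->
  forall z, cmod z < 1 -> forall e : R, 0 < e -> exists N, forall n, (N <= n)%N ->
    cmod (iter n phi z - a) < e.
Proof.
move=> a1 pa nell z z1 e e0.
pose u (x : C) : R := cmod (moebius a x).
have mono x : cmod x < 1 -> u (phi x) <= u x.
  by move=> x1; rewrite /u -{1}pa; exact: schwarz_pick.
have decr m n : (m <= n)%N -> u (iter n phi z) <= u (iter m phi z).
  move=> /subnK <-; elim: (n - m)%N => // k IH; rewrite addSn iterS.
  by rewrite (le_trans (mono _ _))//; exact: iter_unit_disc.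
have cu x : cmod x <= 1 -> forall e : R, 0 < e -> exists2 d : R, 0 < d &
    forall y, cmod (y - x) < d -> `|u y - u x| < e.
  move=> x1 g g0.
  have /derivable_continuous/continuous_cmodP/(_ g g0)[d d0 hd] := derivable_moebius a1 x1.
  exists d => // y /hd; apply: le_lt_trans; rewrite ler_norml lerNl opprB /u.
  by rewrite cmod_dist cmodBC cmod_dist.
have orb1 n : cball 1 (iter n phi z) by apply/ltW/iter_unit_disc.
have [w w1 cl] := compact_cluster_cmod (cball_compact ltr01) orb1.
have uw : u w <= u z.
  apply/ler_addgt0Pr => g g0; have [d d0 hd] := cu w w1 g g0.
  have [n _ /hd] := cl d d0 0%N; rewrite ltr_norml => /andP[h1 _].
  have := decr 0%N n (leq0n n); rewrite /=; lra.
have w1' : cmod w < 1.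
  rewrite lt_neqAle; move: w1; rewrite /cball /= => w1; rewrite w1 andbT.
  apply/eqP => we; have := le_lt_trans uw (cmod_moebius_lt1 a1 z1).
  rewrite -ltr_sqr ?nnegrE ?cmod_ge0// cmod_moebius_sqr// we.
  by rewrite expr1n subrr mulr0 mul0r subr0 ltxx.
have wa : w = a.
  apply: contrapT => /eqP wa; apply: nell.
  have ew : cmod (moebius a (phi w)) = cmod (moebius a w).
    apply/le_anti/andP; split; first exact: mono.
    apply: (@cluster_orbit_le z w u) => // x x1; exact/cu/ltW.
  have [al al1 hal] := schwarz_rigidity dphi phi1 a1 pa w1' wa ew.
  exists al; first exact/unit_circleE.
  exact: conjugate_to_rotation_moebius hal.
have [d d0 hd] := cu w w1 (e / 2) ltac:(by rewrite divr_gt0).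
have [N _ /hd] := cl d d0 0%N; rewrite wa {2}/u moebius_self cmod0 subr0 => uN.
exists N => n Nn.
rewrite (le_lt_trans (cmod_sub_le_moebius a1 (iter_unit_disc n z1)))//.
rewrite -ltr_pdivlMl// mulrC (le_lt_trans (decr _ _ Nn))//.
exact: le_lt_trans (ler_norm _) uN.
Qed.

Lemma scaled_contraction (x y : C) (r : R) : 0 < r < 1 -> cmod x < 1 -> cmod y < 1 ->
  x != y -> cmod (moebius (r%:C * x) (r%:C * y)) < cmod (moebius x y).
Proof.
move=> /andP[r0 r1] x1 y1 xy.
have rx : cmod (r%:C * x) < 1.
  by rewrite cmodM cmod_real gtr0_norm// mulr_ilt1 ?cmod_ge0// ltW.
have ry : cmod (r%:C * y) < 1.
  by rewrite cmodM cmod_real gtr0_norm// mulr_ilt1 ?cmod_ge0// ltW.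
have d1 := moebius_den_neq0 x1 (ltW y1); have d2 := moebius_den_neq0 rx (ltW ry).
have yx : 0 < cmod (y - x) by rewrite cmod_gt0 subr_eq0 eq_sym.
have D1 : 0 < cmod (1 - x^* * y) by rewrite cmod_gt0.
have D2 : 0 < cmod (1 - (r%:C * x)^* * (r%:C * y)) by rewrite cmod_gt0.
have D12 : r * cmod (1 - x^* * y) < cmod (1 - (r%:C * x)^* * (r%:C * y)).
  rewrite -ltr_sqr ?nnegrE ?mulr_ge0 ?cmod_ge0 ?(ltW r0)// exprMn.
  have c1 : cmod (x^* * y) < 1 by rewrite cmodM cmod_conj mulr_ilt1 ?cmod_ge0.
  have -> : (r%:C * x)^* * (r%:C * y) = (r ^+ 2)%:C * (x^* * y).
    by rewrite realcX; case: x {xy x1 rx d1 d2 yx D1 D2 c1} => p q; case: y {y1 ry} => s t;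
      apply/eqP; rewrite eq_complex /=; apply/andP; split; apply/eqP; ring.
  rewrite -subr_gt0.
  have -> : cmod (1 - (r ^+ 2)%:C * (x^* * y)) ^+ 2 - r ^+ 2 * cmod (1 - x^* * y) ^+ 2 =
      (1 - r ^+ 2) * (1 - r ^+ 2 * cmod (x^* * y) ^+ 2).
    by rewrite !cmod_sqr; case: (x^* * y) => p q /=; ring.
  have r2 : r ^+ 2 < 1 by rewrite expr_lt1// ltW.
  by rewrite mulr_gt0 ?subr_gt0// mulr_ilt1 ?sqr_ge0// expr_lt1// cmod_ge0.
rewrite /moebius -mulrBr !cmodM !cmodV cmod_real gtr0_norm//.
rewrite ltr_pdivrMr// mulrAC ltr_pdivlMr// -mulrA mulrCA ltr_pM2l//.
Qed.

(** The map [r phi] sends the closed disc of radius [r] into itself. The pseudo-hyperbolic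
    displacement attains its minimum there, and a nonzero minimum would be lowered by one more step,
    by strict contraction. *)
Lemma scaled_fixed_point (r : R) : 0 < r < 1 ->
  exists2 a, cmod a < 1 & r%:C * phi a = a.
Proof.
move=> r01; have [r0 r1] := andP r01.
pose f z := r%:C * phi z.
have fr z : cmod z < 1 -> cmod (f z) < r.
  by move=> z1; rewrite cmodM cmod_real gtr0_norm// gtr_pMr// phi1.
have f1 z : cmod z < 1 -> cmod (f z) < 1 by move=> /fr/lt_trans; apply.
pose q z := (f z - z) * (1 - z^* * f z)^-1.
have cq z : cmod z < 1 -> {for z, continuous q}.
  move=> z1.
  have cf : {for z, continuous f}.
    apply: continuous_mul; first exact: cst_continuous.
    exact/derivable_continuous/dphi.
  have cc : {for z, continuous (fun w : C => w^*)}.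
    apply/continuous_cmodP => e e0; exists e => // w.
    by rewrite -rmorphB /= cmod_conj.
  apply: continuous_mul.
    by apply: (@continuousB _ _ _ f id); [exact: cf|exact: cvg_id].
  apply: (@continuousV _ _ (fun w => 1 - w^* * f w)).
    by rewrite moebius_den_neq0// ltW// f1.
  have /continuous_cmodP cg : {for z, continuous (fun w => w^* * f w)}.
    by apply: continuous_mul; [exact: cc|exact: cf].
  apply/continuous_cmodP => e /cg[d d0 hd]; exists d => // w /hd.
  by rewrite cmodBC; congr (cmod _ < _); ring.
have [|z zr zmin] := @compact_max_cmod R (cball r) (fun z => - cmod (q z)) 0
    (cball_compact r0) ltac:(by rewrite /cball /= cmod0 ltW).
  move=> z zr e e0; have z1 : cmod z < 1 by exact: le_lt_trans r1.
  have /continuous_cmodP/(_ e e0)[d d0 hd] := cq z z1; exists d => // w _ /hd h.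
  by have := cmod_dist (q z) (q w); rewrite cmodBC; lra.
have z1 : cmod z < 1 by exact: le_lt_trans r1.
exists z => //; apply: contrapT => /eqP fz; rewrite -/(f z) in fz.
have fzr : cball r (f z) by rewrite /cball /= ltW// fr.
have := zmin _ fzr; rewrite lerN2 leNgt => /negP; apply.
have qE v : q v = moebius v (f v) by [].
rewrite !qE.
(* Strict contraction requires distinct points; if they coincide, [f z] is already fixed and has
   displacement [0]. *)
have [e|ne] := eqVneq (phi z) (phi (f z)).
  have efz : f (f z) = f z by rewrite {1}/f -e.
  by rewrite efz moebius_self cmod0 cmod_gt0 moebius_eq0// ltW// f1.
rewrite (lt_le_trans (scaled_contraction r01 _ _ ne)) ?phi1 ?f1//.
by apply: schwarz_pick => //; exact: f1.
Qed.

End Iteration.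

(** * Wolff's boundary point and convergence of the iterates *)

Section DenjoyWolff.
Variable R : realType.
Local Notation C := R[i].
Variable phi : C -> C.
Hypothesis dphi : forall z, cmod z < 1 -> derivable phi z 1.
Hypothesis phi1 : forall z, cmod z < 1 -> cmod (phi z) < 1.

Lemma conj_mul_unit (z : C) : cmod z = 1 -> z^* * z = 1.
Proof.
move=> z1; have := cmod_sqr z; rewrite z1 expr1n; case: z {z1} => x y /= h.
by apply/eqP; rewrite eq_complex /=; apply/andP; split; apply/eqP; [rewrite h; ring|ring].
Qed.

Lemma cmod_unit_sub (z0 x : C) : cmod z0 = 1 -> cmod (1 - z0^* * x) = cmod (z0 - x).
Proof.
move=> z01; rewrite -(conj_mul_unit z01) -mulrBr cmodM cmod_conj z01 mul1r//.
Qed.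

(* Wolff's lemma: the horodiscs at [z0] are limits of the pseudo-hyperbolic discs
   centred at the fixed points of the contractions [r phi], [r < 1]. *)
Lemma wolff : (forall a, cmod a < 1 -> phi a <> a) ->
  exists2 z0, cmod z0 = 1 & forall z, cmod z < 1 ->
    (1 - cmod z ^+ 2) * cmod (z0 - phi z) ^+ 2 <=
    (1 - cmod (phi z) ^+ 2) * cmod (z0 - z) ^+ 2.
Proof.
move=> nofix.
pose r n : R := 1 - n.+2%:R^-1.
have r01 n : 0 < r n < 1.
  rewrite /r subr_gt0 invf_lt1 ?ltr0n// ltr1n /=.
  by rewrite ltrBlDr ltrDl invr_gt0 ltr0n.
have /choice[a ha] : forall n, exists a, cmod a < 1 /\ (r n)%:C * phi a = a.
  by move=> n; have [a a1 ea] := scaled_fixed_point dphi phi1 (r01 n); exists a.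
have ca n : cball 1 (a n) by have [/ltW] := ha n.
have [z0 z01 cl] := compact_cluster_cmod (cball_compact ltr01) ca.
have near_z0 e : 0 < e -> exists n, cmod (a n - z0) < e /\ 1 - r n < e.
  move=> e0; have [N hN] : exists N : nat, forall n, (N <= n)%N -> n.+1%:R^-1 < e :> R.
    by have [N _ hN] := near_infty_natSinv_lt (PosNum e0); exists N.
  have [n Nn hn] := cl e e0 N; exists n; split => //.
  by rewrite /r subKr hN// (leq_trans Nn).
(* Inside the disc, continuity would make the limit [z0] of approximate fixed points a fixed point
   of [phi]. *)
have z0_1 : cmod z0 = 1.
  move: z01; rewrite /cball /= le_eqVlt => /orP[/eqP//|z01].
  case: (nofix z0 z01); apply/eqP; rewrite -subr_eq0 -cmod_eq0 eq_le cmod_ge0 andbT.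
  apply/ler_addgt0Pr => e e0; rewrite add0r.
  have /derivable_continuous/continuous_cmodP/(_ (e / 3))[|d d0 hd] := dphi z01.
    by rewrite divr_gt0.
  have [n []] := near_z0 (Num.min d (e / 3)) ltac:(by rewrite lt_min d0 divr_gt0).
  rewrite !lt_min => /andP[/hd h1 h2] /andP[_ h3].
  have [an1 an] := ha n; have [r0 r1] := andP (r01 n).
  have h4 : cmod (phi (a n) - a n) <= 1 - r n.
    rewrite -{2}an -[X in X - _]mul1r -mulrBl -realcB cmodM cmod_real.
    by rewrite ger0_norm ?subr_ge0 ?(ltW r1)// ler_piMr ?subr_ge0 ?(ltW r1)// ltW// phi1.
  have -> : phi z0 - z0 = (phi (a n) - a n) + (a n - z0) - (phi (a n) - phi z0) by ring.
  have := cmodB ((phi (a n) - a n) + (a n - z0)) (phi (a n) - phi z0).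
  have := cmodD (phi (a n) - a n) (a n - z0).
  move: h1 h2 h3 h4; clear; lra.
exists z0 => // z z1.
set x := 1 - cmod z ^+ 2; set y := phi z.
have x0 : 0 < x by rewrite subr_gt0 expr_lt1// cmod_ge0.
have x1 : x <= 1 by rewrite gerBl sqr_ge0.
have y1 : cmod y < 1 := phi1 z1.
rewrite -!(cmod_unit_sub _ z0_1).
have lip (u v : C) d : cmod u <= 2 -> cmod v <= 2 -> cmod (u - v) <= d ->
    cmod u ^+ 2 <= cmod v ^+ 2 + 4 * d.
  move=> u2 v2 uv; have := cmod_dist u v; have := cmod_ge0 u; have := cmod_ge0 v.
  have := cmod_ge0 (u - v); move=> d0 v0 u0 h.
  rewrite -lerBlDl subr_sqr (@le_trans _ _ (cmod (u - v) * (cmod u + cmod v)))//.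
    by rewrite ler_wpM2r ?addr_ge0.
  rewrite mulrC ler_pM ?addr_ge0//; lra.
have bnd (b w : C) : cmod b <= 1 -> cmod w <= 1 -> cmod (1 - b^* * w) <= 2.
  move=> b1 w1; rewrite (le_trans (cmodB _ _))// cmod1 lerD2l.
  by rewrite cmodM cmod_conj mulr_ile1 ?cmod_ge0.
(* Generous constant: the three errors [k1], [k2], [k3] below amount to [8 * e / 100] each. *)
apply/ler_addgt0Pr => e e0; have [n []] := near_z0 (e / 100) ltac:(by rewrite divr_gt0).
have [an1 an] := ha n; have [r0 r1] := andP (r01 n); set s := r n in an r0 r1 *.
set b := a n in an an1 * => hb hs.
pose f w := s%:C * phi w.
have f1 w : cmod w < 1 -> cmod (f w) < 1.
  by move=> w1; rewrite cmodM cmod_real gtr0_norm// mulr_ilt1 ?cmod_ge0 ?(ltW r0)// phi1.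
have df w : cmod w < 1 -> derivable f w 1.
  by move=> w1; apply: derivable_mul; [exact: derivable_cst|exact: dphi].
(* Both sides are [1] minus a multiple of [1 - cmod b ^+ 2]. This factor vanishes in the limit
   [b -> z0], but it cancels first, so the inequality survives. *)
have := schwarz_pick df f1 an1 z1; rewrite {1}/f an -/b.
have fz1 := f1 z z1.
have D1 := moebius_den_neq0 an1 (ltW z1); have D2 := moebius_den_neq0 an1 (ltW fz1).
rewrite -ler_sqr ?nnegrE ?cmod_ge0// !cmod_moebius_sqr ?(ltW z1) ?(ltW fz1)//.
rewrite lerD2l lerN2 -!mulrA ler_pM2l; last by rewrite subr_gt0 expr_lt1// cmod_ge0.
rewrite ler_pdivrMr ?exprn_gt0 ?cmod_gt0// mulrAC ler_pdivlMr ?exprn_gt0 ?cmod_gt0//.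
rewrite -/x.
have fzs : cmod (f z) ^+ 2 = s ^+ 2 * cmod y ^+ 2.
  by rewrite cmodM exprMn cmod_real gtr0_norm.
have h1 : cmod (1 - z0^* * y) ^+ 2 <= cmod (1 - b^* * f z) ^+ 2 + 4 * (e / 50).
  apply: lip; rewrite ?bnd ?z0_1 ?(ltW an1) ?(ltW y1) ?(ltW fz1)//.
  have -> : 1 - z0^* * y - (1 - b^* * f z) = (b - z0)^* * y - (1 - s)%:C * (b^* * y).
    by rewrite rmorphB /= realcB /f -/y; ring.
  rewrite (le_trans (cmodB _ _))// !cmodM !cmod_conj cmod_real ger0_norm ?subr_ge0 ?(ltW r1)//.
  have : cmod (b - z0) * cmod y <= e / 100.
    by rewrite (le_trans _ (ltW hb))// ler_piMr ?cmod_ge0// ltW.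
  have : (1 - s) * (cmod b * cmod y) <= e / 100.
    rewrite (le_trans _ (ltW hs))// ler_piMr ?subr_ge0 ?(ltW r1)//.
    by rewrite mulr_ile1 ?cmod_ge0// ltW.
  lra.
have h2 : cmod (1 - b^* * z) ^+ 2 <= cmod (1 - z0^* * z) ^+ 2 + 4 * (e / 50).
  apply: lip; rewrite ?bnd ?z0_1 ?(ltW an1) ?(ltW z1)//.
  have -> : 1 - b^* * z - (1 - z0^* * z) = - ((b - z0)^* * z) by rewrite rmorphB /=; ring.
  rewrite cmodN cmodM cmod_conj (le_trans (_ : _ <= cmod (b - z0)))//.
    by rewrite ler_piMr ?cmod_ge0// ltW.
  by lra.
rewrite fzs; have y2 : 0 <= cmod y ^+ 2 <= 1 by rewrite sqr_ge0 expr_le1 ?cmod_ge0// ltW.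
have A2 : 0 <= cmod (1 - b^* * z) ^+ 2 <= 4.
  rewrite sqr_ge0 /= (_ : 4 = 2 ^+ 2); last by ring.
  by rewrite ler_sqr ?nnegrE ?cmod_ge0// bnd// ltW.
move: h1 h2 y2 A2; set P := cmod (1 - z0^* * y) ^+ 2; set P' := cmod (1 - b^* * f z) ^+ 2.
set Q := cmod (1 - z0^* * z) ^+ 2; set Q' := cmod (1 - b^* * z) ^+ 2.
set Y := cmod y ^+ 2 => h1 h2 /andP[Y0 Y1] /andP[Q0 Q4] h.
have k1 : x * P <= x * P' + 4 * (e / 50).
  apply: (@le_trans _ _ (x * (P' + 4 * (e / 50)))); first by rewrite ler_pM2l.
  by rewrite mulrDr lerD2l ler_piMl// mulr_ge0// divr_ge0// ltW.
have k2 : (1 - Y) * Q' <= (1 - Y) * Q + 4 * (e / 50).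
  apply: (@le_trans _ _ ((1 - Y) * (Q + 4 * (e / 50)))).
    by rewrite ler_wpM2l ?subr_ge0.
  rewrite mulrDr lerD2l ler_piMl ?gerBl// mulr_ge0// divr_ge0// ltW//.
have k3 : (1 - s ^+ 2) * (Y * Q') <= 2 * (e / 100) * 4.
  have s2 : 0 <= 1 - s ^+ 2 by rewrite subr_ge0 expr_le1// ltW.
  apply: ler_pM => //; first by rewrite mulr_ge0.
    by have := sqr_ge0 (1 - s); rewrite sqrrB expr1n mul1r; lra.
  by rewrite -[4]mul1r ler_pM.
have e1 : (1 - s ^+ 2 * Y) * Q' = (1 - Y) * Q' + (1 - s ^+ 2) * (Y * Q') by ring.
move: h e1 k1 k2 k3 e0; clear; lra.
Qed.

(** For [cmod z0 = 1], maps the disc to the right half-plane and [z0] to infinity. Its real part is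
    the Poisson kernel at [z0], whose superlevel sets are the horodiscs, so Wolff's inequality says
    that it grows under [phi]. *)
Definition cayley (z0 x : C) : C := (z0 + x) / (z0 - x).

Lemma Re_cayley (z0 x : C) : cmod z0 = 1 ->
  complex.Re (cayley z0 x) = (1 - cmod x ^+ 2) / cmod (z0 - x) ^+ 2.
Proof.
move=> z01; have := cmod_sqr z0; rewrite z01 expr1n /cayley !cmod_sqr.
case: z0 {z01} => a b; case: x => c d /= h.
have -> : 1 - (c ^+ 2 + d ^+ 2) = a ^+ 2 + b ^+ 2 - (c ^+ 2 + d ^+ 2) by rewrite -h.
set N := (_ + _)^-1.
by ring.
Qed.

Lemma cayley_den (z0 x : C) : cmod z0 = 1 -> cmod x < 1 -> z0 - x != 0.
Proof. by move=> z01 x1; rewrite subr_eq0; apply: contraTneq x1 => <-; rewrite z01 ltxx. Qed.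

Lemma derivable_cayley (z0 x : C) : cmod z0 = 1 -> cmod x < 1 ->
  derivable (cayley z0) x 1.
Proof.
move=> z01 x1; apply: derivable_mul.
  by apply: derivable_add; [exact: derivable_cst|exact: derivable_id].
apply: derivable_inv; first exact: cayley_den.
by apply: derivableB; [exact: derivable_cst|exact: derivable_id].
Qed.

Lemma cayley_inj (z0 x y : C) : cmod z0 = 1 -> cmod x < 1 -> cmod y < 1 ->
  cayley z0 x = cayley z0 y -> x = y.
Proof.
move=> z01 x1 y1 e; have dx := cayley_den z01 x1; have dy := cayley_den z01 y1.
have z00 : z0 != 0 by rewrite -cmod_eq0 z01 oner_eq0.
have {}e : (z0 + x) * (z0 - y) = (z0 + y) * (z0 - x).
  by apply/eqP; rewrite -eqr_div//; apply/eqP.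
have h : 2 * z0 * x = 2 * z0 * y.
  apply/eqP; rewrite -subr_eq0.
  have -> : 2 * z0 * x - 2 * z0 * y = (z0 + x) * (z0 - y) - (z0 + y) * (z0 - x) by ring.
  by rewrite e subrr.
by apply: (mulfI _ h); rewrite mulf_neq0// pnatr_eq0.
Qed.

(* An orbit staying away from the circle would cluster at some [w] where Wolff's
   inequality is an equality; then [phi] is a translation in the half-plane
   coordinate [cayley z0], and no orbit of a nontrivial translation clusters. *)
Lemma boundary_no_cluster z0 : (forall a, cmod a < 1 -> phi a <> a) -> cmod z0 = 1 ->
  (forall z, cmod z < 1 ->
    complex.Re (cayley z0 z) <= complex.Re (cayley z0 (phi z))) ->
  forall z w, cmod z < 1 -> cmod w < 1 -> ~ cluster_orbit phi z w.
Proof.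
move=> nofix z01 mono z w z1 w1 cl; pose W := cayley z0.
have cW x : cmod x < 1 -> {for x, continuous W}.
  by move=> x1; apply: derivable_continuous; exact: derivable_cayley.
have ReL (u v : C) : `|complex.Re u - complex.Re v| <= cmod (u - v).
  by rewrite -raddfB; exact: normRe_le.
have ew : complex.Re (W (phi w)) = complex.Re (W w).
  apply/le_anti/andP; split; last exact: mono.
  rewrite -lerN2; apply: (cluster_orbit_le dphi phi1 (u := fun x => - complex.Re (W x)) z1 w1 cl).
    by move=> x x1; rewrite lerN2; exact: mono.
  move=> x x1 e e0; have /continuous_cmodP/(_ e e0)[d d0 hd] := cW x x1.
  exists d => // y /hd; apply: le_lt_trans; rewrite -opprD normrN; exact: ReL.
pose c := W w - W (phi w).
(* As [c] is purely imaginary, [W x - W (phi x) - c] has nonpositive real part, and it vanishes at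
   [w]: the strong maximum principle applies. *)
have trans x : cmod x < 1 -> W (phi x) = W x - c.
  move=> x1; apply/eqP; rewrite -subr_eq0 -oppr_eq0; apply/eqP.
  rewrite (_ : - (W (phi x) - (W x - c)) = W x - W (phi x) - c); last by ring.
  have wn : w \notin ([::] : seq C) by [].
  have xn : x \notin ([::] : seq C) by [].
  apply: (strong_maximum (s := [::]) (h := fun x => W x - W (phi x) - c) w1 wn _ _ _ x1 xn).
  - apply: derivable_off => v v1; apply: derivable_sub_cst; apply: derivableB.
      exact: derivable_cayley.
    by apply: derivable_comp; [exact: dphi|apply: derivable_cayley => //; exact: phi1].
  - move=> v v1; have c0 : complex.Re c = 0 by rewrite /c raddfB /= ew subrr.
    by rewrite raddfB /= c0 subr0 raddfB /= subr_le0; exact: mono.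
  - by rewrite subrr.
have c0 : c != 0.
  apply/eqP => c0; apply: (nofix w w1); apply: (cayley_inj z01 (phi1 w1) w1).
  by rewrite -/W trans// c0 subr0.
have iterW n : W (iter n phi z) = W z - n%:R * c.
  elim: n => [|n IH]; first by rewrite mul0r subr0.
  by rewrite iterS trans ?iter_unit_disc// IH -natr1; ring.
have /continuous_cmodP/(_ 1 ltr01)[d d0 hd] := cW w w1.
pose B := cmod (W w) + 1 + cmod (W z).
have c1 : 0 < cmod c by rewrite cmod_gt0.
have B0 : 0 <= B / cmod c by rewrite divr_ge0 ?cmod_ge0// !addr_ge0 ?cmod_ge0.
have [n Nn hn] := cl d d0 (Num.Def.truncn (B / cmod c)).+1.
have := hd _ hn; rewrite iterW => h1.
have h2 : n%:R * cmod c < B.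
  have -> : n%:R * cmod c = cmod (n%:R * c) by rewrite cmodM -realcn cmod_real normr_nat.
  rewrite (_ : n%:R * c = W z - ((W z - n%:R * c - W w) + W w)); last by ring.
  rewrite (le_lt_trans (cmodB _ _))// /B addrC ltrD2r (le_lt_trans (cmodD _ _))//.
  by rewrite addrC ltrD2l.
have := truncnS_gt (B / cmod c); rewrite ltr_pdivrMr// => h3.
have : (Num.Def.truncn (B / cmod c)).+1%:R * cmod c <= n%:R * cmod c.
  by rewrite ler_pM2r// ler_nat.
move: h2 h3; clear; lra.
Qed.

Theorem denjoy_wolff : ~ elliptic_automorphism phi ->
  exists2 z0, cmod z0 <= 1 & denjoy_wolff_point phi z0.
Proof.
move=> nell; suff [z0 z01 h] : exists2 z0 : C, cmod z0 <= 1 &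
    forall z, cmod z < 1 -> forall e : R, 0 < e -> exists N, forall n, (N <= n)%N ->
      cmod (iter n phi z - z0) < e.
  exists z0 => //; split => //; first by rewrite closed_discE.
  exact: iter_cvg_uniform.
have [[a [a1 pa]]|nofix] := pselect (exists a, cmod a < 1 /\ phi a = a).
  by exists a; [exact: ltW|exact: interior_fixed_point_cvg].
have {}nofix a : cmod a < 1 -> phi a <> a by move=> a1 pa; apply: nofix; exists a.
have [z0 z01 hz0] := wolff nofix; exists z0; first by rewrite z01.
have mono z : cmod z < 1 -> complex.Re (cayley z0 z) <= complex.Re (cayley z0 (phi z)).
  move=> z1; rewrite !Re_cayley//.
  have d1 : 0 < cmod (z0 - z) ^+ 2 by rewrite exprn_gt0// cmod_gt0 cayley_den.
  have d2 : 0 < cmod (z0 - phi z) ^+ 2 by rewrite exprn_gt0// cmod_gt0 cayley_den// phi1.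
  by rewrite ler_pdivrMr// mulrAC ler_pdivlMr//; exact: hz0.
move=> z z1 e e0; apply: contrapT => /forallNP H.
have /choice[n_ hn] : forall k : nat, exists n, (k <= n)%N /\ e <= cmod (iter n phi z - z0).
  move=> k; have /existsNP[n /not_implyP[kn /negP]] := H k.
  by rewrite -leNgt => h; exists n.
pose c := complex.Re (cayley z0 z).
have c0 : 0 < c.
  rewrite /c Re_cayley// divr_gt0 ?exprn_gt0 ?cmod_gt0 ?cayley_den//.
  by rewrite subr_gt0 expr_lt1// cmod_ge0.
have orb n : c <= complex.Re (cayley z0 (iter n phi z)).
  elim: n => // n IH; rewrite iterS (le_trans IH)// mono//; exact: iter_unit_disc.
(* A point [x] of the orbit at distance at least [e] from [z0] satisfies [c * e ^+ 2 <= 1 - cmod x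
   ^+ 2 <= 2 * (1 - cmod x)]. *)
pose rho := 1 - c * e ^+ 2 / 2.
have ce : 0 < c * e ^+ 2 by rewrite mulr_gt0// exprn_gt0.
have far k : cmod (iter (n_ k) phi z) <= rho.
  set x := iter (n_ k) phi z; have x1 : cmod x < 1 by exact: iter_unit_disc.
  have := orb (n_ k); rewrite -/x Re_cayley// ler_pdivlMr; last first.
    by rewrite exprn_gt0// cmod_gt0 cayley_den.
  have [_] := hn k; rewrite -/x cmodBC => h1 h2.
  have : c * e ^+ 2 <= c * cmod (z0 - x) ^+ 2.
    by rewrite ler_pM2l// ler_sqr ?nnegrE ?cmod_ge0// ltW.
  have := sqr_ge0 (1 - cmod x); rewrite sqrrB expr1n mul1r /rho; lra.
have rho0 : 0 <= rho by exact: le_trans (cmod_ge0 _) (far 0%N).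
have rho1 : rho < 1 by rewrite /rho; lra.
(* The radius [rho] may be [0]; [(1 + rho) / 2] is positive and still below [1]. *)
have [w wr cl] := compact_cluster_cmod
  (@cball_compact R ((1 + rho) / 2) ltac:(by rewrite divr_gt0// ltr_wpDr))
  (x_ := fun k => iter (n_ k) phi z) ltac:(by move=> k; rewrite /cball /=; have := far k; lra).
have w1 : cmod w < 1 by apply: le_lt_trans wr _; lra.
apply: (boundary_no_cluster nofix z01 mono z1 w1) => g g0 N.
have [k Nk hk] := cl g g0 N; exists (n_ k) => //.
by have [kn _] := hn k; exact: leq_trans Nk kn.
Qed.

End DenjoyWolff.

(** * Composition operators on the disc algebra *)

Section Operators.
Variable R : realType.
Local Notation C := R[i].
Local Notation A := (disc_algebra R).
Implicit Types f g : A.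

Definition within_disc (f : C -> C) := forall z, cmod z <= 1 ->
  forall e : R, 0 < e -> exists2 d : R, 0 < d &
    forall w, cmod w <= 1 -> cmod (w - z) < d -> cmod (f w - f z) < e.

Lemma within_disc_algebra f : within_disc f.
Proof. exact/within_closed_discP/disc_fun_continuous. Qed.

Lemma derivable_within_disc (f : C -> C) :
  (forall z, cmod z <= 1 -> derivable f z 1) -> within_disc f.
Proof.
move=> df z z1 e e0; have /derivable_continuous/continuous_cmodP/(_ e e0)[d d0 hd] := df z z1.
by exists d => // w _; exact: hd.
Qed.

Lemma within_disc_comp (f g : C -> C) : (forall z, cmod z <= 1 -> cmod (f z) <= 1) ->
  within_disc f -> within_disc g -> within_disc (fun z => g (f z)).
Proof.
move=> f1 cf cg z z1 e e0; have [d d0 hd] := cg _ (f1 z z1) e e0.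
have [d' d'0 hd'] := cf z z1 d d0; exists d' => // w w1 /(hd' w w1); apply: hd; exact: f1.
Qed.

Lemma disc_algebra_exists (f : C -> C) : within_disc f ->
  (forall z, cmod z < 1 -> derivable f z 1) ->
  exists g : A, forall z, cmod z <= 1 -> g z = f z.
Proof.
move=> cf df; pose g := patch (fun=> 0) (@closed_disc R) f.
have gE z : cmod z <= 1 -> g z = f z.
  by move=> z1; rewrite /g patchE mem_set// closed_discE.
have gP : g \in @disc_algebra_pred R.
  apply/disc_algebra_predP; split.
  - apply/within_closed_discP => z z1 e e0; have [d d0 hd] := cf z z1 e e0.
    by exists d => // w w1; rewrite !gE//; exact: hd.
  - move=> z; rewrite unit_discE => z1; apply: (@near_eq_derivable _ _ _ f); last exact: df.
    have := nbhs_unit_disc (z := z); rewrite unit_discE => /(_ z1).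
    by apply: filterS => w; rewrite unit_discE => /ltW /gE.
  - by move=> z nz; rewrite /g patchE memNset.
by exists (DiscAlgebra gP).
Qed.

Lemma within_disc_approx (f : C -> C) z : within_disc f -> cmod z <= 1 ->
  forall e : R, 0 < e -> exists2 w, cmod w < 1 & cmod (f w - f z) < e.
Proof.
move=> cf z1 e e0; have [d d0 hd] := cf z z1 e e0.
pose t := Num.min d 1 / 2.
have [t0 td t1] : [/\ 0 < t, t < d & t < 1].
  have m0 : 0 < Num.min d 1 by rewrite lt_min d0 ltr01.
  have : Num.min d 1 <= d by rewrite ge_min lexx.
  have : Num.min d 1 <= 1 by rewrite ge_min lexx orbT.
  by rewrite /t; split; move: m0; lra.
have w1 : cmod ((1 - t)%:C * z) < 1.
  rewrite cmodM cmod_real gtr0_norm ?subr_gt0// (le_lt_trans (_ : _ <= 1 - t))//.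
    by rewrite ler_piMr// subr_ge0 ltW.
  by rewrite ltrBlDr ltrDl.
exists ((1 - t)%:C * z) => //; apply: hd; first exact: ltW.
have -> : (1 - t)%:C * z - z = - (t%:C * z) by rewrite realcB; ring.
by rewrite cmodN cmodM cmod_real gtr0_norm// (le_lt_trans _ td)// ler_piMr// ltW.
Qed.

Lemma within_disc_le (f : C -> C) (M : R) : within_disc f ->
  (forall z, cmod z < 1 -> cmod (f z) <= M) -> forall z, cmod z <= 1 -> cmod (f z) <= M.
Proof.
move=> cf fM z z1; apply/ler_addgt0Pr => e e0.
have [w w1 hw] := within_disc_approx cf z1 e0.
by have := fM w w1; have := cmod_dist (f z) (f w); rewrite cmodBC; lra.
Qed.

Lemma within_disc_eq (f g : C -> C) : within_disc f -> within_disc g ->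
  (forall z, cmod z < 1 -> f z = g z) -> forall z, cmod z <= 1 -> f z = g z.
Proof.
move=> cf cg fg z z1; apply/eqP; rewrite -subr_eq0 -cmod_eq0 eq_le cmod_ge0 andbT.
apply: (@within_disc_le (fun z => f z - g z)) => //; last first.
  by move=> w w1; rewrite fg// subrr cmod0.
move=> w w1 e e0.
have [d d0 hd] := cf w w1 (e / 2) ltac:(by rewrite divr_gt0).
have [d' d'0 hd'] := cg w w1 (e / 2) ltac:(by rewrite divr_gt0).
exists (Num.min d d'); first by rewrite lt_min d0.
move=> v v1; rewrite lt_min => /andP[/(hd v v1) h1 /(hd' v v1) h2].
have -> : f v - g v - (f w - g w) = f v - f w - (g v - g w) by ring.
by rewrite (le_lt_trans (cmodB _ _))// [e]splitr ltrD.
Qed.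

Lemma disc_funZ (a : C) f z : (a *: f) z = a * f z. Proof. by []. Qed.

Lemma disc_funB f g z : (f - g) z = f z - g z. Proof. by []. Qed.

Lemma disc_fun_sum (I : Type) (r : seq I) (P : pred I) (F : I -> A) z :
  (\sum_(i <- r | P i) F i) z = \sum_(i <- r | P i) F i z.
Proof. by elim/big_rec2: _ => // i x y _ <-. Qed.

Lemma disc_norm_leP f (M : R) : `|f| <= M%:C <-> forall z, cmod z <= 1 -> cmod (f z) <= M.
Proof.
rewrite [`|f|]disc_normE -/(sup_norm f) lecR; split=> [fM z z1|fM].
  by rewrite (le_trans _ fM)// -Re_norm_cmod sup_norm_ub// closed_discE.
by apply: sup_norm_leC => z; rewrite closed_discE normC_cmod lecR; exact: fM.
Qed.

Lemma cmod_le_sup_norm f z : cmod z <= 1 -> cmod (f z) <= sup_norm f.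
Proof. by move: z; apply/disc_norm_leP. Qed.

Lemma sup_norm_ge0 f : 0 <= sup_norm f.
Proof. by apply: le_trans (cmod_ge0 (f 0)) (cmod_le_sup_norm _ _); rewrite cmod0. Qed.

Lemma disc_cvgP (u : nat -> A) g : u n @[n --> \oo] --> g <->
  forall e : R, 0 < e -> exists N, forall n, (N <= n)%N ->
    forall z, cmod z <= 1 -> cmod (u n z - g z) <= e.
Proof.
split=> [/cvgrPdist_le h e e0|h].
  have [|N _ hN] := h e%:C; first by rewrite ltcR.
  exists N => n /hN; rewrite /= distrC => /disc_norm_leP hn z z1.
  by rewrite -disc_funB; exact: hn.
apply/cvgrPdist_le => _ /gt0C[e e0 ->]; have [N hN] := h e e0.
exists N => // n /hN {}hN; rewrite /= distrC; apply/disc_norm_leP => z z1.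
by rewrite disc_funB; exact: hN.
Qed.

Section CompositionOperator.
Variable phi : disc_symbol R.
Local Notation T := (composition_operator phi).

Lemma symbol_derivable z : cmod z < 1 -> derivable phi z 1.
Proof. by rewrite -unit_discE; exact: disc_fun_holomorphic. Qed.

Lemma symbol_disc z : cmod z < 1 -> cmod (phi z) < 1.
Proof. by rewrite -!unit_discE; exact: symbol_unit_disc. Qed.

Lemma symbol_cdisc z : cmod z <= 1 -> cmod (phi z) <= 1.
Proof. by rewrite -!closed_discE; exact: symbol_closed_disc. Qed.

Lemma iter_cdisc n z : cmod z <= 1 -> cmod (iter n phi z) <= 1.
Proof. by move=> z1; elim: n => // n IH; rewrite iterS symbol_cdisc. Qed.

Lemma within_disc_iter n : within_disc (iter n phi).
Proof.
elim: n => [|n IH]; first by move=> z z1 e e0; exists e.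
apply: (@within_disc_comp (iter n phi) phi) => //; last exact: within_disc_algebra.
by move=> z; exact: iter_cdisc.
Qed.

Lemma iter_composition m f z : cmod z <= 1 -> iter m T f z = f (iter m phi z).
Proof.
move=> z1; elim: m z z1 => // m IH z z1.
rewrite iterS [LHS]composition_funE ?closed_discE// IH ?symbol_cdisc//.
by rewrite -iterSr.
Qed.

Lemma cesaro_meanE n f z : cmod z <= 1 ->
  cesaro_mean T n f z = n%:R^-1 * \sum_(1 <= m < n.+1) f (iter m phi z).
Proof.
move=> z1; rewrite /cesaro_mean disc_funZ disc_fun_sum; congr (_ * _).
by apply: eq_bigr => m _; rewrite iter_composition.
Qed.

Lemma iter_composition_linear m (a : C) f g :
  iter m T (a *: f + g) = a *: iter m T f + iter m T g.
Proof. by elim: m => // m IH; rewrite !iterS IH linearP. Qed.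

Lemma cesaro_mean_linear n (a : C) f g :
  cesaro_mean T n (a *: f + g) = a *: cesaro_mean T n f + cesaro_mean T n g.
Proof.
rewrite /cesaro_mean scalerA mulrC -scalerA -scalerDr; congr (_ *: _).
rewrite scaler_sumr -big_split /=; apply: eq_bigr => m _.
exact: iter_composition_linear.
Qed.

Lemma cesaro_mean_le n f (M : R) : (forall z, cmod z <= 1 -> cmod (f z) <= M) ->
  0 <= M -> forall z, cmod z <= 1 -> cmod (cesaro_mean T n f z) <= M.
Proof.
move=> fM M0 z z1; rewrite cesaro_meanE// cmodM cmodV -realcn cmod_real normr_nat.
case: n => [|n]; first by rewrite invr0 mul0r.
rewrite ler_pdivrMl ?ltr0n// (le_trans (cmod_sum _ _ _))//.
rewrite (le_trans (ler_sum _ (G := fun=> M) _))//.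
  by move=> m _; rewrite fM// iter_cdisc.
by rewrite sumr_const_nat subn1 /= mulr_natl.
Qed.

(* The limit of the Cesaro means is automatically linear and contractive. *)
Lemma mean_ergodic_of_cvg : (forall f, exists g, cesaro_mean T n f @[n --> \oo] --> g) ->
  mean_ergodic T.
Proof.
move=> /choice[P hP]; split; first exact: composition_operator_continuous.
have Plin : linear P.
  move=> a f g; apply: cvg_unique (hP (a *: f + g)) _ => //.
  have -> : (fun n => cesaro_mean T n (a *: f + g)) =
      (fun n => a *: cesaro_mean T n f + cesaro_mean T n g).
    by apply/funext => n; exact: cesaro_mean_linear.
  by apply: cvgD (hP g); apply: cvgZr; exact: hP.
pose Pl : {linear A -> A} :=
  HB.pack P (GRing.isLinear.Build C A A _ P Plin).
exists Pl; split => //= f.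
apply/(@cvgrPdist_le C A _ _ (nbhs_filter f)) => _ /gt0C[e e0 ->].
apply/nbhs_ballP; exists e%:C; first by rewrite /= ltcR.
move=> g; rewrite -ball_normE /= => fg.
have -> : P f - P g = P (f - g) by rewrite -[P]/(Pl : A -> A) linearB.
apply/disc_norm_leP => z z1; apply/ler_addgt0Pr => r r0.
have /disc_cvgP/(_ r r0)[N /(_ N (leqnn N) z z1) hN] := hP (f - g).
have h := @cesaro_mean_le N (f - g) e _ (ltW e0) z z1.
have : cmod (cesaro_mean T N (f - g) z) <= e.
  by apply: h; apply/disc_norm_leP; exact: ltW.
by have := cmod_dist (P (f - g) z) (cesaro_mean T N (f - g) z); rewrite cmodBC; lra.
Qed.

End CompositionOperator.
End Operators.

(** * Criteria for uniform mean ergodicity *)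

Section UniformErgodicity.
Variable R : realType.
Local Notation C := R[i].
Local Notation A := (disc_algebra R).
Variable phi : disc_symbol R.
Local Notation T := (composition_operator phi).

Lemma operator_norm_le (S : A -> A) (M : R) :
  (forall f, `|f| <= 1 -> `|S f| <= M%:C) -> (operator_norm S <= M%:E)%E.
Proof.
move=> SM; apply: ge_ereal_sup => _ [f /= f1 <-]; rewrite lee_fin.
by rewrite -[X in X <= _]/(sup_norm (S f)) -lecR; exact: SM.
Qed.

Lemma le_operator_norm (S : A -> A) f : `|f| <= 1 ->
  ((complex.Re `|S f|)%:E <= operator_norm S)%E.
Proof. by move=> f1; apply: ereal_sup_ubound; exists f. Qed.

(** The limit appears as any [g] to which the means of [f] converge, so the estimate can be checked
    without a formula for the limit operator. *)
Lemma uniformly_mean_ergodic_of_cvg : mean_ergodic T ->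
  (forall e : R, 0 < e -> exists N, forall n, (N <= n)%N -> forall f g : A, `|f| <= 1 ->
     cesaro_mean T k f @[k --> \oo] --> g ->
     forall z, cmod z <= 1 -> cmod (cesaro_mean T n f z - g z) <= e) ->
  uniformly_mean_ergodic T.
Proof.
move=> [cT [P [cP hP]]] h; split=> //; exists P; split=> //.
pose D n (x : A) : A := cesaro_mean T n x - P x.
have norm0 n : (0 <= operator_norm (D n))%E.
  apply: le_trans (@le_operator_norm _ 0 _); last by rewrite normr0 ler01.
  by rewrite lee_fin; exact: sup_norm_ge0.
have bound e : 0 < e -> exists N, forall n, (N <= n)%N ->
    (operator_norm (D n) <= e%:E)%E.
  move=> /h[N hN]; exists N => n Nn; apply: operator_norm_le => f f1.
  by apply/disc_norm_leP => z z1; rewrite disc_funB; exact: hN.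
have fin n e : (operator_norm (D n) <= e%:E)%E ->
    operator_norm (D n) \is a fin_num.
  by move=> le; rewrite ge0_fin_numE// (le_lt_trans le) ?ltry.
apply/fine_cvgP; split.
  have [N hN] := bound 1 ltr01; exists N => // n /hN; exact: fin.
apply/cvgrPdist_le => e e0; have [N hN] := bound e e0; exists N => // n /hN le /=.
rewrite sub0r normrN ger0_norm; last by apply: fine_ge0; exact: norm0.
by rewrite -lee_fin fineK ?(fin n e).
Qed.

(** The limit operator is eliminated, so one function of the unit ball evaluated at one point can
    refute uniform ergodicity. *)
Lemma uniformly_mean_ergodic_cauchy : uniformly_mean_ergodic T ->
  forall e : R, 0 < e -> exists N, forall n m, (N <= n)%N -> (N <= m)%N ->
    forall f : A, (forall z, cmod z <= 1 -> cmod (f z) <= 1) ->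
    forall z, cmod z <= 1 -> cmod (cesaro_mean T n f z - cesaro_mean T m f z) <= e.
Proof.
move=> [_ [P [_ cP]]] e e0.
have e2 : 0 < e / 2 by rewrite divr_gt0.
have /fine_cvgP[[N1 _ hN1] /cvgrPdist_le/(_ _ e2)[N2 _ hN2]] := cP.
pose D n (x : A) : A := cesaro_mean T n x - P x.
have key n (f : A) : (maxn N1 N2 <= n)%N -> (forall z, cmod z <= 1 -> cmod (f z) <= 1) ->
    forall z, cmod z <= 1 -> cmod (D n f z) <= e / 2.
  rewrite geq_max => /andP[nN1 nN2] f1.
  have fin : operator_norm (D n) \is a fin_num := hN1 _ nN1.
  have hn : `|0 - fine (operator_norm (D n))| <= e / 2 := hN2 _ nN2.
  have f1' : `|f| <= 1%:C by apply/disc_norm_leP.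
  have := @le_operator_norm (D n) f f1'.
  rewrite -(fineK fin) lee_fin => h.
  have /disc_norm_leP hD : `|D n f| <= (e / 2)%:C.
    rewrite [`|_|]disc_normE -/(sup_norm _) lecR (le_trans h)//.
    by rewrite sub0r normrN in hn; rewrite (le_trans (ler_norm _) hn).
  exact: hD.
exists (maxn N1 N2) => n m nN mN f f1 z z1.
have DE k : D k f z = cesaro_mean T k f z - P f z by exact: disc_funB.
have -> : cesaro_mean T n f z - cesaro_mean T m f z = D n f z - D m f z.
  by rewrite !DE opprB addrA subrK.
by rewrite (le_trans (cmodB _ _))// [e]splitr lerD ?key.
Qed.

End UniformErgodicity.

(** * Density and averages along orbits *)

Section Density.
Variable R : realType.
Implicit Types J : set nat.

Lemma card_initial_segment J N :
  #|[pred k : 'I_N.+1 | (k : nat) \in J]|%:R =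
    (0%N \in J)%:R + \sum_(1 <= k < N.+1) (k \in J)%:R :> R.
Proof.
rewrite -sum1_card natr_sum big_mkcond /=.
rewrite (eq_bigr (fun k : 'I_N.+1 => ((k : nat) \in J)%:R)).
  by rewrite -(big_mkord xpredT (fun k => (k \in J)%:R)) big_ltn.
by move=> k _; rewrite inE; case: (_ \in J).
Qed.

(** Exceptions are counted from [1], like the terms of a Cesaro mean, whereas [has_density] also
    counts [0] and divides by [N]. The discrepancy of at most one is absorbed in [e / 2 * N]. *)
Lemma density1P J : has_density J (1 : R) <->
  forall e : R, 0 < e -> exists N0, forall N, (N0 <= N)%N ->
    \sum_(1 <= k < N.+1) (k \notin J)%:R <= e * N%:R.
Proof.
have sumC N : \sum_(1 <= k < N.+1) (k \in J)%:R =
    N%:R - \sum_(1 <= k < N.+1) (k \notin J)%:R :> R.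
  apply/eqP; rewrite eq_sym subr_eq -big_split /= eq_sym.
  rewrite (eq_bigr (fun=> 1)); last by move=> k _; case: (k \in J); rewrite ?addr0 ?add0r.
  by rewrite sumr_const_nat subn1.
have bad0 N : 0 <= \sum_(1 <= k < N.+1) (k \notin J)%:R :> R by rewrite sumr_ge0.
have NgtP (e : R) : 0 < e -> exists N0, forall N : nat, (N0 <= N)%N -> 1 <= e * N%:R /\ 0 < N%:R :> R.
  move=> e0; exists (Num.Def.truncn e^-1).+1 => N NN.
  have N0 : 0 < N%:R :> R by rewrite ltr0n (leq_ltn_trans _ NN).
  split=> //; rewrite -ler_pdivrMl// mulr1 (le_trans (ltW (truncnS_gt _)))//.
  by rewrite ler_nat.
have b01 (b : bool) : (0 : R) <= b%:R <= (1 : R) by case: b; rewrite ?ler01 ?lexx.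
rewrite /has_density; split=> [/cvgrPdist_le h e e0|h].
  have [|N1 _ hN1] := h (e / 2); first by rewrite divr_gt0.
  have [N2 hN2] := NgtP (e / 2) ltac:(by rewrite divr_gt0).
  exists (maxn N1 N2) => N; rewrite geq_max => /andP[/hN1 /= hN /hN2 [h1 h2]].
  move: hN; rewrite card_initial_segment sumC ler_norml => /andP[_].
  have N0 : N%:R != 0 :> R by rewrite gt_eqF.
  rewrite -(ler_pM2r h2) mulrBl mul1r divfK//.
  have /andP[] := b01 (0%N \in J); lra.
apply/cvgrPdist_le => e e0; have e2 : 0 < e / 2 by rewrite divr_gt0.
have [N1 hN1] := h _ e2; have [N2 hN2] := NgtP _ e2.
exists (maxn N1 N2) => // N; rewrite /= geq_max => /andP[/hN1 hN /hN2 [h1 h2]].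
have N0 : N%:R != 0 :> R by rewrite gt_eqF.
rewrite card_initial_segment sumC; have /andP[] := b01 (0%N \in J).
have := bad0 N; move: hN; set B := \sum_(_ <= _ < _) _; set b := (0%N \in J)%:R.
move=> h3 h4 h5 h6; have -> : 1 - (b + (N%:R - B)) / N%:R = (B - b) / N%:R by field.
rewrite normrM normfV (gtr0_norm h2) ler_pdivrMr// ler_norml.
by apply/andP; split; lra.
Qed.

End Density.

Section UniformAverages.
Variable R : realType.
Local Notation C := R[i].

(* If every orbit has some average of [h] below [e], then by compactness these averages
   can be taken over boundedly many steps; concatenating them gives uniformity. *)
Lemma uniform_averages (phi : C -> C) (h : C -> R) :
  (forall z, cmod z <= 1 -> cmod (phi z) <= 1) -> within_disc phi ->
  (forall z, cmod z <= 1 -> 0 <= h z) ->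
  (forall z, cmod z <= 1 -> forall e : R, 0 < e -> exists2 d : R, 0 < d &
    forall w, cmod w <= 1 -> cmod (w - z) < d -> `|h w - h z| < e) ->
  (forall z, cmod z <= 1 -> forall e : R, 0 < e -> exists2 n, (0 < n)%N &
    \sum_(1 <= m < n.+1) h (iter m phi z) < e * n%:R) ->
  forall e : R, 0 < e -> exists N, forall n, (N <= n)%N -> forall z, cmod z <= 1 ->
    \sum_(1 <= m < n.+1) h (iter m phi z) <= e * n%:R.
Proof.
move=> phi1 cphi h0 ch avg e e0.
have it1 m z : cmod z <= 1 -> cmod (iter m phi z) <= 1.
  by move=> z1; elim: m => // m IH; rewrite iterS phi1.
have cit m : within_disc (iter m phi).
  elim: m => [|m IH]; first by move=> z z1 g g0; exists g.
  by apply: (@within_disc_comp _ (iter m phi) phi) => // z; exact: it1.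
pose S n z := \sum_(1 <= m < n.+1) h (iter m phi z).
have cS n z : cmod z <= 1 -> forall g : R, 0 < g -> exists2 d : R, 0 < d &
    forall w, cmod w <= 1 -> cmod (w - z) < d -> `|S n w - S n z| < g.
  move=> z1; elim: n => [|n IH] g g0.
    by exists 1 => // w _ _; rewrite /S !big_geq// subrr normr0.
  have g2 : 0 < g / 2 by rewrite divr_gt0.
  have [d d0 hd] := IH _ g2.
  have [d1 d10 hd1] := ch _ (it1 n.+1 z z1) _ g2.
  have [d2 d20 hd2] := cit n.+1 z z1 d1 d10.
  exists (Num.min d d2); first by rewrite lt_min d0.
  move=> w w1; rewrite lt_min => /andP[/(hd _ w1) h1 /(hd2 _ w1)/(hd1 _ (it1 _ _ w1)) h2].
  rewrite /S !(big_nat_recr n.+1)//= -/(S n w) -/(S n z) opprD addrACA.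
  by rewrite (le_lt_trans (ler_normD _ _))// [g]splitr ltrD.
have e2 : 0 < e / 2 by rewrite divr_gt0.
have /choice[nd hnd] : forall z, exists nd : nat * R, cmod z <= 1 ->
    [/\ (0 < nd.1)%N, 0 < nd.2 & forall w, cmod w <= 1 -> cmod (w - z) < nd.2 ->
      S nd.1 w <= e / 2 * nd.1%:R].
  move=> z; have [z1|/negP nz1] := boolP (cmod z <= 1); last by exists (0%N, 0).
  have [n n0 hn] := avg z z1 _ e2.
  have [|d d0 hd] := cS n z z1 (e / 2 * n%:R - S n z); first by rewrite subr_gt0.
  exists (n, d) => _; split=> // w w1 /(hd w w1); rewrite ltr_norml => /andP[_] /=; lra.
have [||s sK cov] := @compact_cover_cmod R (cball 1) (fun z => (nd z).2).
- exact: cball_compact.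
- by move=> z /hnd[].
pose L := \max_(z <- s) (nd z).1.
have step w : cmod w <= 1 -> exists k, [/\ (0 < k <= L)%N & S k w <= e / 2 * k%:R].
  move=> w1; have [z zs wz] := cov w w1; have [n0 d0 hz] := hnd z (sK z zs).
  exists (nd z).1; split; last exact: hz.
  by rewrite n0 /=; exact: (@leq_bigmax_seq _ _ xpredT (fun z => (nd z).1)).
have [H H0 hH] : exists2 H : R, 0 <= H & forall w, cmod w <= 1 -> h w <= H.
  have [||z z1 hz] := @compact_max_cmod R (cball 1) h 0 (cball_compact ltr01).
  - by rewrite /cball /= cmod0.
  - move=> z z1 g g0; have [d d0 hd] := ch z z1 g g0; exists d => // w w1 /(hd w w1).
    rewrite ltr_norml => /andP[_]; lra.
  by exists (h z) => //; exact: h0.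
have S_split k n w : (k <= n)%N -> S n w = S k w + S (n - k)%N (iter k phi w).
  move=> kn; rewrite /S (@big_cat_nat _ _ _ k.+1)//=; congr (_ + _).
  rewrite -{1}[k.+1]addn1 addnC big_addn subSn//; apply: eq_bigr => m _.
  by rewrite -iterD.
have S_le n w : cmod w <= 1 -> S n w <= n%:R * H.
  move=> w1; rewrite /S (le_trans (ler_sum _ (G := fun=> H) _))//.
    by move=> m _; apply: hH; exact: it1.
  by rewrite sumr_const_nat subn1 mulr_natl.
(* Blocks of good lengths are split off one by one; the last stretch, of length at most [L], costs
   at most [L * H] whatever [n] is. *)
have bound n w : cmod w <= 1 -> S n w <= e / 2 * n%:R + L%:R * H.
  elim/ltn_ind: n w => n IH w w1; have [nL|Ln] := leqP n L.
    rewrite (le_trans (S_le _ _ w1))// (le_trans (_ : _ <= L%:R * H))//.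
      by rewrite ler_wpM2r// ler_nat.
    by rewrite lerDr mulr_ge0// ltW.
  have [k [/andP[k0 kL] hk]] := step w w1.
  have kn : (k <= n)%N by rewrite (leq_trans kL)// ltnW.
  rewrite (S_split k)//; have := IH (n - k)%N ltac:(by rewrite ltn_subrL k0 (leq_ltn_trans _ Ln)) _ (it1 k w w1).
  by rewrite natrB// mulrBr; move: hk; lra.
exists (Num.Def.truncn (2 * L%:R * H / e)).+1 => n nn z z1.
rewrite (le_trans (bound n z z1))//.
have : L%:R * H <= e / 2 * n%:R.
  have : 2 * L%:R * H / e <= n%:R.
    by rewrite (le_trans (ltW (truncnS_gt _)))// ler_nat.
  by rewrite ler_pdivrMr//; lra.
have -> : e * n%:R = e / 2 * n%:R + e / 2 * n%:R by field.
by rewrite lerD2l.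
Qed.

End UniformAverages.

(** * Boundary Denjoy-Wolff points *)

Section BoundaryDenjoyWolff.
Variable R : realType.
Local Notation C := R[i].
Local Notation A := (disc_algebra R).

Lemma cesaro_small (h : nat -> R) :
  (forall e : R, 0 < e -> exists N, forall n, (N <= n)%N -> h n <= e) ->
  forall e : R, 0 < e -> exists N, forall n, (N <= n)%N ->
    \sum_(1 <= m < n.+1) h m <= e * n%:R.
Proof.
move=> hs e e0; have e2 : 0 < e / 2 by rewrite divr_gt0.
have [N hN] := hs _ e2; pose B := \sum_(1 <= m < N.+1) `|h m|.
have bound n : \sum_(1 <= m < n.+1) h m <= B + e / 2 * n%:R.
  rewrite /B; elim: n => [|n IH].
    by rewrite big_geq// mulr0 addr0 sumr_ge0.
  rewrite big_nat_recr//=; have [Nn|nN] := leqP N n.+1.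
    rewrite -[n.+1%:R]natr1 mulrDr mulr1 addrA lerD//; exact: hN.
  have -> : \sum_(1 <= m < n.+1) h m + h n.+1 = \sum_(1 <= m < n.+2) h m.
    by rewrite [RHS]big_nat_recr.
  rewrite (@big_cat_nat _ _ _ n.+2 1 N.+1)//=; last by rewrite ltnW.
  rewrite -addrA -[leLHS]addr0; apply: lerD.
    by apply: ler_sum => m _; exact: ler_norm.
  by rewrite addr_ge0 ?sumr_ge0// mulr_ge0// ltW.
exists (Num.Def.truncn (2 * B / e)).+1 => n nn; rewrite (le_trans (bound n))//.
have : 2 * B / e <= n%:R by rewrite (le_trans (ltW (truncnS_gt _)))// ler_nat.
by rewrite ler_pdivrMr//; lra.
Qed.

Variable phi : disc_symbol R.
Local Notation T := (composition_operator phi).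

Lemma cesaro_mean_subE n (f : A) (c z : C) : (0 < n)%N -> cmod z <= 1 ->
  cesaro_mean T n f z - c = n%:R^-1 * \sum_(1 <= m < n.+1) (f (iter m phi z) - c).
Proof.
move=> n0 z1; rewrite cesaro_meanE//.
have nC : n%:R != 0 :> C by rewrite pnatr_eq0 -lt0n.
by rewrite big_split /= sumr_const_nat subn1 /= mulrDr mulNrn mulrN -(mulr_natl c) mulKf.
Qed.

Lemma cesaro_mean_sub_le n (f : A) (c z : C) : (0 < n)%N -> cmod z <= 1 ->
  cmod (cesaro_mean T n f z - c) * n%:R <=
    \sum_(1 <= m < n.+1) cmod (f (iter m phi z) - c).
Proof.
move=> n0 z1; rewrite cesaro_mean_subE//.
rewrite cmodM cmodV -realcn cmod_real normr_nat mulrAC mulVf ?mul1r; last first.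
  by rewrite pnatr_eq0 -lt0n.
exact: cmod_sum.
Qed.

(** Extremality of [z0] made quantitative: the supporting linear functional controls the squared
    distance. Expand the square and use [cmod w <= 1]. *)
Lemma half_sqr_le_Re (z0 w : C) : cmod z0 = 1 -> cmod w <= 1 ->
  cmod (w - z0) ^+ 2 <= 2 * complex.Re (1 - z0^* * w).
Proof.
move=> z01 w1; have : cmod w ^+ 2 <= 1 by rewrite expr_le1 ?cmod_ge0.
have := cmod_sqr z0; rewrite z01 expr1n !cmod_sqr.
case: z0 {z01} => a b; case: w {w1} => c d /= h1 h2.
rewrite -subr_ge0 [X in 0 <= X](_ : _ = 1 - (c ^+ 2 + d ^+ 2) + (1 - (a ^+ 2 + b ^+ 2))); last by ring.
by rewrite -h1 subrr addr0 subr_ge0.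
Qed.

Lemma mean_ergodic_density (z0 : C) : mean_ergodic T -> cmod z0 = 1 ->
  (forall z, cmod z < 1 -> forall e : R, 0 < e -> exists N, forall n, (N <= n)%N ->
    cmod (iter n phi z - z0) < e) ->
  forall z (U : set C), cmod z <= 1 -> nbhs z0 U ->
    has_density [set n : nat | U (iter n phi z)] (1 : R).
Proof.
move=> [_ [P [_ hP]]] z01 dw.
have [f hf] : exists g : A, forall z, cmod z <= 1 -> g z = z.
  apply: (@disc_algebra_exists R id); first by move=> z _ e e0; exists e.
  by move=> z _; exact: derivable_id.
have /disc_cvgP cf := hP f.
have Pf z : cmod z < 1 -> P f z = z0.
  move=> z1; apply/eqP; rewrite -subr_eq0 -cmod_eq0 eq_le cmod_ge0 andbT.
  apply/ler_addgt0Pr => e e0; rewrite add0r; have e2 : 0 < e / 2 by rewrite divr_gt0.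
  have [N1 hN1] := cf _ e2.
  have [|N2 hN2] := @cesaro_small (fun m => cmod (f (iter m phi z) - z0)) _ _ e2.
    move=> g g0; have [N hN] := dw z z1 g g0; exists N => n /hN; rewrite hf.
      exact: ltW.
    by apply: iter_cdisc; exact: ltW.
  have h1 := hN1 (maxn N1 N2).+1 (leq_trans (leq_maxl _ _) (leqnSn _)) z (ltW z1).
  have h2 := hN2 (maxn N1 N2).+1 (leq_trans (leq_maxr _ _) (leqnSn _)).
  have := le_trans (cesaro_mean_sub_le f z0 (ltn0Sn _) (ltW z1)) h2.
  rewrite ler_pM2r ?ltr0n// => h3.
  by rewrite (le_trans (cmod_distD (cesaro_mean T (maxn N1 N2).+1 f z) _ _))// [e]splitr lerD// cmodBC.
(* Continuity of [P f] carries the value to the circle, where convergence of the orbits is not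
   known. *)
have {}Pf z : cmod z <= 1 -> P f z = z0.
  move: z; apply: (@within_disc_eq R (P f) (fun=> z0)) => //; first exact: within_disc_algebra.
  by move=> z _ e e0; exists 1 => // w _ _; rewrite subrr cmod0.
move=> z U z1 /nbhs_cmodP[d d0 hU]; apply/density1P => e e0.
have c0 : 0 < e * d ^+ 2 / 2 by rewrite divr_gt0// mulr_gt0// exprn_gt0.
have [N hN] := cf _ c0; exists N.+1 => n nN.
have n0 : (0 < n)%N by exact: leq_ltn_trans nN.
have := hN n (ltnW nN) z z1; rewrite Pf// => hn.
pose g m := complex.Re (1 - z0^* * iter m phi z).
have gsum : \sum_(1 <= m < n.+1) g m <= e * d ^+ 2 / 2 * n%:R.
  have -> : \sum_(1 <= m < n.+1) g m =
      complex.Re (1 - z0^* * cesaro_mean T n f z) * n%:R.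
    have nR : n%:R != 0 :> R by rewrite pnatr_eq0 -lt0n.
    have nC : n%:R != 0 :> C by rewrite pnatr_eq0 -lt0n.
    rewrite /g -raddf_sum sumrB sumr_const_nat subSS subn0 -mulr_sumr.
    have -> : \sum_(1 <= m < n.+1) iter m phi z = n%:R * cesaro_mean T n f z.
      rewrite cesaro_meanE// mulVKf//; apply: eq_bigr => m _.
      by rewrite hf// iter_cdisc.
    move: (cesaro_mean T n f z) => c.
    have -> : 1 *+ n - z0^* * (n%:R * c) = n%:R%:C * (1 - z0^* * c).
      by rewrite realcn; ring.
    have ReZ (x : R) (w : C) : complex.Re (x%:C * w) = x * complex.Re w.
      by case: w => a b /=; rewrite mul0r subr0.
    by rewrite -[LHS]/(complex.Re (n%:R%:C * (1 - z0^* * c))) ReZ mulrC.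
  rewrite ler_pM2r ?ltr0n// (le_trans (Re_le_cmod _))// cmod_unit_sub// cmodBC//.
(* Markov's inequality: [g m] is nonnegative, and at least [d ^+ 2 / 2] when the iterate is outside
   [U]. The bound [e * d ^+ 2 / 2] on the mean of [g] was chosen against this factor. *)
have step m : (m \notin [set n : nat | U (iter n phi z)])%:R <= 2 / d ^+ 2 * g m.
  have w1 := iter_cdisc phi m z1; have h := half_sqr_le_Re z01 w1; rewrite -/(g m) in h.
  have d2 : 0 < d ^+ 2 by rewrite exprn_gt0.
  have gm : 0 <= g m by have := sqr_ge0 (cmod (iter m phi z - z0)); lra.
  have [_|nU] := boolP (m \in _); first by rewrite mulr_ge0// divr_ge0// ltW.
  rewrite mulrAC ler_pdivlMr// mul1r (le_trans _ h)// ler_sqr ?nnegrE ?cmod_ge0 ?(ltW d0)//.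
  by rewrite leNgt; apply: contra nU => /hU hm; apply/mem_set.
rewrite (le_trans (ler_sum _ (fun m _ => step m)))// -mulr_sumr.
rewrite (le_trans (ler_wpM2l _ gsum))//; first by rewrite divr_ge0// sqr_ge0.
by rewrite le_eqVlt; apply/orP; left; apply/eqP; field; rewrite gt_eqF.
Qed.

Lemma density_cesaro_cvg (z0 : C) : cmod z0 <= 1 ->
  (forall (z : C) (U : set C), closed_disc z -> nbhs z0 U ->
    has_density [set n : nat | U (iter n phi z)] (1 : R)) ->
  forall (f : A) (e : R), 0 < e -> exists N, forall n, (N <= n)%N ->
    forall z, cmod z <= 1 -> cmod (cesaro_mean T n f z - f z0) <= e.
Proof.
move=> z01 dens f e e0; pose h w := cmod (f w - f z0).
have Lh (u v : C) : `|cmod u - cmod v| <= cmod (u - v).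
  by rewrite ler_norml lerNl opprB cmod_dist cmodBC cmod_dist.
have [|||N hN] := @uniform_averages R phi h (@symbol_cdisc R phi) (@within_disc_algebra R phi) _ _ _ e e0.
- by move=> z _; exact: cmod_ge0.
- move=> z z1 g g0; have [d d0 hd] := within_disc_algebra f z1 g0.
  exists d => // w w1 /(hd w w1); apply: le_lt_trans; apply: le_trans (Lh _ _) _.
  by rewrite /h (_ : _ - _ - _ = f w - f z)//; ring.
- move=> z z1 g g0.
  have g4 : 0 < g / 4 by rewrite divr_gt0.
  have [d d0 hd] := within_disc_algebra f z01 g4.
  pose H := 2 * sup_norm f; have H0 : 0 <= H by rewrite mulr_ge0// sup_norm_ge0.
  have hH w : cmod w <= 1 -> h w <= H.
    move=> w1; rewrite /h (le_trans (cmodB _ _))// /H mulr2n mulrDl mul1r.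
    by rewrite lerD// cmod_le_sup_norm.
  (* Exceptional times of this frequency, costing at most [H] each, contribute at most [g / 4] to
     the average; the [+ 1] allows [H = 0]. *)
  have e'0 : 0 < g / (4 * (H + 1)) by rewrite divr_gt0// mulr_gt0// ltr_wpDl.
  have cz : closed_disc z by rewrite closed_discE.
  have nU : nbhs z0 [set w : C | cmod (w - z0) < d] by apply/nbhs_cmodP; exists d.
  have /density1P/(_ _ e'0)[N hN] := dens z _ cz nU.
  exists N.+1 => //; have := hN N.+1 (leqnSn _).
  set J := [set n | _] => hJ.
  have step m : h (iter m phi z) <= g / 4 + H * (m \notin J)%:R.
    have w1 := iter_cdisc phi m z1; have [mJ|mJ] := boolP (m \in J).
      by rewrite mulr0 addr0 ltW// hd//; have /set_mem := mJ.
    by rewrite mulr1 (le_trans (hH _ w1))// lerDr ltW.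
  rewrite (le_lt_trans (ler_sum _ (fun m _ => step m)))// big_split /= sumr_const_nat subn1 /=.
  rewrite -mulr_sumr -mulr_natr.
  have : H * \sum_(1 <= k < N.+2) (k \notin J)%:R <= g / 4 * N.+1%:R.
    rewrite (le_trans (ler_wpM2l H0 hJ))// mulrA ler_wpM2r//.
    have -> : H * (g / (4 * (H + 1))) = g / 4 * (H / (H + 1)).
      by field; rewrite gt_eqF// ltr_wpDl.
    by rewrite ler_piMr ?(ltW g4)// ler_pdivrMr ?mul1r ?lerDl// ltr_wpDl.
  have : 0 < g * N.+1%:R by rewrite mulr_gt0// ltr0n.
  have -> : g / 4 * N.+1%:R = g * N.+1%:R / 4 by ring.
  lra.
exists N.+1 => n nN z z1; have n0 : (0 < n)%N by exact: leq_ltn_trans nN.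
rewrite -(ler_pM2r (_ : 0 < n%:R)) ?ltr0n//.
rewrite (le_trans (cesaro_mean_sub_le f (f z0) n0 z1))//.
exact: hN (ltnW nN) _ z1.
Qed.

Lemma density_mean_ergodic (z0 : C) : cmod z0 <= 1 ->
  (forall (z : C) (U : set C), closed_disc z -> nbhs z0 U ->
    has_density [set n : nat | U (iter n phi z)] (1 : R)) ->
  mean_ergodic T.
Proof.
move=> z01 dens; apply: mean_ergodic_of_cvg => f.
have [|g hg|g hg] := @disc_algebra_exists R (fun=> f z0).
- by move=> z _ e e0; exists 1 => // w _ _; rewrite subrr cmod0.
- exact: derivable_cst.
exists g; apply/disc_cvgP => e e0; have [N hN] := density_cesaro_cvg z01 dens f e0.
by exists N => n nN z z1; rewrite hg//; exact: hN.
Qed.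

(* Powers of the peak function [(1 + z0^* w) / 2] defeat uniformity. *)
Lemma boundary_not_uniformly_mean_ergodic (z0 : C) : cmod z0 = 1 ->
  (forall (z : C) (U : set C), closed_disc z -> nbhs z0 U ->
    has_density [set n : nat | U (iter n phi z)] (1 : R)) ->
  ~ uniformly_mean_ergodic T.
Proof.
move=> z01 dens ume.
have e40 : (0 : R) < 4^-1 by rewrite invr_gt0.
have [N hN] := uniformly_mean_ergodic_cauchy ume e40.
pose q (w : C) := (1 + z0^* * w) / 2.
have two : cmod (2 : C) = 2 by rewrite -realcn cmod_real normr_nat.
have q1 w : cmod w <= 1 -> cmod (q w) <= (1 + cmod w) / 2.
  move=> w1; rewrite /q cmodM cmodV two ler_pM2r ?invr_gt0// (le_trans (cmodD _ _))//.
  by rewrite cmod1 cmodM cmod_conj z01 mul1r.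
have q1' w : cmod w <= 1 -> cmod (q w) <= 1.
  by move=> w1; rewrite (le_trans (q1 w w1))//; lra.
have dq k z : derivable (fun w => q w ^+ k) z 1.
  apply: derivable_pow; apply: derivable_mul; last exact: derivable_cst.
  apply: derivable_add; first exact: derivable_cst.
  by apply: derivable_mul; [exact: derivable_cst|exact: derivable_id].
have /choice[F hF] : forall k, exists g : A, forall z, cmod z <= 1 -> g z = q z ^+ k.
  move=> k; apply: disc_algebra_exists; last by move=> z _; exact: dq.
  by apply: derivable_within_disc => z _; exact: dq.
have F1 k z : cmod z <= 1 -> cmod (F k z) <= 1.
  by move=> z1; rewrite hF// cmodX exprn_ile1 ?cmod_ge0// q1'.
have z00 : cmod (0 : C) <= 1 by rewrite cmod0.
have z00' : cmod (0 : C) < 1 by rewrite cmod0.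
pose n := N.+1.
(* The length [n] is fixed before the power [k]: finitely many iterates of [0] stay in a smaller
   disc, where [cmod q] is bounded away from [1]. *)
have [k hk] : exists k, forall m, (m < n.+1)%N -> cmod (q (iter m phi 0)) ^+ k <= 4^-1.
  have [r r1 hr] : exists2 r : R, 0 <= r < 1 & forall m, (m < n.+1)%N -> cmod (q (iter m phi 0)) <= r.
    elim: n.+1 => [|j [r /andP[r0 r1] hr]]; first by exists 0; rewrite // lexx ltr01.
    have w1 := iter_unit_disc (@symbol_disc R phi) j z00'.
    exists (Num.max r (cmod (q (iter j phi 0)))).
      rewrite le_max r0 /= gt_max r1 /= (le_lt_trans (q1 _ (ltW w1)))//.
      by move: w1; lra.
    move=> m; rewrite ltnS leq_eqVlt => /orP[/eqP->|/hr h]; rewrite le_max ?lexx ?orbT//.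
    by rewrite h.
  have [r0 rlt] := andP r1.
  have : (fun k => r ^+ k) @ \oo --> (0 : R) by apply: cvg_expr; rewrite ger0_norm.
  move=> /cvgrPdist_le/(_ _ e40)[k _ /(_ k (leqnn k))] /=.
  rewrite sub0r normrN => /(le_trans (ler_norm _)) h.
  by exists k => m /hr hm; rewrite (le_trans _ h)// lerXn2r ?nnegrE ?cmod_ge0.
have z01' : cmod z0 <= 1 by rewrite z01.
(* Long means of [F k] at [0] are within [1 / 4] of [F k z0 = 1], the mean of length [n] is at most
   [1 / 4], and the Cauchy bound [1 / 4] cannot fill the gap. *)
have [M hM] := density_cesaro_cvg z01' dens (F k) e40.
have Fz0 : F k z0 = 1.
  have -> : F k z0 = q z0 ^+ k by exact: hF.
  rewrite /q conj_mul_unit//; have -> : (1 + 1) / 2 = 1 :> C by field.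
  by rewrite expr1n.
have h1 := hM (maxn M N) (leq_maxl _ _) 0 z00; rewrite Fz0 in h1.
have h2 := hN n (maxn M N) (leqnSn _) (leq_maxr _ _) (F k) (F1 k) 0 z00.
have h3 : cmod (cesaro_mean T n (F k) 0 - 0) <= 4^-1.
  rewrite -(ler_pM2r (_ : 0 < n%:R)) ?ltr0n//.
  rewrite (le_trans (cesaro_mean_sub_le (F k) 0 (ltn0Sn _) z00))//.
  have -> : 4^-1 * n%:R = \sum_(1 <= m < n.+1) 4^-1 :> R.
    by rewrite sumr_const_nat subSS subn0 mulr_natr.
  rewrite big_nat [leRHS]big_nat; apply: ler_sum => m /andP[_ mn].
  have -> : F k (iter m phi 0) = q (iter m phi 0) ^+ k by apply: hF; exact: iter_cdisc.
  by rewrite subr0 cmodX hk.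
have h4 : cmod (1 - 0 : C) = 1 by rewrite subr0 cmod1.
move: (cesaro_mean T n (F k) 0) (cesaro_mean T (maxn M N) (F k) 0) h1 h2 h3 h4 => u v.
have := cmod_distD u (1 : C) 0; have := cmod_distD v (1 : C) u.
have : 4 * 4^-1 = 1 :> R by field.
rewrite (cmodBC (1 : C) v) (cmodBC v u); clear; lra.
Qed.

End BoundaryDenjoyWolff.

(** * Rotations *)

Section IrrationalRotation.
Variable R : realType.
Local Notation C := R[i].

Lemma unit_arg (z : C) : cmod z = 1 -> exists2 t : R, 0 <= t <= 2 * pi &
  z = cos t +i* sin t /\ (0 < complex.Im z -> 0 < t < pi).
Proof.
move=> z1; have := cmod_sqr z; rewrite z1 expr1n.
have := normRe_le z; rewrite z1; case: z {z1} => x y /=; rewrite ler_norml => x1 h.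
have y2 : 1 - x ^+ 2 = y ^+ 2 by rewrite h; ring.
have cx : cos (acos x) = x by rewrite acosK// in_itv.
have a0 := acos_ge0 x1; have api := acos_lepi x1.
have sx : sin (acos x) = `|y| by rewrite sin_acos// y2 sqrtr_sqr.
have p0 := pi_gt0 R.
have [y0|y0] := leP 0 y.
  exists (acos x); first by apply/andP; split; lra.
  rewrite cx sx ger0_norm//; split=> // yp.
  have x11 : -1 < x < 1.
    by rewrite -ltr_norml -ltr_sqr ?nnegrE// expr1n real_normK ?num_real// h ltrDl exprn_gt0.
  have [x12 x13] := andP x11.
  by rewrite acos_gt0 ?acos_ltpi ?x12 ?x13 ?(ltW x12) ?(ltW x13).
exists (pi - acos x + pi); first by apply/andP; split; lra.
rewrite cosDpi sinDpi cosB sinB cospi sinpi cx sx ltr0_norm//; split=> [|yp]; last lra.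
by congr (_ +i* _); ring.
Qed.

Lemma unit_pow_arg (t : R) n : (cos t +i* sin t) ^+ n = cos (n%:R * t) +i* sin (n%:R * t) :> C.
Proof.
elim: n => [|n IH]; first by rewrite expr0 mul0r cos0 sin0.
rewrite exprS IH -[n.+1%:R]natr1 mulrDl mul1r cosD sinD.
by apply/eqP; rewrite eq_complex /=; apply/andP; split; apply/eqP; ring.
Qed.

Lemma cmod_arg_sub (s t : R) :
  cmod ((cos s +i* sin s) - (cos t +i* sin t)) ^+ 2 = 2 - 2 * cos (s - t).
Proof.
rewrite cmod_sqr /= cosB; have := cos2Dsin2 s; have := cos2Dsin2 t => h1 h2.
have -> : (cos s - cos t) ^+ 2 + (sin s - sin t) ^+ 2 = (cos s ^+ 2 + sin s ^+ 2) +
    (cos t ^+ 2 + sin t ^+ 2) - 2 * (cos s * cos t + sin s * sin t) by ring.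
by rewrite h1 h2; ring.
Qed.

(** With [p] in []0, pi[] the angle of [be], the last multiple of [p] below the angle of [ze]
    differs from it by at most [p]; chords grow with the angle on [[0, pi]]. Angles up to [2 * pi]
    bound the exponent. *)
Lemma unit_pow_net (be : C) : cmod be = 1 -> 0 < complex.Im be -> exists L : nat,
  forall ze, cmod ze = 1 -> exists2 n, (n <= L)%N & cmod (be ^+ n - ze) <= cmod (be - 1).
Proof.
move=> be1 Im0; have [p _ [bE /(_ Im0)/andP[p0 ppi]]] := unit_arg be1.
rewrite {be1 Im0}bE.
exists (Num.Def.truncn (2 * pi / p)) => ze /unit_arg[t /andP[t0 t1] [-> _]].
exists (Num.Def.truncn (t / p)).
  by apply: le_truncn; rewrite ler_pM2r ?invr_gt0.
set n := Num.Def.truncn _.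
have tp : 0 <= t / p by rewrite divr_ge0// ltW.
have n1 : n%:R * p <= t by rewrite -ler_pdivlMr// truncn_le.
have n2 : t < n%:R * p + p.
  by rewrite -[X in _ + X]mul1r -mulrDl natr1 -ltr_pdivrMr// truncnS_gt.
rewrite unit_pow_arg -ler_sqr ?nnegrE ?cmod_ge0//.
have -> : (1 : C) = cos 0 +i* sin 0 by rewrite cos0 sin0.
rewrite !cmod_arg_sub subr0 lerD2l lerN2 ler_pM2l// -(cosN (n%:R * p - t)) opprB.
have h : t - n%:R * p <= p by lra.
rewrite leNgt ltr_cos -?leNgt// in_itv /=; apply/andP; split; lra.
Qed.

(** A power [be] of [al] close to [1] is not real: it differs from [1] by hypothesis and from [-1]
    because [cmod (be - 1) < 1]. Its powers, or those of its conjugate, then form a net of mesh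
    [cmod (be - 1)]. *)
Lemma unit_pow_dense (al : C) : cmod al = 1 -> (forall k, (0 < k)%N -> al ^+ k != 1) ->
  forall d : R, 0 < d -> exists L : nat, forall ze, cmod ze = 1 ->
    exists2 q, (q <= L)%N & cmod (al ^+ q - ze) < d.
Proof.
move=> al1 alk d d0; have d10 : 0 < Num.min d 1 by rewrite lt_min d0 ltr01.
have [p p0] := unit_power_recurrent al1 d10; rewrite lt_min => /andP[hp hp1].
set be := al ^+ p in hp hp1.
have be1 : cmod be = 1 by rewrite cmodX al1 expr1n.
have Im0 : complex.Im be != 0.
  apply: contraTneq (alk p p0); rewrite -/be negbK => Im0.
  have := cmod_sqr be; rewrite be1 expr1n Im0.
  have := le_lt_trans (Re_le_cmod _) hp1; have := le_lt_trans (Re_le_cmod _) (_ : cmod (1 - be) < 1).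
  rewrite cmodBC => /(_ hp1); case: be {be1 hp hp1} Im0 => x y /= -> h1 h2 h3.
  have e : (x - 1) * (x + 1) = x ^+ 2 + 0 ^+ 2 - 1 by ring.
  have : (x - 1) * (x + 1) == 0 by rewrite e -h3 subrr.
  rewrite mulf_eq0 => /orP[|]/eqP h4; last lra.
  by rewrite (_ : x = 1)//; lra.
have [L hL] : exists L : nat, forall ze, cmod ze = 1 ->
    exists2 n, (n <= L)%N & cmod (be ^+ n - ze) <= cmod (be - 1).
  have [Im_gt|Im_lt] : 0 < complex.Im be \/ 0 < complex.Im be^*.
    by case: be Im0 {be1 hp hp1} => x y /=; rewrite neq_lt => /orP[]; [right|left]; rewrite ?oppr_gt0.
  - exact: unit_pow_net.
  - have [L hL] := @unit_pow_net be^* ltac:(by rewrite cmod_conj) Im_lt.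
    exists L => ze ze1; have [n nL hn] := hL ze^* ltac:(by rewrite cmod_conj).
    have e1 : cmod (be^* - 1) = cmod (be - 1).
      by case: (be) => x y; rewrite /cmod /=; congr Num.sqrt; ring.
    exists n => //; rewrite -cmod_conj -e1 rmorphB /= rmorphXn /=.
    exact: hn.
exists (p * L)%N => ze /hL[n nL hn]; exists (p * n)%N; first by rewrite leq_mul2l nL orbT.
by rewrite exprM (le_lt_trans hn).
Qed.

Lemma cmod_pow_sub1_le (be : C) m : cmod be = 1 -> cmod (be ^+ m - 1) <= m%:R * cmod (be - 1).
Proof.
move=> be1; elim: m => [|m IH]; first by rewrite expr0 subrr cmod0 mul0r.
have -> : be ^+ m.+1 - 1 = be * (be ^+ m - 1) + (be - 1) by rewrite exprS; ring.
by rewrite (le_trans (cmodD _ _))// cmodM be1 mul1r -natr1 mulrDl mul1r lerD2r.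
Qed.

Lemma geometric_sum_le (be : C) m : cmod be = 1 -> be != 1 ->
  cmod (\sum_(1 <= k < m.+1) be ^+ k) <= 2 / cmod (be - 1).
Proof.
move=> be1 bene; rewrite ler_pdivlMr ?cmod_gt0 ?subr_eq0// -cmodM.
have -> : (\sum_(1 <= k < m.+1) be ^+ k) * (be - 1) = be ^+ m.+1 - be.
  elim: m => [|m IH]; first by rewrite big_geq// mul0r expr1 subrr.
  by rewrite big_nat_recr//= mulrDl IH !exprS; ring.
by rewrite (le_trans (cmodB _ _))// cmodX be1 expr1n.
Qed.

End IrrationalRotation.

(** * Mean ergodicity for elliptic automorphisms *)

Section Elliptic.
Variable R : realType.
Local Notation C := R[i].
Local Notation A := (disc_algebra R).
Variable phi : disc_symbol R.
Local Notation T := (composition_operator phi).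

(** With [c] the mean over one period, the sum of [f - c] over a full period vanishes. Removing
    periods leaves fewer than [k] terms, each of modulus at most [2 * M]. *)
Lemma periodic_cesaro_bound k (f : A) (z : C) (M : R) : (0 < k)%N ->
  (forall w, cmod w <= 1 -> iter k phi w = w) ->
  (forall w, cmod w <= 1 -> cmod (f w) <= M) -> 0 <= M -> cmod z <= 1 ->
  forall n, (0 < n)%N ->
  cmod (cesaro_mean T n f z - cesaro_mean T k f z) * n%:R <= k%:R * (2 * M).
Proof.
move=> k0 per fM M0 z1 n n0; pose c := cesaro_mean T k f z.
have cM : cmod c <= M by exact: cesaro_mean_le.
have kC : k%:R != 0 :> C by rewrite pnatr_eq0 -lt0n.
have nC : n%:R != 0 :> C by rewrite pnatr_eq0 -lt0n.
pose D j := \sum_(1 <= m < j.+1) (f (iter m phi z) - c).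
have DE j : (0 < j)%N -> cesaro_mean T j f z - c = j%:R^-1 * D j.
  by move=> j0; exact: cesaro_mean_subE.
have Dk : D k = 0.
  have := DE k k0; rewrite subrr => /esym/eqP; rewrite mulf_eq0 invr_eq0 (negbTE kC).
  by move/eqP.
have Dsplit j : (k <= j)%N -> D j = D (j - k)%N.
  move=> kj; rewrite /D (@big_cat_nat _ _ _ k.+1)//= -/(D k) Dk add0r.
  rewrite -{1}[k.+1]add1n big_addn subSn//; apply: eq_bigr => m _.
  by rewrite iterD per.
have Dbound j : cmod (D j) <= k%:R * (2 * M).
  elim/ltn_ind: j => j IH; have [jk|kj] := ltnP j k; last first.
    by rewrite Dsplit//; apply: IH; rewrite ltn_subrL k0 (leq_trans k0).
  rewrite (le_trans (cmod_sum _ _ _))//.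
  rewrite (le_trans (ler_sum _ (G := fun=> 2 * M) _))//.
    move=> m _; rewrite (le_trans (cmodB _ _))// mulr2n mulrDl mul1r lerD//.
    by apply: fM; exact: iter_cdisc.
  rewrite sumr_const_nat subSS subn0 -[leLHS]mulr_natl ler_wpM2r ?mulr_ge0// ler_nat.
  exact: ltnW.
rewrite -/c DE// cmodM cmodV -realcn cmod_real normr_nat mulrAC mulVf ?mul1r//.
by rewrite pnatr_eq0 -lt0n.
Qed.

Lemma periodic_cesaro_cvg k : (0 < k)%N -> (forall w, cmod w <= 1 -> iter k phi w = w) ->
  forall (M e : R), 0 <= M -> 0 < e -> exists N, forall n, (N <= n)%N -> forall f : A,
    (forall w, cmod w <= 1 -> cmod (f w) <= M) ->
    forall z, cmod z <= 1 -> cmod (cesaro_mean T n f z - cesaro_mean T k f z) <= e.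
Proof.
move=> k0 per M e M0 e0; exists (Num.Def.truncn (k%:R * (2 * M) / e)).+1 => n nn f fM z z1.
have n0 : (0 < n)%N by exact: leq_ltn_trans nn.
have nR : 0 < n%:R :> R by rewrite ltr0n.
rewrite -(ler_pM2r nR) (le_trans (periodic_cesaro_bound k0 per fM M0 z1 n0))//.
by rewrite [leRHS]mulrC -ler_pdivrMr// (le_trans (ltW (truncnS_gt _)))// ler_nat.
Qed.

Lemma periodic_mean_ergodic k : (0 < k)%N -> (forall w, cmod w <= 1 -> iter k phi w = w) ->
  mean_ergodic T.
Proof.
move=> k0 per; apply: mean_ergodic_of_cvg => f; exists (cesaro_mean T k f).
apply/disc_cvgP => e e0.
have [N hN] := periodic_cesaro_cvg k0 per (sup_norm_ge0 f) e0.
by exists N => n nN z z1; apply: hN => // w; exact: cmod_le_sup_norm.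
Qed.

Lemma periodic_uniformly_mean_ergodic k : (0 < k)%N ->
  (forall w, cmod w <= 1 -> iter k phi w = w) -> uniformly_mean_ergodic T.
Proof.
move=> k0 per; apply: uniformly_mean_ergodic_of_cvg; first exact: periodic_mean_ergodic per.
move=> e e0; have e3 : 0 < e / 3 by rewrite divr_gt0.
have [N hN] := periodic_cesaro_cvg k0 per ler01 e3.
exists N => n nN f g f1 /disc_cvgP cg z z1.
have fM : forall w, cmod w <= 1 -> cmod (f w) <= 1 by apply/disc_norm_leP.
have [N' hN'] := cg _ e3.
have h1 := hN n nN f fM z z1.
have h2 := hN (maxn N N') (leq_maxl _ _) f fM z z1.
have h3 := hN' (maxn N N') (leq_maxr _ _) z z1.
move: (cesaro_mean T n f z) (cesaro_mean T k f z) (cesaro_mean T (maxn N N') f z) h1 h2 h3.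
move=> x y w h1; rewrite cmodBC => h2 h3.
have := cmod_distD y x (g z); have := cmod_distD w y (g z).
move: h1 h2 h3; clear; lra.
Qed.

Lemma periodic_elliptic_iter : periodic_elliptic_automorphism phi ->
  exists2 k, (0 < k)%N & forall w, cmod w <= 1 -> iter k phi w = w.
Proof.
move=> [la /unit_circleE la1 [[_ [psi [[_ [spsi ipsi ssi]] e]]] [k k0 lak]]].
exists k => //; have psiKV u : cmod u < 1 -> 'pinv_(fun=> 0) (@unit_disc R) psi (psi u) = u.
  by move=> u1; apply: pinvKV => //; apply/mem_set; rewrite unit_discE.
have psi1 u : cmod u < 1 -> cmod (psi u) < 1 by rewrite -!unit_discE; exact: spsi.
have iterpsi u n : cmod u < 1 -> iter n phi (psi u) = psi (la ^+ n * u).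
  move=> u1; elim: n => [|n IH]; first by rewrite mul1r.
  have v1 : cmod (la ^+ n * u) < 1 by rewrite cmodM cmodX la1 expr1n mul1r.
  by rewrite iterS IH e ?unit_discE ?psi1// psiKV// exprS mulrA.
apply: (@within_disc_eq R (iter k phi) id).
- exact: within_disc_iter.
- by move=> z _ g g0; exists g.
move=> z; rewrite -unit_discE => /ssi[u /=]; rewrite unit_discE => u1 <-.
by rewrite iterpsi// lak mul1r.
Qed.

Section Rotation.
Variables (a al : C).
Hypothesis a1 : cmod a < 1.
Hypothesis al1 : cmod al = 1.
Hypothesis rot : forall z, cmod z < 1 -> moebius a (phi z) = al * moebius a z.

Lemma rotation_cdisc z : cmod z <= 1 -> moebius a (phi z) = al * moebius a z.
Proof.
have cM : within_disc (moebius a).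
  by apply: derivable_within_disc => w w1; exact: derivable_moebius.
move: z; apply: (@within_disc_eq R (fun z => moebius a (phi z)) (fun z => al * moebius a z)) => //.
- apply: within_disc_comp cM; first by move=> z; exact: symbol_cdisc.
  exact: within_disc_algebra.
- apply: derivable_within_disc => w w1; apply: derivable_mul; first exact: derivable_cst.
  exact: derivable_moebius.
Qed.

Lemma rotation_iter m z : cmod z <= 1 -> moebius a (iter m phi z) = al ^+ m * moebius a z.
Proof.
move=> z1; elim: m => [|m IH]; first by rewrite mul1r.
by rewrite iterS rotation_cdisc ?iter_cdisc// IH exprS mulrA.
Qed.

Lemma iter_rotation m z : cmod z <= 1 -> iter m phi z = moebius (- a) (al ^+ m * moebius a z).
Proof. by move=> z1; rewrite -rotation_iter// moebiusK// iter_cdisc. Qed.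

Lemma rotation_periodic k : al ^+ k = 1 -> forall w, cmod w <= 1 -> iter k phi w = w.
Proof. by move=> alk w w1; rewrite iter_rotation// alk mul1r moebiusK. Qed.

Hypothesis alk : forall k, (0 < k)%N -> al ^+ k != 1.

(* The means of [f] become almost constant on each circle centred at the fixed point,
   since the powers of [al] are dense; the maximum principle carries this to the centre. *)
Lemma irrational_cesaro_cvg (f : A) (e : R) : 0 < e -> exists N, forall n, (N <= n)%N ->
  forall z, cmod z <= 1 -> cmod (cesaro_mean T n f z - f a) <= e.
Proof.
move=> e0; have a1' : cmod (- a) < 1 by rewrite cmodN.
pose h u := f (moebius (- a) u).
have mN1 u : cmod u <= 1 -> cmod (moebius (- a) u) <= 1 by exact: cmod_moebius_le1.
have ch : within_disc h.
  apply: within_disc_comp (@within_disc_algebra R f); first exact: mN1.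
  by apply: derivable_within_disc => w w1; exact: derivable_moebius.
have dh u : cmod u < 1 -> derivable h u 1.
  move=> u1; apply: derivable_comp; first by apply: derivable_moebius => //; exact: ltW.
  by apply: disc_fun_holomorphic; rewrite unit_discE cmod_moebius_lt1.
pose H := sup_norm f; have H0 : 0 <= H := sup_norm_ge0 f.
have hH u : cmod u <= 1 -> cmod (h u) <= H by move=> u1; apply: cmod_le_sup_norm; exact: mN1.
pose B n u := n%:R^-1 * \sum_(1 <= m < n.+1) h (al ^+ m * u).
have BE n z : cmod z <= 1 -> cesaro_mean T n f z = B n (moebius a z).
  move=> z1; rewrite cesaro_meanE//; congr (_ * _); apply: eq_bigr => m _.
  by rewrite iter_rotation.
have rot1 m u : cmod (al ^+ m * u) = cmod u by rewrite cmodM cmodX al1 expr1n mul1r.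
have e2 : 0 < e / 2 by rewrite divr_gt0.
have [d d0 hd] := heine_cantor_cmod (cball_compact (@ltr01 R)) ch e2.
have [L hL] := unit_pow_dense al1 alk d0.
(* Rotating by [al] shifts the sum by one index, so the difference telescopes to two end terms. *)
have shift n u : (0 < n)%N -> cmod u <= 1 ->
    cmod (B n (al * u) - B n u) * n%:R <= 2 * H.
  move=> n0 u1; have nC : n%:R != 0 :> C by rewrite pnatr_eq0 -lt0n.
  have -> : B n (al * u) - B n u = n%:R^-1 * (h (al ^+ n.+1 * u) - h (al ^+ 1 * u)).
    rewrite /B -mulrBr -sumrB; congr (_ * _).
    rewrite (telescope_sumr_eq (fun m => h (al ^+ m * u)))//.
    by move=> m _; rewrite mulrA -exprSr.
  rewrite cmodM cmodV -realcn cmod_real normr_nat mulrAC mulVf ?mul1r; last first.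
    by rewrite pnatr_eq0 -lt0n.
  by rewrite (le_trans (cmodB _ _))// mulr2n mulrDl mul1r lerD// hH// rot1.
have shiftq n q u : (0 < n)%N -> cmod u <= 1 ->
    cmod (B n (al ^+ q * u) - B n u) * n%:R <= q%:R * (2 * H).
  move=> n0 u1; elim: q => [|q IH]; first by rewrite mul1r subrr cmod0 !mul0r.
  have h1 := shift n (al ^+ q * u) n0 ltac:(by rewrite rot1).
  rewrite -[q.+1%:R]natr1 mulrDl mul1r exprS -mulrA.
  have := cmod_distD (B n (al ^+ q * u)) (B n (al * (al ^+ q * u))) (B n u).
  rewrite -(ler_pM2r (_ : 0 < n%:R)) ?ltr0n// mulrDl; move: IH h1; clear; lra.
have near_circle n u v : (0 < n)%N -> cmod u <= 1 -> cmod v = cmod u ->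
    cmod (B n v - B n u) * n%:R <= e / 2 * n%:R + L%:R * (2 * H).
  move=> n0 u1 vu; have [u0|u0] := eqVneq u 0.
    have -> : v = u by apply/eqP; rewrite u0 -cmod_eq0 vu u0 cmod0.
    by rewrite subrr cmod0 mul0r addr_ge0// ?mulr_ge0// ltW.
  have [q qL hq] := hL (v / u) ltac:(by rewrite cmodM cmodV vu divff// cmod_eq0).
  have h1 : cmod (B n v - B n (al ^+ q * u)) * n%:R <= e / 2 * n%:R.
    rewrite ler_wpM2r// /B -mulrBr -sumrB cmodM cmodV -realcn cmod_real normr_nat.
    rewrite ler_pdivrMl ?ltr0n// (le_trans (cmod_sum _ _ _))//.
    rewrite (le_trans (ler_sum _ (G := fun=> e / 2) _))//; last first.
      by rewrite sumr_const_nat subSS subn0 mulr_natl.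
    move=> m _; apply/ltW/hd; rewrite /cball /= ?rot1 ?vu//.
    rewrite -mulrBr rot1.
    have -> : v - al ^+ q * u = - ((al ^+ q - v / u) * u) by field.
    by rewrite cmodN cmodM (le_lt_trans _ hq)// ler_piMr ?cmod_ge0.
  have h2 := shiftq n q u n0 u1.
  have h3 : q%:R * (2 * H) <= L%:R * (2 * H) by rewrite ler_wpM2r ?mulr_ge0// ler_nat.
  have := cmod_distD (B n (al ^+ q * u)) (B n v) (B n u).
  rewrite -(ler_pM2r (_ : 0 < n%:R)) ?ltr0n// mulrDl; move: h1 h2 h3; clear; lra.
have dB n u : cmod u < 1 -> derivable (B n) u 1.
  move=> u1; apply: derivable_mul; first exact: derivable_cst.
  elim: n.+1 => [|j IH].
    have -> : (fun w : C => \sum_(1 <= m < 0) h (al ^+ m * w)) = (fun=> 0).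
      by apply/funext => w; rewrite big_geq.
    exact: derivable_cst.
  have [j0|j0] := posnP j.
    have -> : (fun w : C => \sum_(1 <= m < j.+1) h (al ^+ m * w)) = (fun=> 0).
      by apply/funext => w; rewrite big_geq// j0.
    exact: derivable_cst.
  have -> : (fun w : C => \sum_(1 <= m < j.+1) h (al ^+ m * w)) =
      (fun w => \sum_(1 <= m < j) h (al ^+ m * w) + h (al ^+ j * w)).
    by apply/funext => w; rewrite big_nat_recr.
  apply: derivable_add; first exact: IH.
  apply: derivable_comp; last by apply: dh; rewrite rot1.
  by apply: derivable_mul; [exact: derivable_cst|exact: derivable_id].
exists (Num.Def.truncn (L%:R * (2 * H) / (e / 2))).+1 => n nn.
have n0 : (0 < n)%N by exact: leq_ltn_trans nn.
have nR : 0 < n%:R :> R by rewrite ltr0n.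
have LH : L%:R * (2 * H) <= e / 2 * n%:R.
  by rewrite -ler_pdivrMl// mulrC (le_trans (ltW (truncnS_gt _)))// ler_nat.
(* In the coordinate [moebius a] the fixed point is [0], and every term of its mean is [f a]. *)
have fa : f a = B n 0.
  have nC : n%:R != 0 :> C by rewrite pnatr_eq0 -lt0n.
  rewrite /B (eq_bigr (fun=> f a)).
    by rewrite sumr_const_nat subSS subn0 -(mulr_natl (f a)) mulKf.
  by move=> m _; rewrite mulr0 /h moebius0 opprK.
(* The maximum principle is applied to [v |-> B n v - B n u] on the disc whose boundary circle
   passes through [u], and evaluated at [v = 0]. *)
have inside u : cmod u < 1 -> cmod (B n u - B n 0) <= e.
  move=> u1; rewrite cmodBC.
  apply: (@maximum_modulus R (fun v => B n v - B n u) (cmod u) e u1).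
  - by move=> v; rewrite unit_discE => v1; apply: derivable_sub_cst; exact: dB.
  - move=> v vu; rewrite -(ler_pM2r nR) (le_trans (near_circle n u v n0 (ltW u1) vu))//.
    have -> : e * n%:R = e / 2 * n%:R + e / 2 * n%:R by field.
    by rewrite lerD2l.
  - by rewrite cmod0 cmod_ge0.
have within_C : within_disc (fun z => cesaro_mean T n f z - f a).
  move=> z z1 g g0; have [d' d'0 hd'] := within_disc_algebra (cesaro_mean T n f) z1 g0.
  exists d' => // w w1 /(hd' w w1); congr (cmod _ < _).
  by move: (cesaro_mean T n f w) (cesaro_mean T n f z) => x y; ring.
move=> z z1; move: z z1; apply: (within_disc_le within_C) => z z1.
by rewrite BE ?(ltW z1)// fa; apply: inside; exact: cmod_moebius_lt1.
Qed.

Lemma irrational_mean_ergodic : mean_ergodic T.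
Proof.
apply: mean_ergodic_of_cvg => f.
have [|g hg|g hg] := @disc_algebra_exists R (fun=> f a).
- by move=> z _ e e0; exists 1 => // w _ _; rewrite subrr cmod0.
- exact: derivable_cst.
exists g; apply/disc_cvgP => e e0; have [N hN] := irrational_cesaro_cvg f e0.
by exists N => n nN z z1; rewrite hg//; exact: hN.
Qed.

(* The eigenfunctions [moebius a ^+ j] have eigenvalues [al ^+ j] arbitrarily close to [1]. *)
Lemma irrational_not_uniformly_mean_ergodic : ~ uniformly_mean_ergodic T.
Proof.
move=> ume; have e40 : (0 : R) < 4^-1 by rewrite invr_gt0.
have [N hN] := uniformly_mean_ergodic_cauchy ume e40.
(* Since [cmod (be ^+ m - 1) <= m * cmod (be - 1)], an eigenvalue this close to [1] moves by at most
   [1 / 2] within [n] steps. *)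
pose n := N.+1; have d0 : 0 < (2 * n%:R)^-1 :> R by rewrite invr_gt0 mulr_gt0// ltr0n.
have [j j0 hj] := unit_power_recurrent al1 d0.
pose be := al ^+ j; have be1 : cmod be = 1 by rewrite cmodX al1 expr1n.
have bene : be != 1 by exact: alk.
have dM z : cmod z <= 1 -> derivable (fun w => moebius a w ^+ j) z 1.
  by move=> z1; apply: derivable_pow; exact: derivable_moebius.
have [|z z1|F hF] := @disc_algebra_exists R (fun w => moebius a w ^+ j).
- exact: derivable_within_disc.
- by apply: dM; exact: ltW.
have F1 z : cmod z <= 1 -> cmod (F z) <= 1.
  by move=> z1; rewrite hF// cmodX exprn_ile1 ?cmod_ge0// cmod_moebius_le1.
have c1 : cmod (1 : C) <= 1 by rewrite cmod1.
(* The test point [1] lies on the circle, where the eigenfunction has modulus one. *)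
pose u := moebius a 1 ^+ j.
have u1 : cmod u = 1.
  have m1 : cmod (moebius a 1) = 1.
    apply/eqP; rewrite -(@eqrXn2 _ 2) ?cmod_ge0// cmod_moebius_sqr// cmod1 expr1n.
    by rewrite subrr mulr0 mul0r subr0.
  by rewrite cmodX m1 expr1n.
have Fiter m : F (iter m phi 1) = be ^+ m * u.
  rewrite hF ?iter_cdisc// rotation_iter// exprMn /u /be -!exprM mulnC//.
have h1 : cmod (cesaro_mean T n F 1 - u) <= 2^-1.
  have nR : 0 < n%:R :> R by rewrite ltr0n.
  rewrite -(ler_pM2r nR) (le_trans (cesaro_mean_sub_le phi F u (ltn0Sn N) c1))//.
  have -> : 2^-1 * n%:R = \sum_(1 <= m < n.+1) 2^-1 :> R.
    by rewrite sumr_const_nat subSS subn0 mulr_natr.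
  rewrite big_nat [leRHS]big_nat; apply: ler_sum => m /andP[_ mn].
  rewrite Fiter -[u in _ - u]mul1r -mulrBl cmodM u1 mulr1.
  rewrite (le_trans (cmod_pow_sub1_le m be1))//.
  rewrite (le_trans (ler_pM _ _ (_ : _ <= n%:R) (ltW hj)))// ?cmod_ge0 ?ler_nat//.
  by rewrite invfM mulrA mulrAC divff ?mul1r// gt_eqF.
(* The geometric sum is at most [2 / cmod (be - 1)], so the mean of length [m] is at most [1 / 8];
   the contradiction is [1 <= 1 / 2 + 1 / 4 + 1 / 8]. *)
pose m := maxn N (Num.Def.truncn (8 * (2 / cmod (be - 1)))).+1.
have m0 : (0 < m)%N by rewrite /m leq_max orbT.
have h2 : cmod (cesaro_mean T m F 1) <= 8^-1.
  rewrite cesaro_meanE// (eq_bigr _ (fun i _ => Fiter i)) -mulr_suml mulrA cmodM u1 mulr1.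
  rewrite cmodM cmodV -realcn cmod_real normr_nat ler_pdivrMl ?ltr0n//.
  rewrite (le_trans (geometric_sum_le m be1 bene))// ler_pdivlMr// mulrC.
  rewrite (le_trans (ltW (truncnS_gt _)))// ler_nat leq_max leqnn orbT//.
have h3 := hN n m (leqnSn _) (leq_maxl _ _) F F1 1 c1.
move: (cesaro_mean T n F 1) (cesaro_mean T m F 1) h1 h2 h3 => x y.
have := cmodD (u - x) x; have := cmodD (x - y) y; rewrite !subrK u1 (cmodBC u x).
have : 8 * 8^-1 = 1 :> R by field.
have : 2 * 2^-1 = 1 :> R by field.
have : 4 * 4^-1 = 1 :> R by field.
lra.
Qed.

End Rotation.
End Elliptic.

Theorem theoremB1 (R : realType) (phi : disc_symbol R)
    (no_interior_denjoy_wolff :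
      ~ exists2 z0 : R[i], unit_disc z0 & denjoy_wolff_point phi z0) :
  (mean_ergodic (composition_operator phi) <->
    elliptic_automorphism phi \/
    exists z0 : R[i], [/\ unit_circle z0, denjoy_wolff_point phi z0 &
      forall (z : R[i]) (U : set R[i]), closed_disc z -> nbhs z0 U ->
        has_density [set n : nat | U (iter n phi z)] (1 : R)]) /\
  (mean_ergodic (composition_operator phi) ->
    (uniformly_mean_ergodic (composition_operator phi) <->
     periodic_elliptic_automorphism phi)).
Proof.
have dphi := @symbol_derivable R phi; have phi1 := @symbol_disc R phi.
have forward : mean_ergodic (composition_operator phi) -> elliptic_automorphism phi \/
    exists z0 : R[i], [/\ unit_circle z0, denjoy_wolff_point phi z0 &
      forall (z : R[i]) (U : set R[i]), closed_disc z -> nbhs z0 U ->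
        has_density [set n : nat | U (iter n phi z)] (1 : R)].
  move=> me; have [ell|nell] := pselect (elliptic_automorphism phi); first by left.
  have [z0 z01 dw] := denjoy_wolff dphi phi1 nell; right; exists z0.
  have z0_1 : cmod z0 = 1.
    apply/eqP; rewrite eq_le z01 leNgt /=; apply/negP => z0_lt.
    by apply: no_interior_denjoy_wolff; exists z0; rewrite // unit_discE.
  split; [exact/unit_circleE|exact: dw|move=> z U].
  rewrite closed_discE; apply: (mean_ergodic_density me z0_1) => w w1 e e0.
  have [_ _ unif] := dw.
  have /uniform_cvg_cmodP/(_ e e0)[N hN] := unif _ (@compact_set1 _ w)
    ltac:(by move=> v /= ->; rewrite unit_discE).
  by exists N => n /hN; apply.
(* The multiplier [al] in the Moebius coordinate decides between the two cases; if it is a root of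
   unity, it also witnesses periodicity in the converse. *)
have ell_cases : elliptic_automorphism phi -> exists a al, [/\ cmod a < 1, cmod al = 1,
    forall z, cmod z < 1 -> moebius a (phi z) = al * moebius a z &
    (exists2 k, (0 < k)%N & al ^+ k = 1) \/ forall k, (0 < k)%N -> al ^+ k != 1].
  move=> /elliptic_moebius[a [al [a1 al1 _ rot]]]; exists a, al; split => //.
  have [[k k0 alk]|nk] := pselect (exists2 k, (0 < k)%N & al ^+ k = 1).
    by left; exists k.
  by right=> k k0; apply/eqP => alk; apply: nk; exists k.
split; first split; first exact: forward.
- case=> [/ell_cases[a [al [a1 al1 rot [[k k0 alk]|alk]]]]|[z0 [/unit_circleE z01 _ dens]]].
  + exact: (periodic_mean_ergodic k0 (rotation_periodic a1 rot alk)).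
  + exact: (irrational_mean_ergodic a1 al1 rot alk).
  + by apply: (@density_mean_ergodic R phi z0) => //; rewrite z01.
- move=> me; split=> [ume|/periodic_elliptic_iter[k k0 per]]; last first.
    exact: periodic_uniformly_mean_ergodic per.
  have [/ell_cases[a [al [a1 al1 rot [[k k0 alk]|alk]]]]|[z0 [/unit_circleE z01 _ dens]]] := forward me.
  + exists al; first exact/unit_circleE.
    by split; [exact: conjugate_to_rotation_moebius rot|exists k].
  + by case: (irrational_not_uniformly_mean_ergodic a1 al1 rot alk ume).
  + by case: (boundary_not_uniformly_mean_ergodic z01 dens ume).
Qed.
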